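(* Suppose $V$ is $\alpha$-strongly convex and $\beta$-smooth ($0<\alpha\le\beta$), let $\hat\pi$ be the minimizer of $\mathcal F$ over $\mathsf{BW}(\mathbb R^d)$, and let $0<\eta\le\frac{\alpha^2}{48\beta^3}$. Then the iterates of Stochastic FB--GVI satisfy, for every $N\ge0$, $$\mathbb E\,W_2^2(p_N,\hat\pi)\le\exp\Big(-\frac{\alpha N\eta}{2}\Big)W_2^2(p_0,\hat\pi)+\frac{24\beta\eta d}{\alpha}.$$
   Context: $\mathsf{BW}(\mathbb R^d)$ is the set of Gaussian distributions $\mathcal N(m,\Sigma)$ on $\mathbb R^d$ with $m\in\mathbb R^d$ and $\Sigma$ symmetric positive definite, endowed with the 2-Wasserstein distance $W_2$. $V:\mathbb R^d\to\mathbb R$ is twice continuously differentiable; it is $\beta$-smooth if $-\beta I\preceq\nabla^2V(x)\preceq\beta I$ for all $x$, and $\alpha$-strongly convex ($\alpha>0$) if $\alpha I\preceq\nabla^2V(x)$ for all $x$. Potential $\mathcal V(\mu)=\int V\,d\mu$, entropy $\mathcal H(\mu)=\int\log\mu(x)\,d\mu(x)$ (identifying $\mu$ with its Lebesgue density), $\mathcal F=\mathcal V+\mathcal H$. Stochastic FB--GVI with step size $\eta>0$ and initialization $p_0=\mathcal N(m_0,\Sigma_0)\in\mathsf{BW}(\mathbb R^d)$: given $p_k=\mathcal N(m_k,\Sigma_k)$, draw $\hat X_k\sim p_k$ independently of everything else conditionally on the past, set $b_k=\nabla V(\hat X_k)$, $S_k=\nabla^2V(\hat X_k)$, $m_{k+1}=m_k-\eta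 b_k$, $\Sigma_{k+1/2}=(I-\eta S_k)\Sigma_k(I-\eta S_k)$, $\Sigma_{k+1}=\tfrac12\big(\Sigma_{k+1/2}+2\eta I+[\Sigma_{k+1/2}(\Sigma_{k+1/2}+4\eta I)]^{1/2}\big)$ (principal PSD square root; the two factors commute), and $p_{k+1}=\mathcal N(m_{k+1},\Sigma_{k+1})$ (a random Gaussian). Expectations are over all the randomness of the samples. *)

(* Defs.v *)
From mathcomp Require Import all_boot all_order all_algebra.
From mathcomp Require Import all_classical all_reals all_analysis.

Set Implicit Arguments.
Unset Strict Implicit.
Unset Printing Implicit Defensive.

Import Order.TTheory GRing.Theory Num.Theory.
Import numFieldNormedType.Exports.

Local Open Scope classical_set_scope.
Local Open Scope ring_scope.

Section FBGVI.
Variables (R : realType) (d : nat).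

(** Points of R^d, for integration, are d-tuples (the library equips
    d.-tuple R with the product Borel sigma-algebra); for linear algebra and
    differentiation we use row vectors 'rV[R]_d.  *)
Definition row_of (t : d.-tuple R) : 'rV[R]_d := \row_i tnth t i.

(** Lebesgue integral over R^d, written as iterated one-dimensional Lebesgue
    integrals (Tonelli/Fubini). *)
Fixpoint lebint (n : nat) : (n.-tuple R -> \bar R) -> \bar R :=
  match n return (n.-tuple R -> \bar R) -> \bar R with
  | 0 => fun f => f [tuple]
  | n'.+1 => fun f =>
      (\int[@lebesgue_measure R]_(x in [set: R])
          lebint (fun t : n'.-tuple R => f [tuple of x :: t]))%E
  end.

Definition qform (A : 'M[R]_d) (u : 'rV[R]_d) : R :=
  \sum_(i < d) \sum_(j < d) u 0 i * A i j * u 0 j.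

Definition sqnorm (u : 'rV[R]_d) : R := \sum_(i < d) u 0 i ^+ 2.

Definition spd (A : 'M[R]_d) : Prop :=
  A^T = A /\ forall u : 'rV[R]_d, u != 0 -> 0 < qform A u.
Definition spsd (A : 'M[R]_d) : Prop :=
  A^T = A /\ forall u : 'rV[R]_d, 0 <= qform A u.

Definition sqrtm (A : 'M[R]_d) : 'M[R]_d :=
  xget 0 [set B : 'M[R]_d | spsd B /\ B *m B = A].

Definition gauss_density (m : 'rV[R]_d) (S : 'M[R]_d) (x : 'rV[R]_d) : R :=
  (Num.sqrt ((2 * pi) ^+ d * \det S))^-1 *
  expR (- (qform (invmx S) (x - m)) / 2).

Definition gauss (m : 'rV[R]_d) (S : 'M[R]_d) (A : set (d.-tuple R)) : \bar R :=
  lebint (fun t => ((\1_A t) * gauss_density m S (row_of t))%:E).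

Definition gauss_int (m : 'rV[R]_d) (S : 'M[R]_d) (f : 'rV[R]_d -> \bar R) : \bar R :=
  lebint (fun t => ((gauss_density m S (row_of t))%:E * f (row_of t))%E).

Definition coupling (mu nu : set (d.-tuple R) -> \bar R)
  (g : probability (d.-tuple R * d.-tuple R)%type R) : Prop :=
  (forall A, measurable A -> g (A `*` [set: d.-tuple R]) = mu A) /\
  (forall B, measurable B -> g ([set: d.-tuple R] `*` B) = nu B).

Definition W2sq (mu nu : set (d.-tuple R) -> \bar R) : \bar R :=
  ereal_inf [set (\int[g]_(z in [set: (d.-tuple R * d.-tuple R)%type])
                     (sqnorm (row_of z.1 - row_of z.2))%:E)%E
            | g in [set g | coupling mu nu g]].

Definition potential (V : 'rV[R]_d -> R) (m : 'rV[R]_d) (S : 'M[R]_d) : \bar R :=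
  gauss_int m S (fun x => (V x)%:E).
Definition entropy (m : 'rV[R]_d) (S : 'M[R]_d) : \bar R :=
  gauss_int m S (fun x => (ln (gauss_density m S x))%:E).
Definition freeF (V : 'rV[R]_d -> R) (m : 'rV[R]_d) (S : 'M[R]_d) : \bar R :=
  (potential V m S + entropy m S)%E.

Definition evec (i : 'I_d) : 'rV[R]_d := delta_mx 0 i.
Definition grad (V : 'rV[R]_d -> R) (x : 'rV[R]_d) : 'rV[R]_d :=
  \row_i ('D_(evec i) V x).
Definition hess (V : 'rV[R]_d -> R) (x : 'rV[R]_d) : 'M[R]_d :=
  \matrix_(i, j) ('D_(evec j) ('D_(evec i) V) x).

Definition C2 (V : 'rV[R]_d -> R) : Prop :=
  (forall x, differentiable V x) /\
  (forall x, differentiable (grad V) x) /\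
  continuous (hess V).

Definition smooth (beta : R) (V : 'rV[R]_d -> R) : Prop :=
  forall x u, - beta * sqnorm u <= qform (hess V x) u <= beta * sqnorm u.
Definition strongly_convex (alpha : R) (V : 'rV[R]_d -> R) : Prop :=
  0 < alpha /\ forall x u, alpha * sqnorm u <= qform (hess V x) u.

Definition fb_step (V : 'rV[R]_d -> R) (eta : R)
  (p : 'rV[R]_d * 'M[R]_d) (x : 'rV[R]_d) : 'rV[R]_d * 'M[R]_d :=
  let m := p.1 in let S := p.2 in
  let b := grad V x in let H := hess V x in
  let Sh := (1%:M - eta *: H) *m S *m (1%:M - eta *: H) in
  (m - eta *: b,
   2^-1 *: (Sh + (2 * eta) *: 1%:M + sqrtm (Sh *m (Sh + (4 * eta) *: 1%:M)))).

(** E W2^2(p_k, target) when p_0 = N(p.1, p.2), computed through the Markov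
    structure: draw the sample from the current Gaussian and recurse. *)
Fixpoint expected_W2sq (V : 'rV[R]_d -> R) (eta : R)
  (target : set (d.-tuple R) -> \bar R) (k : nat)
  (p : 'rV[R]_d * 'M[R]_d) : \bar R :=
  match k with
  | 0 => W2sq (gauss p.1 p.2) target
  | k'.+1 => gauss_int p.1 p.2
               (fun x => expected_W2sq V eta target k' (fb_step V eta p x))
  end.

End FBGVI.

(* Main.v *)
(** Write N(m, S) as the law of m + z A, where z is a standard Gaussian row
    vector and A^T A = S.  Whenever K^T S K = Shat, the vectors m + z A and
    mhat + z A K couple N(m, S) with the minimizer, at cost [gcost m mhat S K].
    For each sample, the forward step and the evolution variational inequality
    of the entropy (a consequence of ln det <= tr - d and of the optimality of
    the Brenier map) turn such a coupling into one of the next iterate, whose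
    cost is at most (1 - alpha eta) times the old one plus a noise term.  In
    expectation, Stein's lemma identifies the mean Hessian term, the linear
    noise vanishes and the quadratic noise is at most 4 beta eta^2 tr(S E hess V)
    by co-coercivity; comparing the minimizer with its dilations bounds that
    trace by 5 d / 2 + 2 (beta^2 / alpha) gcost.  The induction bounds the
    expected cost from every K, so no measurability of the iterates or of an
    optimal K is needed; at time 0, K is the Brenier map, for which gcost is
    the squared Wasserstein distance by quadratic duality. *)
Require Import Defs.
From HB Require Import structures.
From mathcomp Require Import all_boot all_order all_algebra.
From mathcomp Require Import complex ring lra.
From mathcomp Require Import all_classical all_reals all_analysis.
From mathcomp Require Import measurable_realfun.
Import Order.TTheory GRing.Theory Num.Theory.
Import numFieldNormedType.Exports.
Set Implicit Arguments.
Unset Strict Implicit.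
Unset Printing Implicit Defensive.
Local Open Scope ring_scope.

(** * Symmetric positive definite matrices *)

(** The transport matrix of the next coupling depends on the sample and is only known to exist, so
    its cost cannot be averaged as a function of the sample. Each step therefore bounds it by an
    explicit majorant of quadratic growth, whose Gaussian mean is computed exactly; the recursion
    only ever integrates such majorants. Origin of the constants: the part of the trace bound
    proportional to the cost adds 8 beta^3 eta^2 / alpha to the factor 1 - alpha eta, and 16 eta
    beta^3 <= alpha^2 keeps this below alpha eta / 2, which leaves the rate alpha eta / 2. The
    remaining noise 4 beta eta^2 (5 d / 2) = 10 beta eta^2 d, divided by that rate, is 20 beta eta d
    / alpha, within the stated 24. The step-size bound also gives eta beta <= 1/48, so that I - eta
    hess V is positive definite. A second obstacle is integration itself. Expectations are defined
    as iterated one-dimensional integrals, while the potential and the entropy have signed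
    integrands: Tonelli covers the nonnegative case, and Gaussian domination justifies Fubini for
    the others. *)

Section SPD.
Variables (R : realType) (n : nat).
Implicit Types (u v w : 'rV[R]_n) (A B C P Q : 'M[R]_n).

Definition dot u v : R := (u *m v^T) 0 0.

Lemma dotE u v : dot u v = \sum_i u 0 i * v 0 i.
Proof. by rewrite /dot mxE; apply: eq_bigr => i _; rewrite mxE. Qed.

Lemma dotC u v : dot u v = dot v u.
Proof. by rewrite !dotE; apply: eq_bigr => i _; rewrite mulrC. Qed.

Lemma dotDl u v w : dot (u + v) w = dot u w + dot v w.
Proof. by rewrite /dot mulmxDl mxE. Qed.

Lemma dotNl u v : dot (- u) v = - dot u v.
Proof. by rewrite /dot mulNmx mxE. Qed.

Lemma dotZl a u v : dot (a *: u) v = a * dot u v.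
Proof. by rewrite /dot -scalemxAl mxE. Qed.

Lemma dotDr u v w : dot u (v + w) = dot u v + dot u w.
Proof. by rewrite dotC dotDl !(dotC u). Qed.

Lemma dotNr u v : dot u (- v) = - dot u v.
Proof. by rewrite dotC dotNl dotC. Qed.

Lemma dotZr a u v : dot u (a *: v) = a * dot u v.
Proof. by rewrite dotC dotZl dotC. Qed.

Definition dot_lin := (dotDl, dotDr, dotNl, dotNr, dotZl, dotZr).

Lemma dot_mulmx u v A : dot (u *m A) v = dot u (v *m A^T).
Proof. by rewrite /dot trmx_mul trmxK mulmxA. Qed.

Lemma sqnormE u : sqnorm u = dot u u.
Proof. by rewrite dotE /sqnorm; apply: eq_bigr => i _; rewrite expr2. Qed.

Lemma qformE A u : qform A u = dot (u *m A) u.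
Proof.
rewrite /qform dotE exchange_big /=; apply: eq_bigr => j _.
by rewrite mxE mulr_suml.
Qed.

Lemma sqnorm_ge0 u : 0 <= sqnorm u.
Proof. by apply: sumr_ge0 => i _; rewrite sqr_ge0. Qed.

Lemma sqnorm_eq0 u : (sqnorm u == 0) = (u == 0).
Proof.
apply/idP/eqP => [|->]; last by rewrite /sqnorm big1// => i _; rewrite mxE expr0n.
rewrite /sqnorm psumr_eq0; last by move=> i _; rewrite sqr_ge0.
move/allP => u0; apply/rowP => i; rewrite mxE; apply/eqP.
by have := u0 i; rewrite mem_index_enum sqrf_eq0; apply.
Qed.

Lemma sqnorm_gt0 u : (0 < sqnorm u) = (u != 0).
Proof. by rewrite lt0r sqnorm_eq0 sqnorm_ge0 andbT. Qed.

Lemma qform_conj A P u : qform (P *m A *m P^T) u = qform A (u *m P).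
Proof. by rewrite !qformE !mulmxA dot_mulmx trmxK. Qed.

Lemma qformD A B u : qform (A + B) u = qform A u + qform B u.
Proof. by rewrite !qformE mulmxDr dotDl. Qed.

Lemma qformZ a A u : qform (a *: A) u = a * qform A u.
Proof. by rewrite !qformE -scalemxAr dotZl. Qed.

Lemma qform1 u : qform 1%:M u = sqnorm u.
Proof. by rewrite qformE mulmx1 sqnormE. Qed.

Lemma spd_spsd A : spd A -> spsd A.
Proof.
move=> [sA pA]; split=> // u; have [->|/pA/ltW//] := eqVneq u 0.
by rewrite qformE mul0mx dotE big1// => i _; rewrite mxE mul0r.
Qed.

Lemma spd_unit A : spd A -> A \in unitmx.
Proof.
move=> [_ pA]; rewrite unitmxE unitfE; apply/negP => /det0P [v v0 vA].
have := pA _ v0; rewrite qformE vA dotE big1 ?ltxx// => i _.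
by rewrite mxE mul0r.
Qed.

Lemma spd_conj A P : P \in unitmx -> spd A -> spd (P *m A *m P^T).
Proof.
move=> Pu [sA pA]; split=> [|u u0].
  by rewrite !trmx_mul trmxK sA mulmxA.
rewrite qform_conj; apply: pA; apply: contra u0 => /eqP uP.
by rewrite -(mulmxK Pu u) uP mul0mx.
Qed.

Lemma spd_inv A : spd A -> spd (invmx A).
Proof.
move=> sA; have Au := spd_unit sA.
have := spd_conj (P := invmx A); rewrite unitmx_inv => /(_ A Au sA).
by rewrite trmx_inv (proj1 sA) mulVmx// mul1mx.
Qed.

Lemma spdD A B : spd A -> spsd B -> spd (A + B).
Proof.
move=> [sA pA] [sB pB]; split=> [|u u0]; first by rewrite linearD/= sA sB.
by rewrite qformD ltr_wpDr// ?pA.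
Qed.

Lemma spdZ a A : 0 < a -> spd A -> spd (a *: A).
Proof.
move=> a0 [sA pA]; split=> [|u u0]; first by rewrite linearZ/= sA.
by rewrite qformZ mulr_gt0// pA.
Qed.

Lemma spd1 : spd (1%:M : 'M[R]_n).
Proof. by split=> [|u u0]; rewrite ?trmx1// qform1 sqnorm_gt0. Qed.

End SPD.

(** * Positive definite square roots by polynomial functional calculus *)

Section Sqrt.
Variable R : realType.

(** Newton interpolation: a new node is matched by adding a multiple of the polynomial that vanishes
    at the earlier ones; a repeated node changes nothing. *)
Lemma interpolation (s : seq R) (f : R -> R) :
  exists p : {poly R}, {in s, forall x, p.[x] = f x}.
Proof.
elim: s => [|a s [p ps]]; first by exists 0.
have [as_|nas] := boolP (a \in s).
  by exists p => x; rewrite inE => /orP[/eqP->|]; exact: ps.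
pose w := \prod_(b <- s) ('X - b%:P).
have wa : w.[a] != 0 by rewrite -rootE root_prod_XsubC.
exists (p + ((f a - p.[a]) / w.[a])%:P * w) => x.
rewrite inE hornerD hornerM hornerC => /orP[/eqP->|xs].
  by rewrite divfK// addrC subrK.
have /eqP -> : w.[x] == 0 by rewrite -rootE root_prod_XsubC.
by rewrite mulr0 addr0 ps.
Qed.

(** The list [s] is the spectrum. The complexification of [A] is Hermitian, hence unitarily
    diagonalisable, and a polynomial that vanishes on the eigenvalues annihilates [A]. *)
Lemma spd_functional_calculus n (A : 'M[R]_n.+1) : spd A ->
  exists s : seq R, all (fun x => 0 < x) s /\
   forall p : {poly R}, {in s, forall x, p.[x] = 0} -> horner_mx A p = 0.
Proof.
move=> sA; pose rc : {rmorphism R -> R[i]} := real_complex R.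
pose AC := map_mx rc A.
have conjrc x : (rc x)^* = rc x by exact: conjc_real.
have hA : AC \is hermsymmx.
  apply/is_hermitianmxP; rewrite /= expr0 scale1r.
  by apply/matrixP => i j; rewrite !mxE conjrc -[in LHS](proj1 sA) mxE.
have [Pu DE] := (spectral_unit AC, orthomx_spectralP (hermitian_normalmx hA)).
have := hermitian_spectral_diag_real hA.
move: DE Pu; move: (spectralmx AC) (spectral_diag AC) => P D DE Pu Dr.
exists [seq complex.Re (D 0 i) | i <- enum 'I_n.+1].
have DrE i : D 0 i = rc (complex.Re (D 0 i)).
  move/mxOverP: Dr => /(_ 0 i); case: (D 0 i) => a b /complex_realP[k ->] //.
have horner0 (p : {poly R}) :
    map_mx rc (horner_mx A p) = invmx P *m diag_mx (map_mx (horner (map_poly rc p)) D) *m P.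
  rewrite map_horner_mx -/AC DE horner_mx_uconjC; last exact: Pu.
  by rewrite horner_mx_diag.
split.
  apply/allP => _ /mapP[i _ ->]; set r := complex.Re _.
  (* The real part [r] of a diagonal entry is an eigenvalue of [A] over the reals, so a real
     eigenvector tests the positivity of [A]. *)
  have : \det (A - r%:M) = 0.
    have := horner0 ('X - r%:P); rewrite rmorphB /= horner_mx_X horner_mx_C => /(congr1
        determinant).
    rewrite det_map_mx !det_mulmx det_diag (bigD1 i)//= mxE DrE horner_map.
    rewrite hornerD hornerN hornerX hornerC subrr rmorph0 mul0r mulr0 mul0r.
    by move=> /eqP; rewrite fmorph_eq0 => /eqP.
  move/eqP/det0P => [v v0]; rewrite mulmxBr mul_mx_scalar => /subr0_eq vA.
  have := proj2 sA _ v0; rewrite qformE vA dotZl -sqnormE pmulr_lgt0//.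
  by rewrite sqnorm_gt0.
move=> p ps; apply/(@map_mx_inj _ _ rc); rewrite horner0 [in RHS]map_mx0.
suff -> : map_mx (horner (map_poly rc p)) D = 0 by rewrite linear0 mulmx0 mul0mx.
apply/rowP => i; rewrite !mxE DrE horner_map ps ?rmorph0//.
by apply/mapP; exists i; rewrite ?mem_enum.
Qed.

(** The root is [C *m C], where [C] is a polynomial in [A] that interpolates the fourth root on the
    spectrum. As [C] is symmetric, the quadratic form of [C *m C] at [u] is the squared norm of
    [u *m C], and positivity follows. *)
Lemma spd_sqrt n (A : 'M[R]_n) : spd A -> exists2 B, spd B & B *m B = A.
Proof.
case: n A => [|n] A sA.
  exists 1%:M; first exact: spd1.
  by apply/matrixP => -[].
have [s [s0 sP]] := spd_functional_calculus sA.
have [p pE] := interpolation s (fun x => Num.sqrt (Num.sqrt x)).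
pose C := horner_mx A p.
have C4 : (C *m C) *m (C *m C) = A.
  have : horner_mx A (p * p * (p * p) - 'X) = 0.
    apply: sP => x xs; have x0 : 0 < x by move/allP: s0; apply.
    rewrite hornerD hornerN hornerX !hornerM (pE x xs).
    rewrite -[X in X * _]expr2 -expr2 sqr_sqrtr ?sqrtr_ge0//.
    by rewrite -expr2 sqr_sqrtr ?subrr// ltW.
  by rewrite rmorphB /= !rmorphM /= horner_mx_X => /subr0_eq.
have Ct : C^T = C.
  rewrite /C; elim/poly_ind: p {pE C C4} => [|q c IH].
    by rewrite rmorph0 trmx0.
  rewrite rmorphD rmorphM /= horner_mx_X horner_mx_C linearD/= trmx_mul tr_scalar_mx IH (proj1 sA).
  congr (_ + _); have /comm_horner_mx -/(_ q) : comm_mx A A by [].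
  done.
exists (C *m C) => //; split; first by rewrite trmx_mul Ct.
move=> u u0; have := qform_conj 1%:M C u; rewrite mulmx1 Ct qform1 => ->.
rewrite sqnorm_gt0; apply: contra u0 => /eqP uC.
have := spd_unit sA => Au.
by rewrite -(mulmxK Au u) -C4 !mulmxA uC !mul0mx.
Qed.

End Sqrt.

(** * Trace inequalities, uniqueness of square roots, Brenier maps between Gaussians *)

Section Trace.
Variables (R : realType) (n : nat).
Implicit Types (A B K P Q S T W : 'M[R]_n).

Lemma mxtrace_qform S P : \tr (P^T *m S *m P) = \sum_i qform S (row i P^T).
Proof.
apply: eq_bigr => i _; rewrite qformE /dot -row_mul.
by rewrite !mxE; apply: eq_bigr => j _; rewrite !mxE.
Qed.

Lemma mxtrace_conj_ge0 S P : spsd S -> 0 <= \tr (P^T *m S *m P).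
Proof. by move=> [_ pS]; rewrite mxtrace_qform sumr_ge0. Qed.

Lemma mxtrace_conj_eq0 S P : spd S -> \tr (P^T *m S *m P) = 0 -> P = 0.
Proof.
move=> sS /eqP; rewrite mxtrace_qform psumr_eq0; last first.
  by move=> i _; exact: (proj2 (spd_spsd sS)).
move=> /allP P0; apply: trmx_inj; apply/row_matrixP => i.
have := P0 i; rewrite mem_index_enum trmx0 row0 => /(_ isT) /=.
by have [//|/(proj2 sS)/gt_eqF->] := eqVneq (row i P^T) 0.
Qed.

Lemma mxtrace_mul_ge0 S W P : spsd S -> spd W -> 0 <= \tr (P^T *m S *m P *m W).
Proof.
move=> sS /spd_sqrt [w [sw _] <-].
have := mxtrace_conj_ge0 (P *m w) sS.
by rewrite trmx_mul sw -!mulmxA mxtrace_mulC -!mulmxA.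
Qed.

(** Multiplying by [X^T] and taking traces writes zero as \tr (X^T P X) + \tr (X Q X^T), two
    nonnegative terms, the first of which is definite in [X]. Uniqueness and commutation of square
    roots both reduce to this. *)
Lemma sylvester_inj P Q X : spd P -> spsd Q -> P *m X + X *m Q = 0 -> X = 0.
Proof.
move=> sP sQ PXQ; apply: (mxtrace_conj_eq0 sP); apply: le_anti.
rewrite (mxtrace_conj_ge0 _ (spd_spsd sP)) andbT.
have := congr1 (fun M => \tr (X^T *m M)) PXQ.
rewrite mulmxDr mulmx0 linearD/= linear0 !mulmxA => /eqP.
rewrite addr_eq0 => /eqP ->; rewrite oppr_le0 -mulmxA mxtrace_mulC.
by rewrite -{1}[X]trmxK mxtrace_conj_ge0.
Qed.

(** [sqrtm] selects an arbitrary semidefinite root [C]. With [B] the root already built, B (B - C) +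
    (B - C) C = B^2 - C^2 = 0, so the two coincide. *)
Lemma sqrtm_spd A : spd A -> spd (sqrtm A) /\ sqrtm A *m sqrtm A = A.
Proof.
move=> sA; have [B sB BA] := spd_sqrt sA.
have [sC CA] : [set C : 'M[R]_n | spsd C /\ C *m C = A]%classic (sqrtm A).
  by apply: (@xgetPex _ 0 [set C : 'M[R]_n | spsd C /\ C *m C = A]%classic);
    exists B; split=> //; exact: spd_spsd.
suff -> : sqrtm A = B by [].
apply/eqP; rewrite -subr_eq0; apply/eqP; apply: (sylvester_inj sB sC).
by rewrite mulmxBr mulmxBl BA CA addrC addrA subrK subrr.
Qed.

(** The commutator X = S B - B S with the root [B] solves B X + X B = S A - A S = 0. *)
Lemma sqrtm_comm A S : spd A -> S *m A = A *m S -> S *m sqrtm A = sqrtm A *m S.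
Proof.
move=> sA SA; have [sB BA] := sqrtm_spd sA; set B := sqrtm A in sB BA *.
apply/eqP; rewrite -subr_eq0; apply/eqP.
apply: (sylvester_inj sB (spd_spsd sB)).
rewrite mulmxBr mulmxBl !mulmxA BA -(mulmxA S) BA SA.
by rewrite addrA subrK subrr.
Qed.

(** The classical formula T = A^(-1/2) (A^(1/2) B A^(1/2))^(1/2) A^(-1/2). *)
Lemma brenier_map_exists A B : spd A -> spd B ->
  exists2 T, spd T & T *m A *m T = B.
Proof.
move=> sA sB; have [w sw wA] := spd_sqrt sA; have wu := spd_unit sw.
have sw' := spd_inv sw.
have /spd_sqrt [s ss sE] : spd (w *m B *m w).
  by have := spd_conj wu sB; rewrite (proj1 sw).
exists (invmx w *m s *m invmx w).
  have wiu : invmx w \in unitmx by rewrite unitmx_inv.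
  by have := spd_conj wiu ss; rewrite (proj1 sw').
rewrite -wA !mulmxA mulmxKV// mulmxK// -(mulmxA (invmx w) s s) sE.
by rewrite !mulmxA mulVmx// mul1mx mulmxK.
Qed.

(* [0 <= \tr ((K - T)^T A (K - T) T^-1)] *)
Lemma brenier_map_opt A K T : spd A -> spd T ->
  K^T *m A *m K = T *m A *m T -> \tr (A *m K) <= \tr (A *m T).
Proof.
move=> sA sT KT; have Tu := spd_unit sT.
have := mxtrace_mul_ge0 (K - T) (spd_spsd sA) (spd_inv sT).
rewrite [(K - T)^T]linearB /= (proj1 sT) !(mulmxBl, mulmxBr) KT.
rewrite !(mulmxK Tu) !linearB /= (mxtrace_mulC T).
rewrite -[in X in _ - X](mulmxA _ K) -!mulmxA.
rewrite (mxtrace_mulC T (A *m _)) -!mulmxA mulVmx// mulmx1.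
have -> : \tr (K^T *m A) = \tr (A *m K).
  by rewrite -mxtrace_tr trmx_mul trmxK (proj1 sA).
by lra.
Qed.

Lemma spd_det_gt0 A : spd A -> 0 < \det A.
Proof.
move=> /spd_sqrt [B sB <-]; rewrite det_mulmx -expr2 exprn_even_gt0//=.
by have := spd_unit sB; rewrite unitmxE unitfE.
Qed.

End Trace.

(** * Log-determinant against trace *)

Section LnDet.
Variable R : realType.

(** Induction by Schur complement: eliminating the corner [p] gives \det A = p \det S, while passing
    to [S] only lowers the trace of the remaining block; the scalar case is ln p <= p - 1. *)
Lemma ln_det_le_trace n (A : 'M[R]_n) : spd A -> ln (\det A) <= \tr A - n%:R.
Proof.
elim: n A => [|n IH] A sA; first by rewrite det_mx00 ln1 /mxtrace big_ord0 subr0.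
pose M : 'M[R]_(1 + n) := A.
have sM : spd M := sA.
pose p := ulsubmx M 0 0; pose v := ursubmx M; pose Q := drsubmx M.
have ulE : ulsubmx M = p%:M by rewrite [LHS]mx11_scalar.
have dlE : dlsubmx M = v^T by rewrite /v trmx_ursub (proj1 sM).
have ME : M = block_mx p%:M v v^T Q by rewrite -[LHS]submxK ulE dlE.
have p0 : 0 < p.
  have /(proj2 sM) : row_mx 1%:M 0 != 0 :> 'rV[R]_(1 + n).
    by rewrite row_mx_eq0 negb_and -scalemx1 scale1r oner_neq0.
  rewrite qformE {1}ME mul_row_block !mul1mx !mul0mx !addr0 /dot tr_row_mx.
  by rewrite mul_row_col trmx1 mulmx1 trmx0 mulmx0 addr0 mxE eqxx mulr1n.
pose S := Q - p^-1 *: (v^T *m v).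
pose L : 'M[R]_(1 + n) := block_mx 1%:M 0 (- p^-1 *: v^T) 1%:M.
have LM : L *m M *m L^T = block_mx p%:M 0 0 S.
  rewrite ME /L tr_block_mx !mulmx_block !trmx1 trmx0 linearZ/= trmxK.
  rewrite !mul1mx !mul0mx !mulmx0 !mulmx1 !addr0 !scaleNr.
  rewrite mul_scalar_mx scalerN scalerA divff ?gt_eqF// scale1r addNr.
  rewrite mulNmx -scalemxAl mul_mx_scalar scalerA mulVf ?gt_eqF// scale1r addNr.
  by rewrite mul0mx add0r mulNmx -scalemxAl addrC.
have Lu : L \in unitmx by rewrite unitmxE det_lblock !det1 mulr1 unitr1.
have := spd_conj Lu sM; rewrite LM => sB.
have sS : spd S.
  split=> [|u u0].
    have := proj1 sB; rewrite tr_block_mx => /eq_block_mx[_ _ _] //.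
  have /(proj2 sB) : row_mx 0 u != 0 :> 'rV[R]_(1 + n).
    by rewrite row_mx_eq0 negb_and u0 orbT.
  rewrite !qformE mul_row_block !mul0mx !mulmx0 !add0r /dot tr_row_mx.
  by rewrite mul_row_col trmx0 mulmx0 add0r.
have detM : \det A = p * \det S.
  have := congr1 determinant LM; rewrite !det_mulmx det_tr det_lblock.
  rewrite !det1 !mul1r mulr1 det_ublock det_scalar1 => <- //.
have trM : \tr A = p + \tr Q.
  by have := mxtrace_block p%:M v v^T Q; rewrite -ME mxtrace_scalar mulr1n.
have trS : \tr S <= \tr Q.
  rewrite linearB/= linearZ/= lerBlDr lerDl mulr_ge0 ?invr_ge0 ?(ltW p0)//.
  apply: sumr_ge0 => i _; rewrite !mxE; apply: sumr_ge0 => j _.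
  by rewrite !mxE -expr2 sqr_ge0.
rewrite detM lnM ?posrE ?spd_det_gt0//.
have := IH _ sS; have : ln p <= p - 1.
  by rewrite -[X in ln X](subrK 1) addrC le_ln1Dx// ltrBrDr addNr.
by rewrite trM -natr1; lra.
Qed.

(** [A *m B] need not be symmetric, but with [b] the root of [B] it has the determinant and trace of
    the positive definite matrix [b *m A *m b]. *)
Lemma ln_det_mul_le_trace n (A B : 'M[R]_n) : spd A -> spd B ->
  ln (\det (A *m B)) <= \tr (A *m B) - n%:R.
Proof.
move=> sA /spd_sqrt [b sb <-]; have := spd_conj (spd_unit sb) sA.
rewrite (proj1 sb) => /ln_det_le_trace.
rewrite !det_mulmx mulrAC -mulrA [X in ln X]mulrC mulrA => h.
rewrite !mulmxA mxtrace_mulC !mulmxA; apply: le_trans h.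
by rewrite (mulrC (\det A)).
Qed.

End LnDet.

(** * One step along a fixed sample *)

Section OneStep.
Variables (R : realType) (n : nat).
Implicit Types (A B K L P Q S T X Y : 'M[R]_n) (u v : 'rV[R]_n).

(** [prox_cov eta Sh] is the covariance of the backward (entropy) step. *)
Definition prox_cov (eta : R) Sh : 'M[R]_n :=
  2^-1 *: (Sh + (2 * eta) *: 1%:M + sqrtm (Sh *m (Sh + (4 * eta) *: 1%:M))).

(** The backward step is the pushforward by a symmetric map [a]. The matrix N = prox_cov eta Sh -
    eta I satisfies N^2 = Sh N + eta Sh = Sh Sp and commutes with [Sh]; then a = I + eta N^(-1) =
    N^(-1) Sp. The last identity is the optimality condition of the implicit step: the displacement
    [a - 1] is [eta] times minus the entropy gradient at the arrival point. *)
Lemma prox_covP (eta : R) Sh : 0 < eta -> spd Sh ->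
  exists a, [/\ spd a, spd (prox_cov eta Sh), a *m Sh *m a = prox_cov eta Sh,
    a *m Sh = Sh *m a & a - 1%:M = eta *: (invmx (prox_cov eta Sh) *m a)].
Proof.
move=> eta0 sSh; set Sp := prox_cov eta Sh.
pose A0 := Sh *m (Sh + (4 * eta) *: 1%:M).
have Shu := spd_unit sSh.
have A0E : A0 = Sh *m Sh + (4 * eta) *: Sh by rewrite /A0 mulmxDr -scalemxAr mulmx1.
have sA0 : spd A0.
  rewrite A0E addrC; apply: spdD; first by apply: spdZ => //; rewrite mulr_gt0.
  have := spd_conj Shu (spd1 R n); rewrite mulmx1 (proj1 sSh) => h.
  exact: spd_spsd.
have [sB BB] := sqrtm_spd sA0.
have ShB : Sh *m sqrtm A0 = sqrtm A0 *m Sh.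
  by apply: sqrtm_comm => //; rewrite A0E mulmxDr mulmxDl -scalemxAl -scalemxAr mulmxA.
set B := sqrtm A0 in sB BB ShB.
pose N := 2^-1 *: (Sh + B).
have sN : spd N by apply: spdZ; [rewrite invr_gt0|apply: spdD => //; exact: spd_spsd].
have SpE : Sp = N + eta *: 1%:M.
  rewrite /Sp /prox_cov -/A0 -/B /N !scalerDr scalerA mulrA mulVf ?mul1r//.
  by rewrite addrAC.
have sSp : spd Sp by rewrite SpE; apply: spdD => //; apply/spd_spsd/spdZ => //; exact: spd1.
have NN : N *m N = Sh *m Sp.
  rewrite /Sp /prox_cov -/A0 -/B /N -!(scalemxAl, scalemxAr) scalerA.
  rewrite mulmxDl !mulmxDr BB A0E -ShB -scalemxAr mulmx1.
  have -> : Sh *m Sh + Sh *m B + (Sh *m B + (Sh *m Sh + (4 * eta) *: Sh)) =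
     2 *: (Sh *m Sh + (2 * eta) *: Sh + Sh *m B).
    by rewrite !scalerDr !scalerA !scaler_nat !mulr2n; apply/matrixP => i j; rewrite !mxE; ring.
  by rewrite scalerA -mulrA mulVf ?mulr1.
have Nu := spd_unit sN; have sN' := spd_inv sN.
have Spu := spd_unit sSp.
have ShN : Sh *m N = N *m Sh.
  by rewrite /N -scalemxAl -scalemxAr mulmxDl mulmxDr ShB.
have ShN' : Sh *m invmx N = invmx N *m Sh.
  apply: (can_inj (mulmxK Nu)).
  by rewrite mulmxKV// -mulmxA ShN mulmxA mulVmx// mul1mx.
pose a := 1%:M + eta *: invmx N.
have aE : a = invmx N *m Sp.
  by rewrite SpE mulmxDr mulVmx// -scalemxAr mulmx1.
have aE' : a = Sp *m invmx N.
  by rewrite SpE mulmxDl mulmxV// -scalemxAl mul1mx.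
have sa : spd a by apply: spdD; [exact: spd1|apply/spd_spsd/spdZ].
exists a; split=> //.
    by rewrite -mulmxA {2}aE' (mulmxA Sh) -NN (mulmxK Nu) aE' mulmxKV.
  by rewrite /a mulmxDl mulmxDr mul1mx mulmx1 -scalemxAl -scalemxAr ShN'.
by rewrite {2}aE' mulKmx// addrC addKr.
Qed.

(** For a centered random row vector x of covariance [S], this is the expectation of the scalar
    product of x P and x Q: the L2 product of two linear displacement fields. *)
Definition ipS S P Q : R := \tr (P^T *m S *m Q).

Lemma ipSC S P Q : S^T = S -> ipS S P Q = ipS S Q P.
Proof.
by move=> sS; rewrite /ipS -mxtrace_tr !trmx_mul trmxK sS mulmxA.
Qed.

Lemma ipSDl S P Q X : ipS S (P + Q) X = ipS S P X + ipS S Q X.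
Proof. by rewrite /ipS [(P + Q)^T]linearD/= !mulmxDl linearD. Qed.

Lemma ipSZl S c P X : ipS S (c *: P) X = c * ipS S P X.
Proof. by rewrite /ipS [(c *: P)^T]linearZ/= -!scalemxAl linearZ. Qed.

Lemma ipSNl S P X : ipS S (- P) X = - ipS S P X.
Proof. by rewrite -scaleN1r ipSZl mulN1r. Qed.

Lemma ipSDr S P Q X : ipS S X (P + Q) = ipS S X P + ipS S X Q.
Proof. by rewrite /ipS mulmxDr linearD. Qed.

Lemma ipSZr S c P X : ipS S X (c *: P) = c * ipS S X P.
Proof. by rewrite /ipS -scalemxAr linearZ. Qed.

Lemma ipSNr S P X : ipS S X (- P) = - ipS S X P.
Proof. by rewrite -scaleN1r ipSZr mulN1r. Qed.

Definition ipS_lin := (ipSDl, ipSDr, ipSZl, ipSZr, ipSNl, ipSNr).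

Lemma ipS_ge0 S P : spsd S -> 0 <= ipS S P P.
Proof. exact: mxtrace_conj_ge0. Qed.

Lemma ipS_conj S A P Q : ipS (A^T *m S *m A) P Q = ipS S (A *m P) (A *m Q).
Proof. by rewrite /ipS trmx_mul !mulmxA. Qed.

(** With K = a^(-1) T the new cost is the squared norm of a - T in the product weighted by [Sh], and
    |a - T|^2 = |1 - T|^2 - |a - 1|^2 + 2 <a - 1, a - T>. By the optimality condition for [a] the
    last product equals eta (n - \tr (a^(-1) T)), which the log-determinant inequality bounds by
    half the entropy gap. *)
Lemma prox_evi (eta : R) Sh T Shat : 0 < eta -> spd Sh -> spd T ->
  T *m Sh *m T = Shat ->
  exists a K, [/\ spd (prox_cov eta Sh), a^T = a, K^T *m prox_cov eta Sh *m K = Shat, a *m Sh *m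
      a = prox_cov eta Sh &
   ipS (prox_cov eta Sh) (1%:M - K) (1%:M - K) <=
   ipS Sh (1%:M - T) (1%:M - T) - ipS Sh (a - 1%:M) (a - 1%:M)
    - eta * (ln (\det Shat) - ln (\det (prox_cov eta Sh)))].
Proof.
move=> eta0 sSh sT TSh; have [a [sa sSp aSh aC a1]] := prox_covP eta0 sSh.
move: sSp aSh a1; set Sp := prox_cov eta Sh => sSp aSh a1.
have au := spd_unit sa; have Spu := spd_unit sSp.
have sa' := spd_inv sa; have ta' := proj1 sa'.
have Kt : (invmx a *m T)^T = T *m invmx a by rewrite trmx_mul ta' (proj1 sT).
exists a, (invmx a *m T).
have KSp : (invmx a *m T)^T *m Sp *m (invmx a *m T) = Shat.
  by rewrite Kt -aSh -!mulmxA (mulKVmx au) (mulKmx au) mulmxA.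
split=> //; first exact: (proj1 sa).
have -> : ipS Sp (1%:M - invmx a *m T) (1%:M - invmx a *m T) = ipS Sh (a - T) (a - T).
  rewrite -aSh -{1}(proj1 sa) ipS_conj mulmxBr mulmx1 mulKVmx//.
have aT : a - T = (a - 1%:M) + (1%:M - T) by rewrite addrA subrK.
have cross : ipS Sh (a - 1%:M) (a - T) = eta * (n%:R - \tr (invmx a *m T)).
  rewrite a1 ipSZl; congr (_ * _); rewrite /ipS trmx_mul (proj1 sa) (proj1 (spd_inv sSp)).
  have aShE : a *m invmx Sp *m Sh = invmx a.
    have SpE : Sh *m (a *m a) = Sp by rewrite mulmxA -aC.
    apply: (can_inj (mulmxK au)); apply: (can_inj (mulmxK au)).
    by rewrite mulVmx// mul1mx -!mulmxA SpE mulVmx// mulmx1.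
  rewrite aShE mulmxBr linearB /= mulVmx// mxtrace1 //.
have lnE : n%:R - \tr (invmx a *m T) <= - (2^-1 * (ln (\det Shat) - ln (\det Sp))).
  have detX : 0 < \det (invmx a *m T) by rewrite det_mulmx mulr_gt0 ?spd_det_gt0.
  have := ln_det_mul_le_trace sa' sT.
  have -> : \det Shat = \det (invmx a *m T) ^+ 2 * \det Sp.
    by rewrite -KSp 2!det_mulmx det_tr; ring.
  rewrite lnM ?posrE ?spd_det_gt0 ?exprn_gt0// lnXn//.
  by lra.
have := ler_wpM2l (ltW eta0) lnE; rewrite -cross aT.
move: (a - 1%:M) (1%:M - T) => X Y.
rewrite !ipS_lin (ipSC Y X) ?(proj1 sSh)//.
by lra.
Qed.

(** The factor [1%:M + L] is the linear part of the whole step, forward map followed by [a], so [L]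
    is its displacement. *)
Lemma one_step_cov (eta : R) Sig Shat S K : 0 < eta ->
  spd Sig -> spd Shat -> S^T = S -> 1%:M - eta *: S \in unitmx ->
  K^T *m Sig *m K = Shat ->
  let Sp := prox_cov eta ((1%:M - eta *: S) *m Sig *m (1%:M - eta *: S)) in
  exists L Kp, [/\ spd Sp, Kp^T *m Sp *m Kp = Shat,
    (1%:M + L)^T *m Sig *m (1%:M + L) = Sp &
    ipS Sp (1%:M - Kp) (1%:M - Kp) <=
    ipS Sig (1%:M - K) (1%:M - K) - 2 * eta * ipS Sig S (1%:M - K)
    - ipS Sig L L - 2 * eta * ipS Sig L S - eta * (ln (\det Shat) - ln (\det Sp))].
Proof.
move=> eta0 sS sH tS; set A := 1%:M - eta *: S => Au KS Sp.
have tA : A^T = A by rewrite /A linearB/= linearZ/= trmx1 tS.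
have sSh : spd (A *m Sig *m A) by have := spd_conj Au sS; rewrite tA.
have [T sT TE] := brenier_map_exists sSh sH.
have [a [Kp [sSp ta KpE aE evi]]] := prox_evi eta0 sSh sT TE.
exists (A *m a - 1%:M), Kp; split=> //.
  by rewrite addrCA subrr addr0 trmx_mul ta tA /Sp -aE !mulmxA.
apply: (le_trans evi); rewrite -/Sp.
(* [prox_evi] requires a symmetric positive definite transport, whereas the coupling inherited from
   [K] is [invmx A *m K]. Replacing it by the Brenier map [T] cannot raise the cost. *)
have opt : ipS (A *m Sig *m A) (1%:M - T) (1%:M - T) <= ipS Sig (A - K) (A - K).
  pose K' := invmx A *m K.
  have K'E : K'^T *m (A *m Sig *m A) *m K' = Shat.
    rewrite trmx_mul trmx_inv tA -!mulmxA (mulKVmx Au) (mulKmx Au).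
    by rewrite mulmxA.
  have := brenier_map_opt sSh sT; move=> /(_ K'); rewrite K'E TE => /(_ erefl).
  have -> : A - K = A *m (1%:M - K') by rewrite mulmxBr mulmx1 mulKVmx.
  rewrite -ipS_conj tA !ipS_lin.
  rewrite (ipSC T) ?(proj1 sSh)// (ipSC K' 1%:M) ?(proj1 sSh)//.
  have ip1 X : ipS (A *m Sig *m A) 1%:M X = \tr (A *m Sig *m A *m X).
    by rewrite /ipS trmx1 mul1mx.
  rewrite !ip1.
  have -> : ipS (A *m Sig *m A) T T = ipS (A *m Sig *m A) K' K'.
    by rewrite /ipS K'E (proj1 sT) TE.
  by lra.
have E1 : ipS (A *m Sig *m A) (a - 1%:M) (a - 1%:M) =
    ipS Sig (A *m a - 1%:M + eta *: S) (A *m a - 1%:M + eta *: S).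
  rewrite -{1}tA ipS_conj mulmxBr mulmx1 -(addrA (A *m a)).
  by have -> : - 1%:M + eta *: S = - A by rewrite opprB addrC.
have E2 : A - K = (1%:M - K) - eta *: S by rewrite addrAC.
move: opt; rewrite E1 E2.
move: (A *m a - 1%:M) (1%:M - K) => L D.
rewrite !ipS_lin (ipSC S D) ?(proj1 sS)// (ipSC S L) ?(proj1 sS)//.
by lra.
Qed.

(* Cost of the coupling of [m + z A] with [mhat + z A K], where [A^T A = S]. *)
Definition gcost (m mhat : 'rV[R]_n) S K : R :=
  sqnorm (m - mhat) + ipS S (1%:M - K) (1%:M - K).

(* The entropies enter [h3] as [- (ln det) / 2], up to a common constant. *)
Lemma one_step (alpha beta eta VP Vpi : R) Sig Shat S H K
    (m mhat b g : 'rV[R]_n) :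
  0 < eta -> eta * beta <= 2^-1 ->
  spd Sig -> spd Shat -> S^T = S -> 1%:M - eta *: S \in unitmx ->
  K^T *m Sig *m K = Shat ->
  let Sp := prox_cov eta ((1%:M - eta *: S) *m Sig *m (1%:M - eta *: S)) in
  exists L Kp, [/\ spd Sp, Kp^T *m Sp *m Kp = Shat,
    (1%:M + L)^T *m Sig *m (1%:M + L) = Sp &
    forall VPp, VPp <= VP - eta * dot g b + ipS Sig L H
           + beta / 2 * (eta ^+ 2 * sqnorm b + ipS Sig L L) ->
    VP - dot g (m - mhat) - ipS Sig (1%:M - K) H
     + alpha / 2 * gcost m mhat Sig K <= Vpi ->
    Vpi - ln (\det Shat) / 2 <= VPp - ln (\det Sp) / 2 ->
    gcost (m - eta *: b) mhat Sp Kp <=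
    (1 - alpha * eta) * gcost m mhat Sig K
    + 2 * eta * (dot (g - b) (m - mhat) + ipS Sig (H - S) (1%:M - K))
    + 2 * eta ^+ 2 * (sqnorm (b - g) + ipS Sig (S - H) (S - H))].
Proof.
move=> eta0 etab sS sH tS Su KS Sp.
have [L [Kp [sSp KpE LE cov]]] := one_step_cov eta0 sS sH tS Su KS.
exists L, Kp; split=> // VPp h1 h2 h3; rewrite /gcost.
have -> : m - eta *: b - mhat = (m - mhat) - eta *: b by rewrite addrAC.
move: h1 h2 cov; rewrite -/Sp /gcost; move: (m - mhat) (1%:M - K) => d D h1 h2 cov.
(* Completing squares: [p1] bounds 2 eta <L, H - S> by half of |L|^2 plus 2 eta^2 |S - H|^2, and
   [p2] lets the other half of |L|^2 absorb the smoothness error. [p3] and [p4] play the same roles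
   for the mean, the slack being half of eta^2 |b - 2 g|^2. *)
have p1 := ipS_ge0 (L + (2 * eta) *: (S - H)) (spd_spsd sS).
have p2 : 0 <= (2^-1 - eta * beta) * ipS Sig L L.
  by rewrite mulr_ge0 ?subr_ge0 ?ipS_ge0//; exact: spd_spsd.
have p3 : 0 <= eta ^+ 2 * ((2^-1 - eta * beta) * sqnorm b).
  by rewrite mulr_ge0 ?sqr_ge0// mulr_ge0 ?subr_ge0 ?sqnorm_ge0.
have p4 : 0 <= eta ^+ 2 * sqnorm (b - 2 *: g).
  by rewrite mulr_ge0 ?sqr_ge0 ?sqnorm_ge0.
have h1' := ler_wpM2l (ltW eta0) h1; have h2' := ler_wpM2l (ltW eta0) h2.
have h3' := ler_wpM2l (ltW eta0) h3.
move: h1' h2' h3' cov p1 p2 p3 p4.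
rewrite !sqnormE !ipS_lin !dot_lin.
rewrite !(ipSC H) ?(proj1 sS)// !(ipSC S L) ?(proj1 sS)// (ipSC S H) ?(proj1 sS)//.
rewrite !(dotC g) !(dotC d) !(ipSC D) ?(proj1 sS)//.
by lra.
Qed.

End OneStep.

Local Open Scope classical_set_scope.

(** * Lebesgue measure on tuples *)

Section LebesgueTuples.
Local Open Scope ereal_scope.

Definition image_measure d1 d2 (T1 : measurableType d1) (T2 : measurableType d2)
    (R : realType) (mu : {measure set T1 -> \bar R}) (f : T1 -> T2)
    (mf : measurable_fun setT f) : {measure set T2 -> \bar R}.
Proof. by refine (pushforward mu f : {measure set T2 -> \bar R}). Defined.

Lemma integral_image_measure d1 d2 (T1 : measurableType d1) (T2 : measurableType d2)
    (R : realType) (mu : {measure set T1 -> \bar R}) (f : T1 -> T2)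
    (mf : measurable_fun setT f) (h : T2 -> \bar R) :
  measurable_fun setT h -> (forall y, 0 <= h y) ->
  \int[image_measure mu mf]_y h y = \int[mu]_x h (f x).
Proof.
move=> mh h0.
by rewrite [LHS](ge0_integral_pushforward mf) ?preimage_setT.
Qed.

Section SigmaFinitePack.
Context d (T : measurableType d) (R : realType) (mu : {measure set T -> \bar R}).
Hypothesis smu : sigma_finite setT mu.
(** Turns a propositional proof of sigma-finiteness into a structure, so that a measure built by
    induction can be fed to the Tonelli theorems. *)
Definition sigma_finite_pack : set T -> \bar R := mu.
HB.instance Definition _ := Measure.on sigma_finite_pack.
HB.instance Definition _ := Measure_isSigmaFinite.Build _ _ _ sigma_finite_pack smu.
Definition sigma_finite_of : {sigma_finite_measure set T -> \bar R} := sigma_finite_pack.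
End SigmaFinitePack.

Lemma product_sigma_finite d1 d2 (T1 : measurableType d1) (T2 : measurableType d2)
    (R : realType) (m1 : {sigma_finite_measure set T1 -> \bar R})
    (m2 : {sigma_finite_measure set T2 -> \bar R}) : sigma_finite setT (m1 \x m2).
Proof.
have /sigma_finiteP[F [FT ndF Foo]] := sigma_finiteT m1.
have /sigma_finiteP[G [GT ndG Goo]] := sigma_finiteT m2.
exists (fun k => F k `*` G k) => [|k].
  apply/esym/seteqP; split=> // -[x y] _.
  have : setT x by []. have : setT y by [].
  rewrite {1}GT {1}FT => -[j _ Gy] [i _ Fx]; exists (maxn i j) => //; split.
    by move: x Fx; exact/subsetPset/ndF/leq_maxl.
  by move: y Gy; exact/subsetPset/ndG/leq_maxr.
have [[mF Fk] [mG Gk]] := (Foo k, Goo k); split; first exact: measurableX.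
by rewrite product_measure1E// lte_mul_pinfty// ge0_fin_numE.
Qed.

(** The iterated integral of [Defs.lebint], for an arbitrary measure on the line. *)
Fixpoint iterint (R : realType) (m : {measure set (measurableTypeR R) -> \bar R}) n :
    (n.-tuple R -> \bar R) -> \bar R :=
  match n return (n.-tuple R -> \bar R) -> \bar R with
  | 0 => fun f => f [tuple]
  | n'.+1 => fun f =>
      \int[m]_x iterint m (fun t : n'.-tuple R => f [tuple of x :: t])
  end.

Lemma lebintE (R : realType) n (f : n.-tuple R -> \bar R) :
  lebint f = iterint (@lebesgue_measure R) f.
Proof.
elim: n f => [|n IH] f //=.
by apply: eq_integral => x _; rewrite IH.
Qed.

Section ProductMeasure.
Variables (R : realType).

Definition tcons n (p : measurableTypeR R * n.-tuple R) : n.+1.-tuple R := [tuple of p.1 :: p.2].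

Definition tuncons n (t : n.+1.-tuple R) : measurableTypeR R * n.-tuple R :=
  (thead t, [tuple of behead t]).

Lemma measurable_tcons n : measurable_fun setT (@tcons n).
Proof. exact: measurable_cons. Qed.

Lemma measurable_tuncons n : measurable_fun setT (@tuncons n).
Proof.
apply/measurable_fun_pairP; split; first exact: measurable_tnth.
exact: measurable_behead.
Qed.

Lemma tuncons_cons n : cancel (@tcons n) (@tuncons n).
Proof. by move=> [x t]; congr pair; apply: val_inj. Qed.

(** In dimension n + 1 the measure is the image under [tcons] of the product of [m] with the measure
    in dimension n; sigma-finiteness is carried along because Tonelli needs it at the next
    dimension. *)
Lemma product_measure_exists (m : {sigma_finite_measure set (measurableTypeR R) -> \bar R}) n :
  exists nu : {sigma_finite_measure set (n.-tuple R) -> \bar R},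
   (forall f : n.-tuple R -> \bar R, measurable_fun setT f -> (forall t, 0 <= f t) ->
    \int[nu]_t f t = iterint m f).
Proof.
elim: n => [|n [nu nuE]].
  exists (dirac [tuple]) => f mf f0.
  by rewrite integral_dirac// diracT mul1e.
pose M := image_measure (m \x nu) (@measurable_tcons n).
have sM : sigma_finite setT M.
  have [F FT Foo] := product_sigma_finite m nu.
  exists (fun k => (@tuncons n) @^-1` F k).
    by rewrite -preimage_bigcup -FT preimage_setT.
  move=> k; have [mF Fk] := Foo k; split.
    by rewrite -[X in measurable X]setTI; exact: measurable_tuncons.
  rewrite /M/= /pushforward -comp_preimage (_ : _ \o _ = id)//.
  by apply/funext => p /=; rewrite tuncons_cons.
exists (sigma_finite_of sM) => f mf f0.
rewrite [LHS](integral_image_measure (m \x nu) (@measurable_tcons n))//.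
rewrite (fubini_tonelli1 (fun p => f (tcons p))) /fubini_F//=; last first.
  exact: measurableT_comp mf (@measurable_tcons n).
apply: eq_integral => x _; rewrite nuE//.
apply: measurableT_comp => //.
exact: (measurableT_comp (@measurable_tcons n) (pair1_measurable x)).
Qed.

Definition prod_measure (m : {sigma_finite_measure set (measurableTypeR R) -> \bar R}) n :
  {sigma_finite_measure set (n.-tuple R) -> \bar R} :=
  projT1 (cid (product_measure_exists m n)).

Lemma integral_prod_measure (m : {sigma_finite_measure set (measurableTypeR R) -> \bar R})
    n (f : n.-tuple R -> \bar R) :
  measurable_fun setT f -> (forall t, 0 <= f t) ->
  \int[prod_measure m n]_t f t = iterint m f.
Proof. by move=> mf f0; rewrite /prod_measure; case: cid => nu /= ->. Qed.

End ProductMeasure.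

(** * Affine changes of variable on the line *)

Section Affine1.
Variable R : realType.
Local Notation mu := (@lebesgue_measure R).

(** By uniqueness of Lebesgue measure it suffices to compare half-open intervals; a negative [a]
    exchanges their open and closed ends. *)
Lemma lebesgue_measure_affine (a b : R) (A : set (measurableTypeR R)) :
  a != 0%R -> measurable A ->
  mu A = `|a|%:E * mu [set x | A (a * x + b)%R].
Proof.
move=> a0 mA.
have mf : measurable_fun setT (fun x : measurableTypeR R => (a * x + b)%R : measurableTypeR R).
  by apply: measurable_funD => //; exact: measurable_funM.
have ab0 : (0 <= `|a|)%R by [].
pose M : {measure set (measurableTypeR R) -> \bar R} := mscale (NngNum ab0) (image_measure mu mf).
have -> : `|a|%:E * mu [set x | A (a * x + b)%R] = M A by [].
apply: lebesgue_measure_unique => // _ [[x y] _ <-] /=.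
rewrite /M/= /mscale/= /pushforward.
have [a_gt0|a_lt0|aE] := ltgtP a 0%R; last by rewrite aE eqxx in a0.
- rewrite (_ : _ @^-1` _ = `[((y - b) / a)%R, ((x - b) / a)%R[%classic); last first.
    apply/seteqP; split=> z /=; rewrite !in_itv/=.
      by rewrite ler_ndivrMr// ltr_ndivlMr// -!(mulrC a) lerBrDr ltrBlDr andbC.
    by rewrite ler_ndivrMr// ltr_ndivlMr// -!(mulrC a) lerBrDr ltrBlDr andbC.
  rewrite !lebesgue_measure_itv/= !lte_fin ltr_nM2r ?invr_lt0// ltrD2r.
  case: ifPn => xy; last by rewrite mule0.
  by rewrite -!EFinB -EFinM ltr0_norm//; congr EFin; field.
- rewrite (_ : _ @^-1` _ = `]((x - b) / a)%R, ((y - b) / a)%R]%classic); last first.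
    apply/seteqP; split=> z /=; rewrite !in_itv/=.
      by rewrite ltr_pdivrMr// ler_pdivlMr// -!(mulrC a) lerBrDr ltrBlDr.
    by rewrite ltr_pdivrMr// ler_pdivlMr// -!(mulrC a) lerBrDr ltrBlDr.
  rewrite !lebesgue_measure_itv/= !lte_fin ltr_pM2r ?invr_gt0// ltrD2r.
  case: ifPn => xy; last by rewrite mule0.
  by rewrite -!EFinB -EFinM gtr0_norm//; congr EFin; field.
Qed.

Lemma integral_affine (a b : R) (f : R -> \bar R) :
  a != 0%R -> measurable_fun setT f -> (forall x, 0 <= f x) ->
  \int[mu]_x f x = `|a|%:E * \int[mu]_x f (a * x + b)%R.
Proof.
move=> a0 mf f0.
have mg : measurable_fun setT (fun x : measurableTypeR R => (a * x + b)%R : measurableTypeR R).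
  by apply: measurable_funD => //; exact: measurable_funM.
rewrite -(integral_image_measure mu mg mf f0).
have ab0 : (0 <= `|a|)%R by [].
rewrite -(ge0_integral_mscale (image_measure mu mg) measurableT (NngNum ab0))//=.
by apply: eq_measure_integral => A mA _; exact: lebesgue_measure_affine.
Qed.

End Affine1.

Section RowTuple.
Variable R : realType.

Definition tup n (u : 'rV[R]_n) : n.-tuple R := [tuple u 0%R i | i < n].

Lemma tupK n : cancel (@tup n) (@row_of R n).
Proof. by move=> u; apply/rowP => i; rewrite mxE tnth_mktuple. Qed.

Lemma row_ofK n : cancel (@row_of R n) (@tup n).
Proof. by move=> t; apply: eq_from_tnth => i; rewrite tnth_mktuple mxE. Qed.

Lemma row_of_cons n (x : R) (t : n.-tuple R) :
  row_of [tuple of x :: t] = row_mx x%:M (row_of t) :> 'rV[R]_(1 + n).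
Proof.
apply/rowP => i; rewrite !mxE; case: splitP => j ji; rewrite !mxE.
  by rewrite (_ : i = ord0) ?(ord1 j) ?mulr1n//; apply: val_inj; rewrite /= ji ord1.
by rewrite (_ : i = lift ord0 j) ?tnthS//; apply: val_inj; rewrite /= ji.
Qed.

Lemma measurable_tup d (T : measurableType d) n (f : T -> 'rV[R]_n) :
  (forall i, measurable_fun setT (fun x => f x 0%R i)) ->
  measurable_fun setT (fun x => tup (f x)).
Proof.
move=> mf; apply/measurable_fun_tnthP => i.
by apply: (eq_measurable_fun (fun x => f x 0%R i)) => // x _ /=; rewrite tnth_mktuple.
Qed.

Lemma measurable_row_of n i : measurable_fun setT (fun t : n.-tuple R => row_of t 0%R i).
Proof.
apply: (eq_measurable_fun (fun t : n.-tuple R => tnth t i)); last exact: measurable_tnth.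
by move=> t _; rewrite mxE.
Qed.

Lemma measurable_affine n (m : 'rV[R]_n) (A : 'M[R]_n) :
  measurable_fun setT (fun t : n.-tuple R => tup (m + row_of t *m A)%R).
Proof.
apply: measurable_tup => i.
apply: (eq_measurable_fun (fun t : n.-tuple R => m 0 i + \sum_j row_of t 0 j * A j i)%R).
  by move=> t _; rewrite !mxE.
apply: measurable_funD => //; apply: measurable_sum => j.
by apply: measurable_funM => //; exact: measurable_row_of.
Qed.

End RowTuple.

(** * Linear changes of variable in iterated Lebesgue integrals *)

Section LinearChange.
Variable R : realType.
Local Notation mu := (@lebesgue_measure R).

Definition rmeas n (F : 'rV[R]_n -> \bar R) := measurable_fun setT (F \o @row_of R n).
Definition rint n (F : 'rV[R]_n -> \bar R) := iterint mu (F \o @row_of R n).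

Lemma rint_prod n (F : 'rV[R]_n -> \bar R) : rmeas F -> (forall u, 0 <= F u) ->
  rint F = \int[prod_measure mu n]_t F (row_of t).
Proof. by move=> mF F0; rewrite integral_prod_measure. Qed.

Lemma rint_ge0 n (F : 'rV[R]_n -> \bar R) : rmeas F -> (forall u, 0 <= F u) -> 0 <= rint F.
Proof. by move=> mF F0; rewrite rint_prod// integral_ge0. Qed.

Lemma rmeas_affine n (m : 'rV[R]_n) (A : 'M[R]_n) (F : 'rV[R]_n -> \bar R) :
  rmeas F -> rmeas (fun u => F (m + u *m A)%R).
Proof.
move=> mF; have := measurableT_comp mF (measurable_affine m A).
by apply: eq_measurable_fun => t _ /=; rewrite tupK.
Qed.

Lemma rint_cons n (F : 'rV[R]_(1 + n) -> \bar R) :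
  rint F = \int[mu]_x rint (fun u => F (row_mx x%:M u)).
Proof.
apply: eq_integral => x _; congr (iterint _ _); apply/funext => t /=.
by rewrite row_of_cons.
Qed.

Lemma rmeas_cons n (F : 'rV[R]_(1 + n) -> \bar R) x :
  rmeas F -> rmeas (fun u => F (row_mx x%:M u)).
Proof.
move=> mF.
have mc : measurable_fun setT (fun t : n.-tuple R => [tuple of x :: t]) by exact: measurable_cons.
have := measurableT_comp mF mc.
by apply: eq_measurable_fun => t _ /=; rewrite row_of_cons.
Qed.

Lemma measurable_pair_cons n (F : 'rV[R]_(1 + n) -> \bar R) : rmeas F ->
  measurable_fun setT (fun p : measurableTypeR R * n.-tuple R => F (row_mx p.1%:M (row_of p.2))).
Proof.
move=> mF; have := measurableT_comp mF (@measurable_tcons R n).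
by apply: eq_measurable_fun => t _ /=; rewrite row_of_cons.
Qed.

Lemma measurable_rint_cons n (F : 'rV[R]_(1 + n) -> \bar R) : rmeas F -> (forall u, 0 <= F u) ->
  measurable_fun setT (fun x : measurableTypeR R => rint (fun u => F (row_mx x%:M u))).
Proof.
move=> mF F0.
have := measurable_fun_fubini_tonelli_F (m2 := prod_measure mu n) _ (measurable_pair_cons mF)
    (fun p => F0 _).
apply: eq_measurable_fun => x _; rewrite /fubini_F/= rint_prod//.
exact: rmeas_cons.
Qed.

(** Tonelli with the first coordinate integrated innermost, as required by a shear that moves it by
    a function of the others. *)
Lemma rint_swap n (F : 'rV[R]_(1 + n) -> \bar R) : rmeas F -> (forall u, 0 <= F u) ->
  rint F = \int[prod_measure mu n]_t \int[mu]_x F (row_mx x%:M (row_of t)).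
Proof.
move=> mF F0.
have := fubini_tonelli (m1 := mu) (m2 := prod_measure mu n) _ (measurable_pair_cons mF) (fun p
    => F0 _).
rewrite /fubini_G /fubini_F/= => <-; rewrite rint_cons.
by apply: eq_integral => x _; rewrite rint_prod//; exact: rmeas_cons.
Qed.

Lemma rint_translation n (s : 'rV[R]_n) (F : 'rV[R]_n -> \bar R) : rmeas F ->
  (forall u, 0 <= F u) -> rint F = rint (fun u => F (s + u)%R).
Proof.
elim: n s F => [|n IH] s F mF F0.
  by rewrite /rint/=; congr F; apply/rowP => -[].
pose s' : 'rV[R]_(1 + n) := s.
have mF' : rmeas (fun u => F (s + u)%R).
  by have := rmeas_affine s 1%:M mF; congr rmeas; apply/funext => u; rewrite mulmx1.
rewrite (rint_cons F) (rint_cons (fun u => F (s + u)%R)).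
have mG := measurable_rint_cons mF F0.
rewrite (integral_affine (a := 1%R) (lsubmx s' 0 0)%R _ mG) ?oner_neq0//; last first.
  by move=> x; apply: rint_ge0 => //; exact: rmeas_cons.
rewrite normr1 mul1e; apply: eq_integral => x _.
rewrite (IH (rsubmx s')) //; last exact: rmeas_cons.
congr rint; apply/funext => u; congr F.
have -> : (s + row_mx x%:M u)%R = row_mx (lsubmx s' + x%:M)%R (rsubmx s' + u)%R.
  by rewrite -add_row_mx hsubmxK.
suff -> : (1 * x + lsubmx s' 0 0)%R%:M = (lsubmx s' + x%:M)%R by [].
by apply/matrixP => i j; rewrite !ord1 !mxE mul1r addrC eqxx !mulr1n.
Qed.

Definition change_of_var n (A : 'M[R]_n) := forall F : 'rV[R]_n -> \bar R,
  rmeas F -> (forall u, 0 <= F u) ->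
  rint F = `|\det A|%:E * rint (fun u => F (u *m A)).

Lemma rmeas_mulmx n (A : 'M[R]_n) (F : 'rV[R]_n -> \bar R) :
  rmeas F -> rmeas (fun u => F (u *m A)).
Proof.
by move=> /(rmeas_affine 0%R A); congr rmeas; apply/funext => u; rewrite add0r.
Qed.

Lemma change_of_var_mul n (A B : 'M[R]_n) :
  change_of_var A -> change_of_var B -> change_of_var (A *m B).
Proof.
move=> cA cB F mF F0; rewrite cB// (cA (fun u => F (u *m B)))//; last exact: rmeas_mulmx.
rewrite muleA -EFinM -normrM mulrC det_mulmx; congr (_ * rint _).
by apply/funext => u; rewrite mulmxA.
Qed.

Lemma change_of_var_upper n (v : 'rV[R]_n) :
  change_of_var (block_mx 1%:M v 0%R 1%:M : 'M[R]_(1 + n)).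
Proof.
move=> F mF F0; rewrite det_ublock !det1 mulr1 normr1 mul1e.
rewrite (rint_cons F) [in RHS]rint_cons; apply: eq_integral => x _.
rewrite (rint_translation (x *: v)%R)//; last exact: rmeas_cons.
congr rint; apply/funext => u; congr F.
by rewrite mul_row_block !mulmx1 mulmx0 addr0 mul_scalar_mx.
Qed.

Lemma change_of_var_lower n (w : 'cV[R]_n) :
  change_of_var (block_mx 1%:M 0%R w 1%:M : 'M[R]_(1 + n)).
Proof.
move=> F mF F0; rewrite det_lblock !det1 mulr1 normr1 mul1e.
rewrite (rint_swap mF F0) (rint_swap (rmeas_mulmx _ mF))//.
apply: eq_integral => t _.
have mF1 : measurable_fun setT (fun x : measurableTypeR R => F (row_mx x%:M (row_of t))).
  exact: (measurableT_comp (measurable_pair_cons mF) (pair2_measurable t)).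
rewrite (integral_affine (a := 1%R) ((row_of t *m w) 0 0)%R _ mF1)//.
rewrite normr1 mul1e; apply: eq_integral => x _; congr F.
rewrite mul_row_block !mulmx1 mulmx0 add0r; congr row_mx.
by apply/matrixP => i j; rewrite !ord1 !mxE mul1r eqxx !mulr1n.
Qed.

Lemma change_of_var_diag n (c : R) (B : 'M[R]_n) : c != 0%R -> change_of_var B ->
  change_of_var (block_mx c%:M 0%R 0%R B : 'M[R]_(1 + n)).
Proof.
move=> c0 cB F mF F0; rewrite det_ublock det_scalar1 normrM EFinM -muleA.
have mG := measurable_rint_cons mF F0.
rewrite rint_cons (integral_affine (a := c) 0%R _ mG)//; last first.
  by move=> x; apply: rint_ge0 => //; exact: rmeas_cons.
congr (_ * _); rewrite rint_cons -ge0_integralZl//; last 2 first.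
- have := measurable_rint_cons (rmeas_mulmx (block_mx c%:M 0%R 0%R B : 'M[R]_(1 + n)) mF) (fun u
    => F0 _).
  by apply: eq_measurable_fun.
- move=> x _; apply: rint_ge0 => //; exact: (rmeas_cons _ (rmeas_mulmx _ mF)).
apply: eq_integral => x _; rewrite cB//; last exact: rmeas_cons.
congr (_ * rint _); apply/funext => u; congr F.
by rewrite mul_row_block !mulmx0 addr0 add0r -scalar_mxM addr0 mulrC.
Qed.

(** Block Gaussian elimination: when the corner is nonzero, [M] is a lower shear times a block
    diagonal matrix carrying the Schur complement times an upper shear, and the induction hypothesis
    handles the Schur complement. *)
Lemma change_of_var_unit n (A : 'M[R]_n) : A \in unitmx -> change_of_var A.
Proof.
elim: n A => [|n IH] A Au.
  by move=> F mF F0; rewrite det_mx00 normr1 mul1e /rint/=; congr F; apply/rowP => -[].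
suff H (M : 'M[R]_(1 + n)) : M \in unitmx -> ulsubmx M ord0 ord0 != 0%R -> change_of_var M.
  pose M : 'M[R]_(1 + n) := A; have Mu : M \in unitmx := Au.
  have [c0|] := eqVneq (ulsubmx M ord0 ord0) 0%R; last exact: H.
  have [dl0|/matrix0Pn[i [j ij]]] := eqVneq (dlsubmx M) 0%R.
    move: Mu; rewrite -[M]submxK dl0 unitmxE det_ublock [ulsubmx M]mx11_scalar.
    by rewrite det_scalar1 c0 mul0r unitr0.
  rewrite (ord1 j) in ij.
  pose E (w : 'rV[R]_n) : 'M[R]_(1 + n) := block_mx 1%:M w 0%R 1%:M.
  have Eu w : E w \in unitmx by rewrite unitmxE det_ublock !det1 mulr1 unitr1.
  pose w : 'rV[R]_n := delta_mx ord0 i.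
  (* The corner vanishes but the entry of row [i] below it does not; the shear [E w] adds that row
     to the first one and makes the corner nonzero. *)
  have ME : M = E (- w)%R *m (E w *m M).
    rewrite mulmxA /E mulmx_block !mulmx1 !mul1mx !mul0mx !mulmx0 !addr0 add0r.
    by rewrite subrr -scalar_mx_block mul1mx.
  rewrite -[A]/M ME; apply: change_of_var_mul; first exact: change_of_var_upper.
  apply: H; first by rewrite unitmx_mul Eu.
  rewrite -[M]submxK /E mulmx_block block_mxKul mul1mx -rowE !mxE.
  by move: c0 ij; rewrite !mxE => ->; rewrite add0r.
move=> Mu c0.
pose c := ulsubmx M ord0 ord0.
have ulE : ulsubmx M = c%:M by rewrite [LHS]mx11_scalar.
pose S := (drsubmx M - c^-1 *: (dlsubmx M *m ursubmx M))%R.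
have ME : M = (block_mx 1%:M 0%R (c^-1 *: dlsubmx M)%R 1%:M : 'M[R]_(1 + n)) *m
   ((block_mx c%:M 0%R 0%R S : 'M[R]_(1 + n)) *m (block_mx 1%:M (c^-1 *: ursubmx M)%R 0%R 1%:M :
       'M[R]_(1 + n))).
  rewrite !mulmx_block !mulmx1 !mul1mx !mulmx0 !mul0mx !addr0 !add0r.
  rewrite mul_scalar_mx mul_mx_scalar !scalerA !divff// !scale1r.
  by rewrite -scalemxAl addrC subrK -ulE submxK.
rewrite ME; apply: change_of_var_mul; first exact: change_of_var_lower.
apply: change_of_var_mul; last exact: change_of_var_upper.
apply: change_of_var_diag => //; apply: IH.
move: Mu; rewrite ME !unitmx_mul => /andP[_ /andP[]].
by rewrite unitmxE det_ublock unitrM -unitmxE => /andP[].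
Qed.

End LinearChange.

End LebesgueTuples.

Local Open Scope ring_scope.

(** * Gaussian integration *)

Section Density.
Variable R : realType.
Local Notation mu := (@lebesgue_measure R).
Local Open Scope ereal_scope.

(** The normal density agrees almost everywhere with the Radon-Nikodym derivative, since both have
    the same integral over every measurable set. *)
Lemma integral_normal_prob (f : R -> \bar R) : measurable_fun setT f -> (forall x, 0 <= f x) ->
  \int[normal_prob 0 1]_x f x = \int[mu]_x ((normal_pdf 0 1 x)%:E * f x).
Proof.
move=> mf f0; have Nmu := @normal_prob_dominates R 0 1.
pose N : {finite_measure set (measurableTypeR R) -> \bar R} := normal_prob 0 1.
pose g := Radon_Nikodym_SigmaFinite.f N mu.
rewrite -(Radon_Nikodym_SigmaFinite.change_of_variables (nu := N) Nmu)//.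
under [RHS]eq_integral do rewrite muleC.
have mg := measurable_int mu (Radon_Nikodym_SigmaFinite.f_integrable Nmu).
have mpdf : measurable_fun setT (fun x : measurableTypeR R => (normal_pdf 0 1 x)%:E : \bar R).
  by apply/measurable_EFinP; exact: measurable_normal_pdf.
apply: ae_eq_integral => //; [exact: emeasurable_funM|exact: emeasurable_funM|].
apply: ae_eqe_mul2l; apply: integral_ae_eq => //.
  exact: Radon_Nikodym_SigmaFinite.f_integrable.
by move=> A _ mA; rewrite -Radon_Nikodym_SigmaFinite.f_integral.
Qed.

Definition std_density n (u : 'rV[R]_n) : R :=
  ((Num.sqrt (2 * pi))^-1 ^+ n * expR (- sqnorm u / 2))%R.

Lemma std_density_ge0 n (u : 'rV[R]_n) : (0 <= std_density u)%R.
Proof. by rewrite mulr_ge0 ?exprn_ge0 ?expR_ge0. Qed.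

Lemma sqnorm_cons n (x : R) (u : 'rV[R]_n) :
  sqnorm (row_mx x%:M u : 'rV[R]_(1 + n)) = (x ^+ 2 + sqnorm u)%R.
Proof.
rewrite /sqnorm big_split_ord big_ord1; congr (_ + _)%R.
  by rewrite row_mxEl mxE eqxx mulr1n.
by apply: eq_bigr => i _; rewrite row_mxEr.
Qed.

Lemma std_density_cons n (x : R) (u : 'rV[R]_n) :
  std_density (row_mx x%:M u : 'rV[R]_(1 + n)) = (normal_pdf 0 1 x * std_density u)%R.
Proof.
rewrite /std_density sqnorm_cons normal_pdfE ?oner_neq0// /normal_peak /normal_fun.
rewrite expr1n mul1r subr0 exprS -[in RHS]mulr_natl.
rewrite [in RHS]mulrACA -[in RHS]expRD -mulrDl -opprD -mulrA mulrA.
by congr (_ * _)%R; exact: exprS.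
Qed.

Lemma measurable_sqnorm n : measurable_fun setT (fun t : n.-tuple R => sqnorm (row_of t)).
Proof.
apply: measurable_sum => i; apply: measurable_funX.
exact: measurable_row_of.
Qed.

Lemma measurable_std_density n : measurable_fun setT (fun t : n.-tuple R => std_density (row_of t)).
Proof.
apply: measurable_funM => //; apply: measurableT_comp => //.
by apply: measurable_funM => //; apply: measurableT_comp => //; exact: measurable_sqnorm.
Qed.

Definition std_gauss n : {sigma_finite_measure set (n.-tuple R) -> \bar R} :=
  prod_measure (normal_prob 0 1 : {sigma_finite_measure set (measurableTypeR R) -> \bar R}) n.

Lemma iterint_ge0 (m : {measure set (measurableTypeR R) -> \bar R}) n (f : n.-tuple R -> \bar R) :
  (forall t, 0 <= f t) -> 0 <= iterint m f.
Proof.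
elim: n f => [|n IH] f f0 /=; first exact: f0.
by apply: integral_ge0 => x _; exact: IH.
Qed.

Lemma rint_scale n (c : \bar R) (F : 'rV[R]_n -> \bar R) : rmeas F -> (forall u, 0 <= F u) -> 0
    <= c ->
  rint (fun u => c * F u) = c * rint F.
Proof.
move=> mF F0 c0; rewrite !rint_prod//; last 2 first.
- by apply: emeasurable_funM.
- by move=> u; rewrite mule_ge0.
by rewrite ge0_integralZl.
Qed.

Lemma integral_std_gauss n (F : 'rV[R]_n -> \bar R) :
  rmeas F -> (forall u, 0 <= F u) ->
  \int[std_gauss n]_t F (row_of t) = rint (fun u => (std_density u)%:E * F u).
Proof.
move=> mF F0; rewrite /std_gauss integral_prod_measure//.
elim: n F mF F0 => [|n IH] F mF F0.
  rewrite /rint/= /std_density expr0 mul1r.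
  by rewrite [sqnorm _]big_ord0 oppr0 mul0r expR0 mul1e.
rewrite rint_cons /=.
have E x : iterint (normal_prob 0 1) (fun t : n.-tuple R => F (row_of [tuple of x :: t])) =
   rint (fun u => (std_density u)%:E * F (row_mx x%:M u)).
  rewrite -IH//; last exact: rmeas_cons.
  by congr iterint; apply/funext => t /=; rewrite row_of_cons.
under eq_integral do rewrite E.
(* The density of the tail is seen as a function of the whole vector, so that [measurable_rint_cons]
   gives measurability of the inner integral in the first coordinate. *)
have mD : rmeas (fun u : 'rV[R]_(1 + n) => (std_density (rsubmx u))%:E).
  apply/measurable_EFinP.
  have mr : measurable_fun setT (fun t : n.+1.-tuple R => tup (rsubmx (row_of t : 'rV[R]_(1 + n)))).
    apply: measurable_tup => i.
    apply: (eq_measurable_fun (fun t : n.+1.-tuple R => row_of t ord0 (rshift 1 i))).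
      by move=> t _; rewrite !mxE.
    exact: measurable_row_of.
  have := measurableT_comp (@measurable_std_density n) mr.
  by apply: eq_measurable_fun => t _ /=; rewrite tupK.
have mF' : rmeas (fun u : 'rV[R]_(1 + n) => (std_density (rsubmx u))%:E * F u).
  exact: emeasurable_funM.
rewrite integral_normal_prob; last 2 first.
- have := measurable_rint_cons mF'.
  have h : forall u : 'rV[R]_(1 + n), 0 <= (std_density (rsubmx u))%:E * F u.
    by move=> u; rewrite mule_ge0 ?lee_fin ?std_density_ge0.
  move=> /(_ h); apply: eq_measurable_fun => x _.
  by congr rint; apply/funext => u; rewrite row_mxKr.
- move=> x; apply: iterint_ge0 => t; rewrite mule_ge0 ?lee_fin ?std_density_ge0//.
apply: eq_integral => x _; rewrite -rint_scale ?lee_fin ?normal_pdf_ge0//.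
- congr rint; apply/funext => u; rewrite muleA -EFinM; congr (_ * _).
  by rewrite std_density_cons.
- have := rmeas_cons x mF'; congr rmeas; apply/funext => u.
  by rewrite row_mxKr.
- by move=> u; rewrite mule_ge0 ?lee_fin ?std_density_ge0.
Qed.

Lemma std_gauss_setT n : std_gauss n setT = 1.
Proof.
rewrite -[setT]setIid -integral_indic//.
under eq_integral do rewrite indicT.
rewrite integral_prod_measure//; last by apply/measurable_EFinP; exact: measurable_cst.
elim: n => [|n IH] //=.
under eq_integral do rewrite IH.
by rewrite integral_cst// mul1e; exact: probability_setT.
Qed.

HB.instance Definition _ n := Measure_isProbability.Build _ _ _ (std_gauss n) (@std_gauss_setT n).

End Density.

Section Norms.
Variables (R : realType) (n : nat).
Implicit Types (u v : 'rV[R]_n) (A : 'M[R]_n).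

Lemma dot_cauchy_schwarz u v : dot u v ^+ 2 <= sqnorm u * sqnorm v.
Proof.
have [->|v0] := eqVneq v 0.
  rewrite dotC /dot mul0mx mxE expr0n/=.
  by rewrite mulr_ge0 ?sqnorm_ge0.
have := sqnorm_ge0 (sqnorm v *: u - dot u v *: v).
rewrite !sqnormE !dot_lin (dotC v u) -sqnormE.
have -> : sqnorm v * (sqnorm v * dot u u - dot u v * dot u v) +
  (sqnorm v * - (dot u v * dot u v) - dot u v * - (dot u v * sqnorm v)) =
  sqnorm v * (dot u u * sqnorm v - dot u v ^+ 2) by ring.
by rewrite pmulr_rge0 ?subr_ge0// sqnorm_gt0.
Qed.

(** The square of the Frobenius norm, standing in for that of the operator norm. *)
Definition frob A : R := \sum_j sqnorm (col j A)^T.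

Lemma frob_ge0 A : 0 <= frob A.
Proof. by apply: sumr_ge0 => j _; exact: sqnorm_ge0. Qed.

Lemma sqnorm_mulmx u A : sqnorm (u *m A) <= sqnorm u * frob A.
Proof.
rewrite {1}/sqnorm /frob mulr_sumr; apply: ler_sum => j _.
apply: le_trans (dot_cauchy_schwarz _ _); rewrite dotE mxE.
by under [in leRHS]eq_bigr do rewrite !mxE.
Qed.

Lemma sqnormD_le u v : sqnorm (u + v) <= 2 * sqnorm u + 2 * sqnorm v.
Proof.
have := sqnorm_ge0 (u - v); rewrite !sqnormE !dot_lin (dotC v u); lra.
Qed.

End Norms.

(** * From Gaussian densities to standard Gaussian integrals *)

Section Bridge.
Variable R : realType.
Local Notation mu := (@lebesgue_measure R).
Implicit Types n : nat.

Lemma gauss_density_ge0 n (m : 'rV[R]_n) S u : 0 <= gauss_density m S u.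
Proof. by rewrite mulr_ge0 ?invr_ge0 ?expR_ge0. Qed.

Lemma qform_invmx n (A : 'M[R]_n) u : A \in unitmx ->
  qform (invmx (A^T *m A)) u = sqnorm (u *m invmx A).
Proof.
move=> Au; have Atu : A^T \in unitmx by rewrite unitmx_tr.
have -> : invmx (A^T *m A) = invmx A *m (invmx A)^T.
  apply: (can_inj (mulmxK (_ : A^T *m A \in unitmx))); rewrite ?unitmx_mul ?Atu//.
  by rewrite mulVmx ?unitmx_mul ?Atu// trmx_inv -!mulmxA (mulKmx Atu) mulVmx.
by rewrite qformE mulmxA dot_mulmx trmxK -sqnormE.
Qed.

Lemma gauss_density_affine n (m : 'rV[R]_n) (A : 'M[R]_n) z : A \in unitmx ->
  `|\det A| * gauss_density m (A^T *m A) (m + z *m A) = std_density z.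
Proof.
move=> Au; have d0 : \det A != 0 by rewrite -unitfE -unitmxE.
rewrite /gauss_density /std_density mulrA; congr (_ * expR _); last first.
  by rewrite (addrC m) addrK qform_invmx// mulmxK.
have p2 : 0 <= 2 * pi :> R by rewrite mulr_ge0// pi_ge0.
rewrite det_mulmx det_tr -expr2 sqrtrM ?exprn_ge0// sqrtr_sqr.
rewrite invfM mulrCA divff ?normr_eq0// mulr1 exprVn; congr (_^-1).
elim: n {m A z Au d0} => [|k IH]; first by rewrite !expr0 sqrtr1.
by rewrite !exprS sqrtrM// IH.
Qed.

Lemma measurable_qform n (A : 'M[R]_n) (m : 'rV[R]_n) :
  measurable_fun setT (fun t : n.-tuple R => qform A (row_of t - m)).
Proof.
apply: measurable_sum => i; apply: measurable_sum => j.
have h k : measurable_fun setT (fun t : n.-tuple R => (row_of t - m) 0 k).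
  apply: (eq_measurable_fun (fun t : n.-tuple R => row_of t 0 k - m 0 k)).
    by move=> t _; rewrite !mxE.
  by apply: measurable_funB => //; exact: measurable_row_of.
by apply: measurable_funM => //; apply: measurable_funM.
Qed.

Lemma measurable_gauss_density n (m : 'rV[R]_n) S :
  measurable_fun setT (fun t : n.-tuple R => gauss_density m S (row_of t)).
Proof.
apply: measurable_funM => //; apply: measurableT_comp => //.
by apply: measurable_funM => //; apply: measurableT_comp => //; exact: measurable_qform.
Qed.

Local Open Scope ereal_scope.

(** The substitution u = m + z A, whose Jacobian turns the density into the standard one; a row
    vector z A has covariance A^T A, hence the second parameter. *)
Lemma gauss_rint n (m : 'rV[R]_n) (A : 'M[R]_n) (F : 'rV[R]_n -> \bar R) :
  A \in unitmx -> rmeas F -> (forall u, 0 <= F u) ->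
  rint (fun u => (gauss_density m (A^T *m A) u)%:E * F u) =
  \int[std_gauss R n]_t F (m + row_of t *m A)%R.
Proof.
move=> Au mF F0.
have mDF : rmeas (fun u => (gauss_density m (A^T *m A) u)%:E * F u).
  apply: emeasurable_funM => //; apply/measurable_EFinP.
  exact: measurable_gauss_density.
have DF0 u : 0 <= (gauss_density m (A^T *m A) u)%:E * F u.
  by rewrite mule_ge0 ?lee_fin ?gauss_density_ge0.
have mDF' : rmeas (fun u => (gauss_density m (A^T *m A) (m + u)%R)%:E * F (m + u)%R).
  have := rmeas_affine m 1%:M mDF; congr rmeas; apply/funext => u.
  by rewrite mulmx1.
rewrite (rint_translation m mDF DF0) (change_of_var_unit Au mDF' (fun u => DF0 _)).
rewrite -(rint_scale (rmeas_affine m A mDF) (fun u => DF0 _)) ?lee_fin//.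
rewrite (integral_std_gauss (rmeas_affine m A mF) (fun u => F0 _)).
congr rint; apply/funext => u.
by rewrite muleA -EFinM gauss_density_affine.
Qed.

Lemma gauss_intE n (m : 'rV[R]_n) S (f : 'rV[R]_n -> \bar R) :
  gauss_int m S f = rint (fun u => (gauss_density m S u)%:E * f u).
Proof. exact: lebintE. Qed.

Lemma expR_sqnorm_cons n (c x : R) (u : 'rV[R]_n) :
  (expR (- c * sqnorm (row_mx x%:M u : 'rV[R]_(1 + n))) = expR (- c * x ^+ 2) * expR (- c *
      sqnorm u))%R.
Proof. by rewrite sqnorm_cons mulrDr expRD. Qed.

Lemma rmeas_expR_sqnorm n (c : R) : rmeas (fun u : 'rV[R]_n => (expR (- c * sqnorm u))%:E).
Proof.
apply/measurable_EFinP; apply: measurableT_comp => //.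
by apply: measurable_funM => //; exact: measurable_sqnorm.
Qed.

Lemma integral_expR_sqr_lty (c : R) : (0 < c)%R ->
  \int[mu]_x (expR (- c * x ^+ 2))%:E < +oo.
Proof.
move=> c0; have s0 : Num.sqrt c != 0%R by rewrite sqrtr_eq0 -ltNge.
have := integrableP _ _ _ (@integrableT_gauss R) => -[mg].
have -> : \int[mu]_x `|(EFin \o gauss_fun) x| = \int[mu]_x (gauss_fun x)%:E.
  by apply: eq_integral => x _ /=; rewrite ger0_norm ?gauss_fun_ge0.
rewrite (integral_affine (a := Num.sqrt c) 0%R s0)//; last first.
  by move=> x; rewrite lee_fin gauss_fun_ge0.
under eq_integral do rewrite /gauss_fun addr0 exprMn sqr_sqrtr ?(ltW c0)// -mulNr.
rewrite !ltey; apply: contra => /eqP ->.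
by rewrite gt0_muley// lte_fin normr_gt0.
Qed.

Lemma rint_expR_sqnorm_lty n (c : R) : (0 < c)%R ->
  rint (fun u : 'rV[R]_n => (expR (- c * sqnorm u))%:E) < +oo.
Proof.
move=> c0; elim: n => [|n IH]; first by rewrite /rint /= ltry.
rewrite rint_cons.
set K := rint _ in IH.
have K0 : 0 <= K by apply: iterint_ge0 => t; rewrite lee_fin expR_ge0.
have -> : \int[mu]_x rint (fun u : 'rV[R]_n => (expR (- c * sqnorm (row_mx x%:M u : 'rV[R]_(1 +
    n))))%:E) =
   \int[mu]_x ((expR (- c * x ^+ 2))%:E * K).
  apply: eq_integral => x _; rewrite -rint_scale ?lee_fin ?expR_ge0//.
  - by congr rint; apply/funext => u; rewrite expR_sqnorm_cons.
  - exact: rmeas_expR_sqnorm.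
rewrite ge0_integralZr//; last first.
  apply/measurable_EFinP; apply: measurableT_comp => //.
  by apply: measurable_funM => //; exact: measurable_funX.
rewrite lte_mul_pinfty ?integral_ge0// ?ge0_fin_numE// ?integral_expR_sqr_lty//.
by rewrite integral_ge0.
Qed.

(** Gaussian decay yields integrability in every dimension and survives freezing the first
    coordinate, which suits an induction along iterated integrals. *)
Definition gauss_dominated n (f : 'rV[R]_n -> R) := rmeas (EFin \o f) /\
  exists C c : R, (0 < c)%R /\ forall u, (`|f u| <= C * expR (- c * sqnorm u))%R.

Lemma gauss_dominated_integrable n (f : 'rV[R]_n -> R) : gauss_dominated f ->
  (prod_measure mu n).-integrable setT (fun t => (f (row_of t))%:E).
Proof.
move=> [mf [C [c [c0 fC]]]]; apply/integrableP; split => //.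
have C0 : (0 <= C)%R.
  have := le_trans (normr_ge0 _) (fC 0%R).
  by rewrite pmulr_lge0// expR_gt0.
apply: le_lt_trans (_ : C%:E * rint (fun u : 'rV[R]_n => (expR (- c * sqnorm u))%:E) < +oo);
    last first.
  have := rint_expR_sqnorm_lty n c0; rewrite !ltey => h.
  rewrite -ltey lte_mul_pinfty ?lee_fin ?fin_numE ?h//.
  have : 0 <= rint (fun u : 'rV[R]_n => (expR (- c * sqnorm u))%:E) by apply: iterint_ge0 => t;
      rewrite lee_fin expR_ge0.
  by rewrite ltey h.
rewrite -rint_scale//; [|exact: rmeas_expR_sqnorm].
rewrite rint_prod//; last 2 first.
- by apply: emeasurable_funM => //; exact: rmeas_expR_sqnorm.
- by move=> u; rewrite mule_ge0.
apply: ge0_le_integral => //.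
- by apply: measurableT_comp.
- by apply: emeasurable_funM => //; exact: rmeas_expR_sqnorm.
- by move=> t _; rewrite /= lee_fin fC.
Qed.

Lemma gauss_dominated_cons n (f : 'rV[R]_(1 + n) -> R) x : gauss_dominated f ->
  gauss_dominated (fun u : 'rV[R]_n => f (row_mx x%:M u)).
Proof.
move=> [mf [C [c [c0 fC]]]]; split; first exact: (rmeas_cons x mf).
exists C, c; split=> // u; apply: (le_trans (fC _)).
rewrite expR_sqnorm_cons ler_wpM2l//.
  have := le_trans (normr_ge0 _) (fC 0%R).
  by rewrite pmulr_lge0// expR_gt0.
rewrite ler_piMl ?expR_ge0// -expR0 ler_expR mulNr oppr_le0 mulr_ge0 ?(ltW c0)//.
exact: sqr_ge0.
Qed.

(** Fubini for signed functions: Tonelli treats the positive and negative parts separately, and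
    domination makes both outer integrals finite so that they can be subtracted. *)
Lemma rint_dominated n (f : 'rV[R]_n -> R) : gauss_dominated f ->
  rint (EFin \o f) = \int[prod_measure mu n]_t (f (row_of t))%:E.
Proof.
elim: n f => [|n IH] f df.
  rewrite [RHS]integralE !integral_prod_measure//=; first last.
  - by apply: measurable_funepos; exact: (proj1 df).
  - by apply: measurable_funeneg; exact: (proj1 df).
  by have /(congr1 (@^~ [tuple])) /= <- := funeposneg (fun x : 0.-tuple R => (f (row_of x))%:E).
have int := gauss_dominated_integrable df.
have mpos : rmeas (fun u => maxe (f u)%:E 0).
  by apply: measurable_maxe => //; exact: (proj1 df).
have mneg : rmeas (fun u => maxe (- (f u)%:E) 0).
  by apply: measurable_maxe => //; apply: measurableT_comp => //; exact: (proj1 df).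
have pos0 u : 0 <= maxe (f u)%:E 0 by rewrite le_max lexx orbT.
have neg0 u : 0 <= maxe (- (f u)%:E) 0 by rewrite le_max lexx orbT.
rewrite [RHS]integralE.
have -> : \int[prod_measure mu n.+1]_t (fun t => (f (row_of t))%:E)^\+ t =
   \int[mu]_x rint (fun u : 'rV[R]_n => maxe (f (row_mx x%:M u))%:E 0).
  rewrite -(rint_cons (fun u => maxe (f u)%:E 0)) (rint_prod mpos pos0).
  by apply: eq_integral => t _; rewrite funeposE.
have -> : \int[prod_measure mu n.+1]_t (fun t => (f (row_of t))%:E)^\- t =
   \int[mu]_x rint (fun u : 'rV[R]_n => maxe (- (f (row_mx x%:M u))%:E) 0).
  rewrite -(rint_cons (fun u => maxe (- (f u)%:E) 0)) (rint_prod mneg neg0).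
  by apply: eq_integral => t _; rewrite funenegE.
have ipos : mu.-integrable setT (fun x => rint (fun u : 'rV[R]_n => maxe (f (row_mx x%:M u))%:E 0)).
  apply/integrableP; split; first exact: (measurable_rint_cons mpos pos0).
  under eq_integral do rewrite gee0_abs ?(iterint_ge0 _ (fun t => pos0 _))//.
  rewrite -(rint_cons (fun u => maxe (f u)%:E 0)) (rint_prod mpos pos0).
  have /integrableP[_] := integrable_funepos measurableT int.
  by under eq_integral do rewrite gee0_abs ?funepos_ge0// funeposE.
have ineg : mu.-integrable setT (fun x => rint (fun u : 'rV[R]_n => maxe (- (f (row_mx x%:M
    u))%:E) 0)).
  apply/integrableP; split; first exact: (measurable_rint_cons mneg neg0).
  under eq_integral do rewrite gee0_abs ?(iterint_ge0 _ (fun t => neg0 _))//.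
  rewrite -(rint_cons (fun u => maxe (- (f u)%:E) 0)) (rint_prod mneg neg0).
  have /integrableP[_] := integrable_funeneg measurableT int.
  by under eq_integral do rewrite gee0_abs ?funeneg_ge0// funenegE.
rewrite -integralB// rint_cons; apply: eq_integral => x _.
rewrite (IH (fun u => f (row_mx x%:M u))); last exact: gauss_dominated_cons.
rewrite integralE (rint_prod (rmeas_cons x mpos) (fun u => pos0 _)).
rewrite (rint_prod (rmeas_cons x mneg) (fun u => neg0 _)).
by congr (_ - _); apply: eq_integral => t _; rewrite ?funeposE ?funenegE.
Qed.

End Bridge.

(** * Standard Gaussian expectation of functions of moderate growth *)

Section Expectation.
Variables (R : realType) (n : nat).
Implicit Types (f g h : 'rV[R]_n -> R) (u v w : 'rV[R]_n).
Local Notation gam := (std_gauss R n).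

Definition rowmf f := measurable_fun setT (fun t : n.-tuple R => f (row_of t)).
Definition integ f := gam.-integrable setT (fun t => (f (row_of t))%:E).
(** Since [fine] sends infinite values to 0, [Ez] represents the expectation under [integ]. *)
Definition Ez f : R := fine (\int[gam]_t (f (row_of t))%:E).

Lemma rowmfD f g : rowmf f -> rowmf g -> rowmf (fun u => f u + g u).
Proof. exact: measurable_funD. Qed.
Lemma rowmfM f g : rowmf f -> rowmf g -> rowmf (fun u => f u * g u).
Proof. exact: measurable_funM. Qed.
Lemma rowmf_cst c : rowmf (fun=> c).
Proof. exact: measurable_cst. Qed.
Lemma rowmf_sum (I : Type) (s : seq I) (F : I -> 'rV[R]_n -> R) :
  (forall i, rowmf (F i)) -> rowmf (fun u => \sum_(i <- s) F i u).
Proof. by move=> mF; apply: measurable_sum => i; exact: mF. Qed.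
Lemma rowmf_coord i : rowmf (fun u => u 0 i).
Proof. exact: measurable_row_of. Qed.
Lemma rowmf_rmeas f : rowmf f -> rmeas (EFin \o f).
Proof. by move=> mf; apply/measurable_EFinP. Qed.

Lemma integD f g : integ f -> integ g -> integ (fun u => f u + g u).
Proof. by move=> If Ig; have := integrableD measurableT If Ig. Qed.

Lemma integZ c f : integ f -> integ (fun u => c * f u).
Proof. by move=> If; have := integrableZl measurableT c If. Qed.

Lemma Ez_fin f : integ f -> (Ez f)%:E = (\int[gam]_t (f (row_of t))%:E)%E.
Proof. by move=> If; rewrite fineK//; apply: integrable_fin_num. Qed.

Lemma EzD f g : integ f -> integ g -> Ez (fun u => f u + g u) = Ez f + Ez g.
Proof.
move=> If Ig; apply: EFin_inj; rewrite EFinD !Ez_fin//; last exact: integD.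
by rewrite -integralD.
Qed.

Lemma EzZ c f : integ f -> Ez (fun u => c * f u) = c * Ez f.
Proof.
move=> If; apply: EFin_inj; rewrite EFinM !Ez_fin//; last exact: integZ.
by rewrite -integralZl.
Qed.

Lemma integ_cst c : integ (fun=> c).
Proof.
apply/integrableP; split; first by apply/measurable_EFinP; exact: measurable_cst.
by rewrite integral_cst//= std_gauss_setT mule1 ltry.
Qed.

Lemma Ez_cst c : Ez (fun=> c) = c.
Proof. by rewrite /Ez integral_cst//= std_gauss_setT mule1. Qed.

Lemma integ_sum (I : Type) (s : seq I) (F : I -> 'rV[R]_n -> R) :
  (forall i, integ (F i)) -> integ (fun u => \sum_(i <- s) F i u).
Proof.
move=> IF; elim: s => [|i s IH].
  by have := integ_cst 0; congr integ; apply/funext => u; rewrite big_nil.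
by have := integD (IF i) IH; congr integ; apply/funext => u; rewrite big_cons.
Qed.

Lemma Ez_sum (I : Type) (s : seq I) (F : I -> 'rV[R]_n -> R) :
  (forall i, integ (F i)) -> Ez (fun u => \sum_(i <- s) F i u) = \sum_(i <- s) Ez (F i).
Proof.
move=> IF; elim: s => [|i s IH].
  by rewrite big_nil -[RHS](Ez_cst 0); congr Ez; apply/funext => u; rewrite big_nil.
rewrite big_cons -IH -EzD//; last exact: integ_sum.
by congr Ez; apply/funext => u; rewrite big_cons.
Qed.

Lemma Ez_le f g : integ f -> integ g -> (forall u, f u <= g u) -> Ez f <= Ez g.
Proof.
move=> If Ig fg; rewrite -lee_fin !Ez_fin//; apply: le_integral => //.
by move=> t _; rewrite lee_fin.
Qed.

(** Against the density exp (- |u|^2 / 2), growth at rate 1/4 leaves the integrable factor exp (-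
    |u|^2 / 4). The same envelope serves for the difference quotients of [tilt]. *)
Lemma integ_dom f : rowmf f ->
  (exists C, forall u, `|f u| <= C * expR (sqnorm u / 4)) -> integ f.
Proof.
move=> mf [C fC]; apply/integrableP; split; first exact: rowmf_rmeas.
have C0 : 0 <= C.
  by have := le_trans (normr_ge0 _) (fC 0); rewrite pmulr_lge0// expR_gt0.
have mabs : rmeas (fun u => `|(f u)%:E|%E).
  by apply: measurableT_comp => //; exact: rowmf_rmeas.
rewrite (integral_std_gauss mabs)//.
pose K := C * (Num.sqrt (2 * pi))^-1 ^+ n.
have K0 : 0 <= K by rewrite mulr_ge0// exprn_ge0.
apply: (@le_lt_trans _ _ (K%:E * rint (fun u : 'rV[R]_n => (expR (- 4^-1 * sqnorm u))%:E))%E).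
  rewrite -rint_scale ?lee_fin//; last exact: rmeas_expR_sqnorm.
  rewrite !rint_prod//; last 4 first.
  - by apply: emeasurable_funM => //; exact: rmeas_expR_sqnorm.
  - by move=> u; rewrite mule_ge0 ?lee_fin ?expR_ge0.
  - apply: emeasurable_funM => //; apply/measurable_EFinP.
    exact: measurable_std_density.
  - by move=> u; rewrite mule_ge0 ?lee_fin ?std_density_ge0.
  apply: ge0_le_integral => //.
  - by move=> t _; rewrite mule_ge0 ?lee_fin ?std_density_ge0.
  - apply: emeasurable_funM => //; apply/measurable_EFinP.
    exact: measurable_std_density.
  - by apply: emeasurable_funM => //; exact: rmeas_expR_sqnorm.
  move=> t _; rewrite /= -!EFinM lee_fin /std_density /K.
  apply: le_trans (ler_wpM2l _ (fC _)) _; first by rewrite mulr_ge0 ?exprn_ge0 ?expR_ge0.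
  rewrite mulrCA -!mulrA -expRD.
  by rewrite (_ : - _ / 2 + _ = - 4^-1 * sqnorm (row_of t))//; lra.
have h := rint_expR_sqnorm_lty (R := R) n (c := 4^-1).
have {}h : (rint (fun u : 'rV[R]_n => (expR (- 4^-1 * sqnorm u))%:E) < +oo)%E by apply: h.
have h0 : (0 <= rint (fun u : 'rV[R]_n => (expR (- 4^-1 * sqnorm u))%:E))%E.
  by apply: iterint_ge0 => t; rewrite lee_fin expR_ge0.
by rewrite lte_mul_pinfty ?lee_fin// ge0_fin_numE.
Qed.

(* [qbnd] and [lbnd]: at most quadratic, respectively linear, growth. *)
Definition qbnd f := rowmf f /\ exists C, forall u, `|f u| <= C * (1 + sqnorm u).
Definition lbnd f := rowmf f /\ exists C, forall u, f u ^+ 2 <= C * (1 + sqnorm u).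

Lemma sqnorm1_ge1 u : 1 <= 1 + sqnorm u.
Proof. by rewrite lerDl sqnorm_ge0. Qed.

Lemma sqnorm1_gt0 u : 0 < 1 + sqnorm u.
Proof. exact: lt_le_trans (sqnorm1_ge1 u). Qed.

Lemma expR_ge_affine (q c : R) : 0 < c -> 0 <= q -> c <= 1 -> 1 + q <= c^-1 * expR (c * q).
Proof.
move=> c0 q0 c1; rewrite ler_pdivlMl//; apply: le_trans (expR_ge1Dx _).
by rewrite mulrDr mulr1 lerD2r.
Qed.

Lemma qbnd_integ f : qbnd f -> integ f.
Proof.
move=> [mf [C fC]]; apply: integ_dom => //; exists (C * 4) => u.
have C0 : 0 <= C.
  by have := le_trans (normr_ge0 _) (fC 0); rewrite pmulr_lge0// sqnorm1_gt0.
apply: (le_trans (fC u)); rewrite -mulrA ler_wpM2l//.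
have := @expR_ge_affine (sqnorm u) 4^-1; rewrite invrK [_^-1 * _]mulrC; apply.
- by rewrite invr_gt0.
- exact: sqnorm_ge0.
- by rewrite invf_le1// ler1n.
Qed.

Lemma qbndD f g : qbnd f -> qbnd g -> qbnd (fun u => f u + g u).
Proof.
move=> [mf [C fC]] [mg [D gD]]; split; first exact: rowmfD.
exists (C + D) => u; rewrite mulrDl; apply: le_trans (ler_normD _ _) _.
exact: lerD.
Qed.

Lemma qbndZ c f : qbnd f -> qbnd (fun u => c * f u).
Proof.
move=> [mf [C fC]]; split; first by apply: rowmfM => //; exact: rowmf_cst.
by exists (`|c| * C) => u; rewrite normrM -mulrA ler_wpM2l.
Qed.

Lemma qbnd_cst c : qbnd (fun=> c).
Proof.
split; first exact: rowmf_cst.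
by exists `|c| => u; rewrite ler_peMr// sqnorm1_ge1.
Qed.

Lemma qbnd_sum (I : Type) (s : seq I) (F : I -> 'rV[R]_n -> R) :
  (forall i, qbnd (F i)) -> qbnd (fun u => \sum_(i <- s) F i u).
Proof.
move=> IF; elim: s => [|i s IH].
  by have := qbnd_cst 0; congr qbnd; apply/funext => u; rewrite big_nil.
by have := qbndD (IF i) IH; congr qbnd; apply/funext => u; rewrite big_cons.
Qed.

Lemma lbndM f g : lbnd f -> lbnd g -> qbnd (fun u => f u * g u).
Proof.
move=> [mf [C fC]] [mg [D gD]]; split; first exact: rowmfM.
exists (C + D) => u; rewrite mulrDl.
have := fC u; have := gD u; rewrite normrM -(real_normK (num_real (f u))) -(real_normK (num_real
    (g u))).
have := sqr_ge0 (`|f u| - `|g u|); have := normr_ge0 (f u); have := normr_ge0 (g u).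
move: `|f u| `|g u| => a b; have := mulr_ge0; nra.
Qed.

Lemma lbnd_cst c : lbnd (fun=> c).
Proof.
split; first exact: rowmf_cst.
by exists (c ^+ 2) => u; rewrite ler_peMr ?sqnorm1_ge1// sqr_ge0.
Qed.

Lemma lbnd_qbnd f : lbnd f -> qbnd f.
Proof.
move=> lf; have := lbndM lf (lbnd_cst 1); congr qbnd; apply/funext => u.
by rewrite mulr1.
Qed.

Lemma lbndD f g : lbnd f -> lbnd g -> lbnd (fun u => f u + g u).
Proof.
move=> [mf [C fC]] [mg [D gD]]; split; first exact: rowmfD.
exists (2 * C + 2 * D) => u; rewrite mulrDl.
by have := fC u; have := gD u; have := sqr_ge0 (f u - g u); nra.
Qed.

Lemma lbndZ c f : lbnd f -> lbnd (fun u => c * f u).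
Proof.
move=> [mf [C fC]]; split; first by apply: rowmfM => //; exact: rowmf_cst.
by exists (c ^+ 2 * C) => u; rewrite exprMn -mulrA ler_wpM2l ?sqr_ge0.
Qed.

Lemma lbnd_sum (I : Type) (s : seq I) (F : I -> 'rV[R]_n -> R) :
  (forall i, lbnd (F i)) -> lbnd (fun u => \sum_(i <- s) F i u).
Proof.
move=> IF; elim: s => [|i s IH].
  by have := lbnd_cst 0; congr lbnd; apply/funext => u; rewrite big_nil.
by have := lbndD (IF i) IH; congr lbnd; apply/funext => u; rewrite big_cons.
Qed.

Lemma lbnd_coord i : lbnd (fun u => u 0 i).
Proof.
split; first exact: rowmf_coord.
exists 1 => u; rewrite mul1r /sqnorm (bigD1 i)//= addrCA lerDl addr_ge0//.
by apply: sumr_ge0 => j _; exact: sqr_ge0.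
Qed.

Lemma lbnd_affine w (A : 'M[R]_n) i : lbnd (fun u => (w + u *m A) 0 i).
Proof.
have : lbnd (fun u => w 0 i + \sum_j A j i * u 0 j).
  apply: lbndD; first exact: lbnd_cst.
  by apply: lbnd_sum => j; apply: lbndZ; exact: lbnd_coord.
congr lbnd; apply/funext => u; rewrite !mxE; congr (_ + _).
by apply: eq_bigr => j _; rewrite mulrC.
Qed.

End Expectation.

(** * Translations of the standard Gaussian *)

Section Stein.
Variables (R : realType) (n : nat).
Implicit Types (f g h : 'rV[R]_n -> R) (u v w : 'rV[R]_n).
Local Notation gam := (std_gauss R n).

Lemma rowmf_affine f (m : 'rV[R]_n) (A : 'M[R]_n) : rowmf f -> rowmf (fun u => f (m + u *m A)).
Proof.
move=> /rowmf_rmeas mf; have := rmeas_affine m A mf.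
by move=> h; apply/measurable_EFinP.
Qed.

Lemma rowmf_translation f w : rowmf f -> rowmf (fun u => f (w + u)).
Proof.
by move=> /(rowmf_affine w 1%:M); congr rowmf; apply/funext => u; rewrite mulmx1.
Qed.

(* The Cameron-Martin density of the translation by [w]. *)
Definition tilt w u : R := expR (dot u w - sqnorm w / 2).

Lemma rowmf_dot w : rowmf (fun u => dot u w).
Proof.
have : rowmf (fun u => \sum_i u 0 i * w 0 i).
  by apply: rowmf_sum => i; apply: rowmfM; [exact: rowmf_coord|exact: rowmf_cst].
by congr rowmf; apply/funext => u; rewrite dotE.
Qed.

Lemma rowmf_tilt w : rowmf (tilt w).
Proof.
apply: measurableT_comp => //; apply: measurable_funB => //; exact: rowmf_dot.
Qed.

Lemma std_density_tilt w u : std_density (u - w) = std_density u * tilt w u.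
Proof.
rewrite /std_density /tilt -mulrA -expRD; congr (_ * expR _).
by rewrite !sqnormE !dot_lin (dotC w u); lra.
Qed.

Local Open Scope ereal_scope.

Lemma ge0_std_gauss_translation w (F : 'rV[R]_n -> \bar R) : rmeas F -> (forall u, 0 <= F u) ->
  \int[gam]_t F (w + row_of t)%R = \int[gam]_t ((tilt w (row_of t))%:E * F (row_of t)).
Proof.
move=> mF F0.
have mF1 : rmeas (fun u => F (w + u)%R).
  by have := rmeas_affine w 1%:M mF; congr rmeas; apply/funext => u; rewrite mulmx1.
have mtF : rmeas (fun u => (tilt w u)%:E * F u).
  by apply: emeasurable_funM => //; exact: rowmf_rmeas (rowmf_tilt w).
rewrite (integral_std_gauss mF1)// (integral_std_gauss mtF); last first.
  by move=> u; rewrite mule_ge0 ?lee_fin ?expR_ge0.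
pose G u := (std_density (u - w))%:E * F u.
have GE : (fun u => (std_density u)%:E * ((tilt w u)%:E * F u)) = G.
  by apply/funext => u; rewrite /G std_density_tilt EFinM muleA.
have mG : rmeas G.
  rewrite -GE; apply: emeasurable_funM => //; apply/measurable_EFinP.
  exact: measurable_std_density.
have G0 u : 0 <= G u by rewrite mule_ge0 ?lee_fin ?std_density_ge0.
rewrite GE (rint_translation w mG G0).
by congr rint; apply/funext => u; rewrite /G addrC addrK addrC.
Qed.

Lemma std_gauss_translation w f : rowmf f ->
  \int[gam]_t (f (w + row_of t)%R)%:E = \int[gam]_t (tilt w (row_of t) * f (row_of t))%:E.
Proof.
move=> mf; have mF := rowmf_rmeas mf.
have mpos : rmeas (fun u => maxe (f u)%:E 0) by apply: measurable_maxe.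
have mneg : rmeas (fun u => maxe (- (f u)%:E) 0).
  by apply: measurable_maxe => //; exact: measurableT_comp.
have pos0 u : 0 <= maxe (f u)%:E 0 by rewrite le_max lexx orbT.
have neg0 u : 0 <= maxe (- (f u)%:E) 0 by rewrite le_max lexx orbT.
have tilt0 u : 0 <= (tilt w u)%:E by rewrite lee_fin expR_ge0.
rewrite [LHS]integralE [RHS]integralE; congr (_ - _).
- under eq_integral do rewrite funeposE.
  rewrite (ge0_std_gauss_translation w mpos pos0); apply: eq_integral => t _.
  by rewrite funeposE maxe_pMr// mule0.
- under eq_integral do rewrite funenegE.
  rewrite (ge0_std_gauss_translation w mneg neg0); apply: eq_integral => t _.
  by rewrite funenegE maxe_pMr// mule0 EFinM muleN.
Qed.

End Stein.

(** * Stein's identity by dominated convergence *)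

Section SteinLimit.
Variables (R : realType) (n : nat).
Implicit Types (f g h : 'rV[R]_n -> R) (u v w : 'rV[R]_n).
Local Notation gam := (std_gauss R n).

Lemma derive_seq (W : normedModType R) (f : W -> R) (u v : W) : derivable f u v ->
  (fun k => k.+1%:R * (f (k.+1%:R^-1 *: v + u) - f u)) @ \oo --> 'D_v f u.
Proof.
move=> /cvgr_dnbhsP/(_ (fun k => k.+1%:R^-1)); rewrite /=.
have h : (forall k, k.+1%:R^-1 != 0 :> R) /\ ((fun k => k.+1%:R^-1 : R) @ \oo --> (0 : R)).
  split=> [k|]; first by rewrite invr_eq0 pnatr_eq0.
  exact: cvg_harmonic.
move=> /(_ h); apply: cvg_trans; apply: near_eq_cvg; near=> k.
by rewrite invrK.
Unshelve. all: by end_near. Qed.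

Lemma abs_expRB1_le (s : R) : `|expR s - 1| <= `|s| * expR `|s|.
Proof.
have [s0|s0] := leP 0 s.
  rewrite ger0_norm; last by rewrite subr_ge0 -expR0 ler_expR.
  rewrite ger0_norm//; have := expR_ge1Dx (- s); rewrite expRN => h.
  have e0 := expR_gt0 s; have : (1 - s) * expR s <= 1.
    by rewrite -ler_pdivlMr// mul1r.
  by rewrite mulrBl mul1r; lra.
rewrite ltr0_norm; last by rewrite subr_lt0 -expR0 ltr_expR.
rewrite ltr0_norm//; have := expR_ge1Dx s => h.
have : 1 <= expR (- s) by rewrite -expR0 ler_expR; lra.
have : 0 < - s by lra.
by nra.
Qed.

(** An envelope independent of [k]. The quotient is at most B exp B with B = |<u, v>| + |v|^2; the
    product of B with |f u| is at most quadratic, hence below a multiple of 8 exp (|u|^2 / 8), and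
    exp B costs another exp (|u|^2 / 8) by the arithmetic-geometric inequality, for a total rate of
    1/4. *)
Lemma tilt_diff_bound f v : lbnd f -> exists C, forall (k : nat) u,
  `|k.+1%:R * (tilt (k.+1%:R^-1 *: v) u - 1) * f u| <= C * expR (sqnorm u / 4).
Proof.
move=> [_ [Cf fC]]; have qv0 := sqnorm_ge0 v; set qv := sqnorm v in qv0.
have Cf0 : 0 <= Cf.
  by have := le_trans (sqr_ge0 _) (fC 0); rewrite pmulr_lge0// sqnorm1_gt0.
exists ((Cf + qv + qv ^+ 2) * 8 * expR (3 * qv)) => k u.
have qu0 := sqnorm_ge0 u; have CS := dot_cauchy_schwarz u v; have fu := fC u.
set qu := sqnorm u in qu0 CS fu *; rewrite -/qv in CS.
set t : R := k.+1%:R^-1; have t0 : 0 < t by rewrite invr_gt0.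
have t1 : t <= 1 by rewrite invf_le1// ler1n.
set a := `|dot u v|; have a0 : 0 <= a by exact: normr_ge0.
have a2 : a ^+ 2 <= qu * qv by rewrite /a real_normK ?num_real.
pose B := a + qv; have B0 : 0 <= B by rewrite addr_ge0.
pose s := t * dot u v - t ^+ 2 * qv / 2.
have sB : `|s| <= t * B.
  apply: (le_trans (ler_normB _ _)); rewrite [`|t * _|]normrM (ger0_norm (ltW t0)) -/a.
  rewrite ger0_norm; last by apply: mulr_ge0 => //; apply: mulr_ge0 => //; exact: sqr_ge0.
  have : t ^+ 2 * qv <= t * qv by rewrite expr2 -mulrA ler_piMl// mulr_ge0// ltW.
  by have := mulr_ge0 (ltW t0) qv0; rewrite /B; lra.
have tiltE : tilt (t *: v) u = expR s.
  by rewrite /tilt dotZr sqnormE dotZl dotZr -sqnormE -/qv /s !mulrA -expr2.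
have kE : k.+1%:R = t^-1 by rewrite invrK.
have B1 : `|k.+1%:R * (tilt (t *: v) u - 1)| <= B * expR B.
  rewrite normrM tiltE; have := abs_expRB1_le s => h.
  apply: le_trans (ler_wpM2l _ h) _ => //; rewrite mulrA ler_pM ?mulr_ge0 ?expR_ge0//.
    by rewrite ger0_norm// kE ler_pdivrMl.
  by rewrite ler_expR (le_trans sB)// ler_piMl.
have fB : `|f u| * B <= (Cf + qv + qv ^+ 2) * (1 + qu).
  have := sqr_ge0 (`|f u| - B); rewrite sqrrB (real_normK (num_real (f u))).
  have B2 : B ^+ 2 <= 2 * (qu * qv) + 2 * qv ^+ 2.
    by have := sqr_ge0 (a - qv); rewrite /B; nra.
  have := mulr_ge0 qv0 qu0; have := mulr_ge0 (sqr_ge0 qv) qu0; nra.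
have BE : B <= qu / 8 + 3 * qv.
  suff : a <= qu / 8 + 2 * qv by rewrite /B; lra.
  rewrite -(@ler_pXn2r _ 2)// ?nnegrE//; last by lra.
  by apply: (le_trans a2); have := sqr_ge0 (qu / 8 - 2 * qv); nra.
rewrite normrM; apply: le_trans (ler_wpM2r _ B1) _ => //.
rewrite mulrAC [B * _]mulrC; apply: le_trans (ler_wpM2r (expR_ge0 _) fB) _.
rewrite -!mulrA ler_wpM2l//; first by rewrite !addr_ge0// sqr_ge0.
apply: (@le_trans _ _ ((8 * expR (qu / 8)) * expR (qu / 8 + 3 * qv))).
  apply: ler_pM; [by lra|exact: expR_ge0| |by rewrite ler_expR].
  have := @expR_ge_affine R qu 8^-1; rewrite invrK [_^-1 * _]mulrC; apply => //.
  by rewrite invf_le1// ler1n.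
rewrite -mulrA -!expRD ler_wpM2l// ler_expR; lra.
Qed.

Lemma cvg_tilt v u : (fun k => k.+1%:R * (tilt (k.+1%:R^-1 *: v) u - 1)) @ \oo --> dot u v.
Proof.
pose g (r : R^o) : R := expR (r * dot u v - r ^+ 2 * (sqnorm v / 2)).
have dg : is_derive (0 : R^o) (1 : R^o) g (dot u v).
  apply: is_derive_eq.
  rewrite /GRing.scale/= expr0n/=.
  by rewrite !mul0r subrr expR0; ring.
have := derive_seq (@ex_derive _ _ _ _ _ _ _ dg); rewrite derive_val.
suff <- : (fun k => k.+1%:R * (g (k.+1%:R^-1 *: (1 : R^o) + 0) - g 0)) =
   (fun k => k.+1%:R * (tilt (k.+1%:R^-1 *: v) u - 1)) by [].
have sE (t : R) : t *: (1 : R^o) + 0 = t by rewrite addr0; exact: mulr1.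
have g0 : g 0 = 1 by rewrite /g mul0r expr0n/= mul0r subrr expR0.
have tE (t : R) : sqnorm (t *: v) = t ^+ 2 * sqnorm v.
  by rewrite sqnormE dotZl dotZr -sqnormE mulrA -expr2.
by apply/funext => k; rewrite sE g0 /g /tilt tE dotZr mulrA.
Qed.

Lemma rowmf_cvg (F : nat -> 'rV[R]_n -> R) f : (forall k, rowmf (F k)) ->
  (forall u, F ^~ u @ \oo --> f u) -> rowmf f.
Proof.
move=> mF Ff; apply: (measurable_fun_cvg (h := fun k t => F k (row_of t))) => //.
Qed.

Lemma Ez_cvg (F : nat -> 'rV[R]_n -> R) f (C : R) : (forall k, rowmf (F k)) ->
  (forall u, F ^~ u @ \oo --> f u) ->
  (forall k u, `|F k u| <= C * expR (sqnorm u / 4)) ->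
  integ f /\ (fun k => Ez (F k)) @ \oo --> Ez f.
Proof.
move=> mF Ff FC; have mf := rowmf_cvg mF Ff.
have C0 : 0 <= C.
  by have := le_trans (normr_ge0 _) (FC 0%N 0); rewrite pmulr_lge0// expR_gt0.
have ig : integ (fun u => C * expR (sqnorm u / 4)).
  apply: integ_dom; last first.
    by exists C => u; rewrite ger0_norm// mulr_ge0// expR_ge0.
  apply: rowmfM; first exact: rowmf_cst.
  apply: measurableT_comp => //; apply: measurable_funM => //; exact: measurable_sqnorm.
have h1 k : measurable_fun setT (fun t : n.-tuple R => (F k (row_of t))%:E) by exact: rowmf_rmeas.
have h2 : {ae gam, forall t, setT t -> (fun k => (F k (row_of t))%:E) @ \oo --> (f (row_of t))%:E}.
  by apply: aeW => t _; apply/cvg_EFin; [exact: nearW|exact: Ff].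
have h3 : {ae gam, forall t k, setT t -> (`|(F k (row_of t))%:E| <= (C * expR (sqnorm (row_of t)
    / 4))%:E)%E}.
  by apply: aeW => t k _; rewrite lee_fin.
have [If _ lim] := dominated_convergence measurableT h1 (rowmf_rmeas mf) h2 ig h3.
split => //; have IF k : integ (F k) by apply: integ_dom => //; exists C => u; exact: FC.
apply: (@fine_cvg _ _ _ _ _ (Ez f)).
by rewrite Ez_fin.
Qed.

(* Differentiate [Ez (fun u => f (t *: v + u))] at [t = 0], under the integral
   and after moving the translation onto the density. *)
Lemma stein f v (K : R) : lbnd f -> (forall u, derivable f u v) ->
  (forall u t, `|f (t *: v + u) - f u| <= K * `|t|) ->
  integ ('D_v f) /\ Ez ('D_v f) = Ez (fun u => f u * dot u v).
Proof.
move=> lf df fK; have mf := proj1 lf.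
have qf := lbnd_qbnd lf.
have K0 : 0 <= K by have := le_trans (normr_ge0 _) (fK 0 1); rewrite normr1 mulr1.
pose F k u := k.+1%:R * (f (k.+1%:R^-1 *: v + u) - f u).
have mF k : rowmf (F k).
  apply: rowmfM; first exact: rowmf_cst.
  by apply: measurable_funB => //; exact: rowmf_translation.
have [|IF cF] := @Ez_cvg F ('D_v f) K mF (fun u => derive_seq (df u)).
  move=> k u; rewrite /F normrM; apply: le_trans (_ : K <= _); last first.
    by rewrite ler_peMr// -[leLHS]expR0 ler_expR divr_ge0// sqnorm_ge0.
  apply: le_trans (ler_wpM2l _ (fK _ _)) _ => //.
  by rewrite mulrCA !ger0_norm ?invr_ge0// mulfV ?mulr1.
have [C tC] := tilt_diff_bound v lf.
pose G k u := k.+1%:R * (tilt (k.+1%:R^-1 *: v) u - 1) * f u.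
have mG k : rowmf (G k).
  apply: rowmfM => //; apply: rowmfM; first exact: rowmf_cst.
  by apply: measurable_funB => //; exact: rowmf_tilt.
have [|IG cG] := @Ez_cvg G (fun u => dot u v * f u) C mG _ tC.
  by move=> u; apply: cvgMl; exact: cvg_tilt.
split=> //.
have FG : (fun k => Ez (F k)) = (fun k => Ez (G k)).
  apply/funext => k.
  have If := qbnd_integ qf.
  have It : integ (fun u => f (k.+1%:R^-1 *: v + u)).
    apply: qbnd_integ; split; first exact: rowmf_translation.
    have [_ [D fD]] := qf; exists (D + K * `|k.+1%:R^-1|) => u.
    rewrite mulrDl; apply: le_trans (_ : `|f u| + `|f (k.+1%:R^-1 *: v + u) - f u| <= _).
      by rewrite -{1}(subrK (f u) (f (_ + u))) addrC ler_normD.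
    apply: lerD; first exact: fD.
    by apply: (le_trans (fK _ _)); rewrite ler_peMr ?mulr_ge0// sqnorm1_ge1.
  have Ig : integ (fun u => tilt (k.+1%:R^-1 *: v) u * f u).
    have IGk : integ (G k) by apply: integ_dom => //; exists C => u; exact: tC.
    have := integD If (integZ k.+1%:R^-1 IGk); congr integ; apply/funext => u.
    by rewrite /G !mulrA mulVf ?pnatr_eq0// mul1r mulrBl mul1r addrC subrK.
  have -> : F k = fun u => k.+1%:R * (f (k.+1%:R^-1 *: v + u) + -1 * f u).
    by apply/funext => u; rewrite mulN1r.
  have -> : G k = fun u => k.+1%:R * (tilt (k.+1%:R^-1 *: v) u * f u + -1 * f u).
    by apply/funext => u; rewrite /G mulN1r -mulrA mulrBl mul1r.
  rewrite !EzZ ?EzD//; try exact: integZ; try (apply: integD => //; exact: integZ).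
  by congr (_ * (_ + _)); rewrite /Ez std_gauss_translation.
have := cvg_lim (@Rhausdorff R) cF; rewrite FG => <-.
rewrite (cvg_lim (@Rhausdorff R) cG).
by congr Ez; apply/funext => u; rewrite mulrC.
Qed.

End SteinLimit.

(** * Calculus of the potential *)

Section Calculus.
Variables (R : realType) (n : nat).
Implicit Types (F V : 'rV[R]_n -> R) (x y u v w : 'rV[R]_n).

Lemma is_derive_line F x v t : derivable F (x + t *: v) v ->
  is_derive (t : R) (1 : R) (fun s : R => F (x + s *: v)) ('D_v F (x + t *: v)).
Proof.
move=> dF.
have E : (fun h : R => h^-1 *: (F (x + (h *: (1 : R^o) + t) *: v) - F (x + t *: v))) =
         (fun h : R => h^-1 *: (F (h *: v + (x + t *: v)) - F (x + t *: v))).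
  apply/funext => h; congr (_ *: (F _ - _)).
  by rewrite [h *: (1 : R^o)]mulr1 scalerDl addrCA.
split; first by rewrite /derivable /= E.
by rewrite /derive /= E.
Qed.

Lemma mvt_line F x v : (forall y, derivable F y v) -> continuous F ->
  exists2 c : R, 0 < c < 1 & F (x + v) - F x = 'D_v F (x + c *: v).
Proof.
move=> dF cF.
have cl : continuous (fun s : R => F (x + s *: v)).
  move=> s; apply: (@continuous_comp _ _ _ (fun s : R => x + s *: v) F); last exact: cF.
  apply: cvgD; first exact: cvg_cst.
  by apply: cvgZr_tmp; exact: cvg_id.
have [|c] := @MVT R (fun s => F (x + s *: v)) (fun s => 'D_v F (x + s *: v)) 0 1 ltr01 (fun s _
    => is_derive_line (dF _)).
  exact: continuous_subspaceT.
rewrite in_itv/= subr0 mulr1 scale1r scale0r addr0 => c01 E.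
by exists c.
Qed.

Lemma derive_sum_evec F x v : differentiable F x ->
  'D_v F x = \sum_i v 0 i * 'D_(evec R i) F x.
Proof.
move=> dF; rewrite deriveE// [v in LHS]row_sum_delta linear_sum/=.
by apply: eq_bigr => i _; rewrite linearZ/= deriveE.
Qed.

Lemma evecE (i k : 'I_n) : evec R i 0 k = (k == i)%:R :> R.
Proof. by rewrite mxE eqxx. Qed.

Lemma dot_evec u i : dot u (evec R i) = u 0 i.
Proof.
rewrite dotE (bigD1 i)//= big1 ?addr0; last first.
  by move=> k ki; rewrite evecE (negbTE ki) mulr0.
by rewrite evecE eqxx mulr1.
Qed.

Section C2.
Variable V : 'rV[R]_n -> R.
Hypothesis C2V : C2 V.

Lemma gradE x v : 'D_v V x = dot (grad V x) v.
Proof.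
rewrite derive_sum_evec; last exact: (proj1 C2V).
rewrite dotE.
by apply: eq_bigr => i _; rewrite mxE mulrC.
Qed.

Lemma differentiable_gradi x i : differentiable (fun y => grad V y 0 i) x.
Proof.
apply: (@differentiable_comp _ _ _ _ (grad V) (fun u : 'rV[R]_n => u 0 i)).
  exact: (proj1 (proj2 C2V)).
exact: differentiable_coord.
Qed.

Lemma gradiE i : (fun y => grad V y 0 i) = 'D_(evec R i) V.
Proof. by apply/funext => y; rewrite mxE. Qed.

Lemma hessE x i v : 'D_v (fun y => grad V y 0 i) x = \sum_j v 0 j * hess V x i j.
Proof.
rewrite derive_sum_evec; last exact: differentiable_gradi.
by apply: eq_bigr => j _; rewrite mxE gradiE.
Qed.

Lemma differentiable_dot_grad x w : differentiable (fun y => dot (grad V y) w) x.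
Proof.
have -> : (fun y => dot (grad V y) w) = \sum_i (fun y => grad V y 0 i * w 0 i).
  by apply/funext => y; rewrite dotE fct_sumE.
apply: differentiable_sum => i; apply: differentiableM => //.
exact: differentiable_gradi.
Qed.

Lemma derive_dot_grad x v w : 'D_v (fun y => dot (grad V y) w) x = dot (w *m hess V x) v.
Proof.
have -> : (fun y => dot (grad V y) w) = \sum_i (fun y => w 0 i *: grad V y 0 i).
  by apply/funext => y; rewrite dotE fct_sumE; apply: eq_bigr => i _; rewrite mulrC.
rewrite derive_sum; last first.
  move=> i; apply: derivableZ; apply: diff_derivable; exact: differentiable_gradi.
rewrite dotE.
have dZ i : 'D_v (fun y => w 0 i *: grad V y 0 i) x = w 0 i * \sum_j v 0 j * hess V x i j.
  rewrite deriveZ ?hessE//; apply: diff_derivable; exact: differentiable_gradi.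
under eq_bigr do rewrite dZ mulr_sumr.
under [RHS]eq_bigr do rewrite mxE mulr_suml.
rewrite exchange_big/=; apply: eq_bigr => i _.
by apply: eq_bigr => j _; ring.
Qed.

Lemma continuous_V : continuous V.
Proof. by move=> x; apply: differentiable_continuous; exact: (proj1 C2V). Qed.

Lemma derivable_V x v : derivable V x v.
Proof. by apply: diff_derivable; exact: (proj1 C2V). Qed.

Lemma continuous_gradi i : continuous (fun y => grad V y 0 i).
Proof. by move=> x; apply: differentiable_continuous; exact: differentiable_gradi. Qed.

Lemma continuous_hessij i j : continuous (fun y => hess V y i j).
Proof.
move=> x; apply: (@continuous_comp _ _ _ (hess V) (fun M : 'M[R]_n => M i j)).
  exact: (proj2 (proj2 C2V)).
exact: coord_continuous.
Qed.

Lemma derivable_gradi x v i : derivable (fun y => grad V y 0 i) x v.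
Proof. by apply: diff_derivable; exact: differentiable_gradi. Qed.

Lemma derivable_shift F w x v : derivable F (x + w) v ->
  derivable (fun y => F (y + w)) x v /\ 'D_v (fun y => F (y + w)) x = 'D_v F (x + w).
Proof.
move=> dF.
have E : (fun h : R => h^-1 *: (F (h *: v + x + w) - F (x + w))) =
         (fun h : R => h^-1 *: (F (h *: v + (x + w)) - F (x + w))).
  by apply/funext => h; rewrite addrA.
by split; [rewrite /derivable/= E|rewrite /derive/= E].
Qed.

(* Its left-hand side is symmetric in [i] and [j], whence the symmetry of the Hessian. *)
Lemma second_difference x i j (h : R) : 0 < h -> exists s t : R, [/\ 0 < s < h, 0 < t < h &
  V (x + h *: evec R i + h *: evec R j) - V (x + h *: evec R i)
   - (V (x + h *: evec R j) - V x) = h ^+ 2 * hess V (x + s *: evec R i + t *: evec R j) i j].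
Proof.
move=> h0; pose e : 'rV[R]_n := h *: evec R i; pose e' : 'rV[R]_n := h *: evec R j.
pose F y := V (y + e') - V y.
have dF y v : derivable F y v.
  apply: derivableB; last exact: derivable_V.
  by have [] := @derivable_shift V e' y v (@derivable_V _ _).
have cs : continuous (fun z : 'rV[R]_n => z + e').
  by move=> z; apply: differentiable_continuous; exact: differentiableD.
have cVs : continuous (fun z : 'rV[R]_n => V (z + e')).
  by move=> z; apply: (continuous_comp (cs z)); exact: continuous_V.
have cF : continuous F.
  by move=> y; apply: (cvgB (cVs y)); exact: continuous_V.
have [c c01 FE] := @mvt_line F x e (fun y => dF y e) cF.
have [c' c01' GE] := @mvt_line (fun y => grad V y 0 i) (x + c *: e) e'
  (fun y => @derivable_gradi y e' i) (@continuous_gradi i).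
exists (c * h), (c' * h); split.
- by case/andP: c01 => c0 c1; rewrite mulr_gt0//= gtr_pMl.
- by case/andP: c01' => c0 c1; rewrite mulr_gt0//= gtr_pMl.
have -> : V (x + h *: evec R i + h *: evec R j) - V (x + h *: evec R i)
   - (V (x + h *: evec R j) - V x) = F (x + e) - F x by [].
have [dV DV] := @derivable_shift V e' (x + c *: e) e (@derivable_V _ _).
rewrite FE (deriveB dV (@derivable_V _ _)) DV !gradE.
have dote y : dot (grad V y) e = h * grad V y 0 i.
  by rewrite dotZr dot_evec.
rewrite !dote -mulrBr GE hessE (bigD1 j)//= big1 ?addr0; last first.
  by move=> k kj; rewrite mxE evecE (negbTE kj) mulr0 mul0r.
by rewrite [e' 0 j]mxE evecE eqxx mulr1 /e /e' !scalerA expr2 mulrA.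
Qed.

Lemma hess_sym x : (hess V x)^T = hess V x.
Proof.
apply/matrixP => j i; rewrite mxE; apply/eqP; rewrite -subr_eq0 -normr_le0.
apply/ler_addgt0Pr => e e0; rewrite add0r.
have e20 : 0 < e / 2 by rewrite divr_gt0.
have near_ij k l : exists2 d : R, 0 < d & forall z, `|x - z| < d -> `|hess V x k l - hess V z k
    l| < e / 2.
  have /cvgrPdist_lt/(_ _ e20) := @continuous_hessij k l x.
  move=> /nbhs_ballP[d /= d0 dB]; exists d => // z xz; apply: dB.
  by rewrite -ball_normE.
have [d1 d10 H1] := near_ij i j; have [d2 d20 H2] := near_ij j i.
(* With [h = d / M], the intermediate points given by [second_difference] stay within [d] of [x]. *)
pose M := 1 + `|evec R i| + `|evec R j|.
have M0 : 0 < M by rewrite /M -addrA ltr_wpDr// addr_ge0.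
pose d := Num.min d1 d2; have d0 : 0 < d by rewrite lt_min d10.
pose h := d / M; have h0 : 0 < h by rewrite divr_gt0.
have close k l (s t : R) : (k = i /\ l = j) \/ (k = j /\ l = i) -> 0 < s < h -> 0 < t < h ->
    `|x - (x + s *: evec R k + t *: evec R l)| < d.
  move=> kl /andP[s0 sh] /andP[t0 th].
  have -> : x - (x + s *: evec R k + t *: evec R l) = - (s *: evec R k + t *: evec R l).
    by rewrite -addrA opprD addrA subrr add0r.
  rewrite normrN; apply: (le_lt_trans (ler_normD _ _)).
  rewrite !normrZ (gtr0_norm s0) (gtr0_norm t0).
  apply: (@le_lt_trans _ _ (h * `|evec R k| + h * `|evec R l|)).
    by rewrite lerD// ler_wpM2r// ltW.
  rewrite -mulrDr /h mulrAC ltr_pdivrMr// ltr_pM2l// /M.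
  by case: kl => -[-> ->]; [rewrite -addrA ltrDr|rewrite addrC -addrA ltrDr].
have [s [t [sh th E1]]] := second_difference x i j h0.
have [s' [t' [sh' th' E2]]] := second_difference x j i h0.
have E : hess V (x + s *: evec R i + t *: evec R j) i j =
         hess V (x + s' *: evec R j + t' *: evec R i) j i.
  have h20 : h ^+ 2 != 0 by rewrite expf_neq0// gt_eqF.
  apply: (mulfI h20); rewrite -E1 -E2 (addrAC x).
  by ring.
have dd1 : d <= d1 by rewrite ge_min lexx.
have dd2 : d <= d2 by rewrite ge_min lexx orbT.
have h1 := H1 _ (lt_le_trans (close i j s t (or_introl (conj erefl erefl)) sh th) dd1).
have h2 := H2 _ (lt_le_trans (close j i s' t' (or_intror (conj erefl erefl)) sh' th') dd2).
have {}h1 : `|hess V x i j - hess V (x + s' *: evec R j + t' *: evec R i) j i| < e / 2.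
  by rewrite -[X in _ - X]E.
apply: (le_trans (ler_distD (hess V (x + s' *: evec R j + t' *: evec R i) j i) _ _)).
rewrite distrC in h2.
by have := lerD (ltW h1) (ltW h2); rewrite -splitr.
Qed.

(** * Consequences of strong convexity and smoothness *)

Section Bounds.
Variables alpha beta : R.
Hypotheses (alpha0 : 0 < alpha) (alphabeta : alpha <= beta).
Hypothesis strongV : strongly_convex alpha V.
Hypothesis smoothV : smooth beta V.

Let beta0 : 0 < beta. Proof. exact: lt_le_trans alphabeta. Qed.

Lemma grad_monotone x v : alpha * sqnorm v <= dot (grad V (x + v) - grad V x) v <= beta * sqnorm v.
Proof.
have [||c _] := @mvt_line (fun y => dot (grad V y) v) x v.
- by move=> y; apply: diff_derivable; exact: differentiable_dot_grad.
- by move=> y; apply: differentiable_continuous; exact: differentiable_dot_grad.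
rewrite derive_dot_grad -qformE dotDl dotNl => ->.
by rewrite (proj2 strongV) (proj2 (andP (smoothV _ _))).
Qed.

Lemma taylor_bound x v :
  alpha / 2 * sqnorm v <= V (x + v) - V x - dot (grad V x) v <= beta / 2 * sqnorm v.
Proof.
(* The mean value theorem is applied to the Taylor remainder minus k s^2 |v|^2 / 2, with [k] equal
   to [alpha] or [beta]. Its derivative has a sign by [grad_monotone], which produces the sharp
   factor 1/2. *)
have key (k : R) : exists2 c : R, 0 < c < 1 &
   V (x + v) - V x - dot (grad V x) v - k / 2 * sqnorm v =
   dot (grad V (x + c *: v) - grad V x) v - k * c * sqnorm v.
  pose g (s : R) := V (x + s *: v) - s * dot (grad V x) v - s ^+ 2 * (k / 2 * sqnorm v).
  pose dg (s : R) := dot (grad V (x + s *: v) - grad V x) v - k * s * sqnorm v.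
  have gd s : is_derive (s : R) (1 : R) g (dg s).
    have h1 := @is_derive_line V x v s (@derivable_V _ _).
    have h2 : is_derive (s : R) (1 : R) (fun s : R => s * dot (grad V x) v) (dot (grad V x) v).
      by apply: is_derive_eq; rewrite /GRing.scale/=; ring.
    have h3 : is_derive (s : R) (1 : R) (fun s : R => s ^+ 2 * (k / 2 * sqnorm v)) (k * s *
        sqnorm v).
      by apply: is_derive_eq; rewrite /GRing.scale/=; field.
    have := is_deriveB (is_deriveB h1 h2) h3.
    by rewrite gradE /dg dotDl dotNl.
  have cg : continuous g.
    by move=> s; apply: differentiable_continuous; apply/derivable1_diffP; case: (gd s).
  have [|c c01] := @MVT R g dg 0 1 ltr01 (fun s _ => gd s).
    exact: continuous_subspaceT.
  rewrite /g /dg subr0 mulr1 scale1r scale0r addr0 !mul0r expr0n/= !mul0r !subr0 mul1r expr1n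
      mul1r => E.
  exists c; first by move: c01; rewrite in_itv.
  by rewrite -E; ring.
have [c /andP[c0 c1] Ec] := key alpha; have [c' /andP[c'0 c'1] Ec'] := key beta.
have hc (k : R) : 0 < k -> alpha * k * sqnorm v <= dot (grad V (x + k *: v) - grad V x) v <=
    beta * k * sqnorm v.
  move=> k0; have /andP[] := grad_monotone x (k *: v).
  have -> : sqnorm (k *: v) = k ^+ 2 * sqnorm v by rewrite sqnormE dotZl dotZr -sqnormE mulrA
      -expr2.
  rewrite dotZr expr2 !mulrA => h1 h2; apply/andP; split.
    by rewrite -(ler_pM2l k0); apply: le_trans h1; rewrite le_eqVlt; apply/orP; left; apply/eqP;
        ring.
  by rewrite -(ler_pM2l k0); apply: (le_trans h2); rewrite le_eqVlt; apply/orP; left; apply/eqP;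
      ring.
have /andP[h1 _] := hc _ c0; have /andP[_ h2] := hc _ c'0.
by apply/andP; split; lra.
Qed.

Lemma taylor_lower x y : V x + dot (grad V x) (y - x) + alpha / 2 * sqnorm (y - x) <= V y.
Proof.
have /andP[+ _] := taylor_bound x (y - x); rewrite (addrC x) subrK; lra.
Qed.

Lemma taylor_upper x y : V y <= V x + dot (grad V x) (y - x) + beta / 2 * sqnorm (y - x).
Proof.
have /andP[_ +] := taylor_bound x (y - x); rewrite (addrC x) subrK; lra.
Qed.

Lemma grad_strongly_monotone x y :
  alpha * sqnorm (y - x) <= dot (grad V y - grad V x) (y - x).
Proof. by have /andP[+ _] := grad_monotone x (y - x); rewrite (addrC x) subrK. Qed.

(* Evaluate [V] at [y - (grad V y - grad V x) / beta]. *)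
Lemma convex_smooth_gap x y : V x + dot (grad V x) (y - x)
  + (2 * beta)^-1 * sqnorm (grad V y - grad V x) <= V y.
Proof.
pose D := grad V y - grad V x; pose z := y - beta^-1 *: D.
have h1 := taylor_lower x z; have h2 := taylor_upper y z.
have h3 : 0 <= alpha / 2 * sqnorm (z - x) by rewrite mulr_ge0 ?sqnorm_ge0// divr_ge0// ltW.
have zy : z - y = - (beta^-1 *: D) by rewrite /z addrAC subrr add0r.
have zx : z - x = (y - x) - beta^-1 *: D by rewrite /z addrAC.
have gy : dot (grad V y) D = dot (grad V x) D + sqnorm D.
  have -> : grad V y = grad V x + D by rewrite /D addrC subrK.
  by rewrite dotDl -sqnormE.
have sq : beta / 2 * sqnorm (beta^-1 *: D) = (2 * beta)^-1 * sqnorm D.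
  by rewrite sqnormE dotZl dotZr -sqnormE; field; rewrite gt_eqF.
have sqN : sqnorm (- (beta^-1 *: D)) = sqnorm (beta^-1 *: D).
  by rewrite !sqnormE dotNl dotNr opprK.
rewrite -/D; move: h1 h2; rewrite zy zx sqN sq dotDr !dotNr !dotZr gy => h1 h2.
rewrite zx in h3.
have b2 : beta^-1 * sqnorm D = 2 * ((2 * beta)^-1 * sqnorm D).
  by field; rewrite gt_eqF.
by move: h1 h2; rewrite mulrDr b2; lra.
Qed.

(** Adding [convex_smooth_gap] for (x, y) and for (y, x) cancels the values of [V]. *)
Lemma grad_cocoercive x y :
  sqnorm (grad V y - grad V x) <= beta * dot (grad V y - grad V x) (y - x).
Proof.
have h1 := convex_smooth_gap x y; have h2 := convex_smooth_gap y x.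
have sE : sqnorm (grad V x - grad V y) = sqnorm (grad V y - grad V x).
  by rewrite -(opprB (grad V x)) !sqnormE dotNl dotNr opprK.
have xy : x - y = - (y - x) by rewrite opprB.
rewrite sE xy dotNr in h2.
have b0 := beta0.
have : beta^-1 * sqnorm (grad V y - grad V x) <= dot (grad V y - grad V x) (y - x).
  have b2 : beta^-1 * sqnorm (grad V y - grad V x) = 2 * ((2 * beta)^-1 * sqnorm (grad V y -
      grad V x)).
    by field; rewrite gt_eqF.
  by rewrite b2 dotDl dotNl; lra.
by rewrite ler_pdivrMl.
Qed.

Lemma grad_lipschitz x y : sqnorm (grad V y - grad V x) <= beta ^+ 2 * sqnorm (y - x).
Proof.
have h1 := grad_cocoercive x y.
have := sqnorm_ge0 ((grad V y - grad V x) - beta *: (y - x)).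
move: h1; rewrite !sqnormE; move: (grad V y - grad V x) (y - x) => D v.
rewrite !dot_lin (dotC v D); lra.
Qed.

(* [0 <= qform (hess V x) (u - beta^-1 *: u *m hess V x)] *)
Lemma hess_sq_le x u : sqnorm (u *m hess V x) <= beta * qform (hess V x) u.
Proof.
have tS := hess_sym x; move: tS (proj2 strongV x) (smoothV x); set S := hess V x => tS sc sm.
have b0 := beta0.
have h1 : 0 <= qform S (beta *: u - u *m S).
  by apply: le_trans (sc _); rewrite mulr_ge0 ?sqnorm_ge0// ltW.
have h2 := proj2 (andP (sm (u *m S))).
have E : qform S (beta *: u - u *m S) =
    beta ^+ 2 * qform S u - 2 * beta * sqnorm (u *m S) + qform S (u *m S).
  rewrite !qformE mulmxBl -scalemxAl !dot_lin sqnormE.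
  rewrite (dot_mulmx (u *m S) u) tS; ring.
rewrite -(ler_pM2l b0); move: h1; rewrite E.
have : beta * sqnorm (u *m S) <= beta * sqnorm (u *m S) by [].
by nra.
Qed.

End Bounds.

End C2.
End Calculus.

(** * Borel measurability of continuous functions of a tuple *)

Section ContinuousMeasurable.
Variables (R : realType) (n : nat).
Implicit Types (F : 'rV[R]_n -> R) (u : 'rV[R]_n).

(** Rounds each coordinate down to a multiple of 1 / (k + 1). The range is countable and the fibres
    are products of half-open intervals, so any function composed with [grid k] is measurable; a
    continuous function is the pointwise limit of these compositions. *)
Definition grid k u : 'rV[R]_n := \row_i ((Num.floor (k.+1%:R * u 0 i))%:~R / k.+1%:R).

Lemma grid_cvg u : grid ^~ u @ \oo --> u.
Proof.
apply/cvgrPdist_le => e e0.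
near=> k.
rewrite [`|_|]mx_normrE; apply: bigmax_le; first exact: ltW.
move=> [i j] _ /=; rewrite (ord1 i) !mxE.
have k0 : 0 < k.+1%:R :> R by [].
set a := u 0 j; have /andP[f1 f2] := floor_itv (k.+1%:R * a).
have -> : a - (Num.floor (k.+1%:R * a))%:~R / k.+1%:R = (k.+1%:R * a - (Num.floor (k.+1%:R *
    a))%:~R) / k.+1%:R.
  by field.
rewrite ger0_norm; last by rewrite divr_ge0// subr_ge0.
rewrite ler_pdivrMr//; apply: (@le_trans _ _ 1).
  by rewrite intrD in f2; rewrite lerBlDl ltW.
rewrite mulrC -ler_pdivrMr// mul1r.
apply: (@le_trans _ _ k%:R); last by rewrite ler_nat.
by near: k; exact: nbhs_infty_ger.
Unshelve. all: by end_near. Qed.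

Lemma rowmf_grid F k : rowmf (fun u => F (grid k u)).
Proof.
move=> _ B mB; rewrite setTI.
pose gp (z : n.-tuple int) : 'rV[R]_n := \row_i ((tnth z i)%:~R / k.+1%:R).
pose fl (t : n.-tuple R) : n.-tuple int := [tuple Num.floor (k.+1%:R * tnth t i) | i < n].
have -> : (fun t : n.-tuple R => F (grid k (row_of t))) @^-1` B =
   \bigcup_(z in [set: n.-tuple int]) [set t | fl t = z /\ B (F (gp z))].
  have E t : grid k (row_of t) = gp (fl t).
    by apply/rowP => i; rewrite !mxE tnth_mktuple.
  apply/seteqP; split=> [t /=|t /= [z _ [<-]]]; rewrite E// => Bt.
  by exists (fl t).
apply: countable_bigcupT_measurable => // z.
have [Bz|nBz] := pselect (B (F (gp z))); last first.
  by rewrite (_ : [set _ | _] = set0)//; apply/seteqP; split=> [t /= []|].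
have -> : [set t | fl t = z /\ B (F (gp z))] =
   \bigcap_(i in [set: 'I_n]) ((fun t : n.-tuple R => tnth t i) @^-1`
     `[(tnth z i)%:~R / k.+1%:R, (tnth z i + 1)%:~R / k.+1%:R[).
  have flE (t : n.-tuple R) i : (Num.floor (k.+1%:R * tnth t i) = tnth z i) <->
      (tnth z i)%:~R / k.+1%:R <= tnth t i < (tnth z i + 1)%:~R / k.+1%:R.
    rewrite ler_pdivrMr// ltr_pdivlMr// mulrC; split=> [<-|].
      exact: floor_itv.
    exact: floor_def.
  apply/seteqP; split=> [t /= [tz _] i _|t tz] /=.
    by rewrite in_itv/=; apply/flE; rewrite -tz tnth_mktuple.
  split=> //; apply: eq_from_tnth => i; rewrite tnth_mktuple.
  by apply/flE; have := tz i I; rewrite /= in_itv.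
apply: fin_bigcap_measurable => // i _.
rewrite -[X in measurable X]setTI; apply: measurable_tnth => //.
Qed.

Lemma continuous_rowmf F : continuous F -> rowmf F.
Proof.
move=> cF; apply: (measurable_fun_cvg (h := fun k t => F (grid k (row_of t)))).
- by move=> k; exact: rowmf_grid.
- by move=> t _; apply: (continuous_cvg _ (cF (row_of t))); exact: grid_cvg.
Qed.

End ContinuousMeasurable.

(** * Gaussian moments from Stein's identity *)

Section GaussianMoments.
Variables (R : realType) (n : nat).
Implicit Types (f g : 'rV[R]_n -> R) (u v w z m : 'rV[R]_n) (A P Q : 'M[R]_n).

Lemma derivable_affine f m A z v : derivable f (m + z *m A) (v *m A) ->
  derivable (fun y => f (m + y *m A)) z v /\
  'D_v (fun y => f (m + y *m A)) z = 'D_(v *m A) f (m + z *m A).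
Proof.
rewrite /derivable /derive /=.
suff -> : (fun h : R => h^-1 *: ((fun y => f (m + y *m A)) (h *: v + z) - f (m + z *m A))) =
  (fun h : R => h^-1 *: ((f \o shift (m + z *m A)) (h *: (v *m A)) - f (m + z *m A))) by [].
apply/funext => h /=; congr (_ *: (f _ - _)).
by rewrite mulmxDl -scalemxAl addrCA.
Qed.

Lemma stein_affine f m A v (L : R) : 0 <= L -> lbnd (fun z => f (m + z *m A)) ->
  (forall x w, derivable f x w) ->
  (forall x y, (f y - f x) ^+ 2 <= L * sqnorm (y - x)) ->
  Ez (fun z => f (m + z *m A) * dot z v) = Ez (fun z => 'D_(v *m A) f (m + z *m A)).
Proof.
move=> L0 fb df fL.
have [||_ <-] := @stein R n (fun z => f (m + z *m A)) v (Num.sqrt (L * sqnorm (v *m A))) fb.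
- by move=> u; have [] := derivable_affine (df (m + u *m A) (v *m A)).
- move=> u t; rewrite -sqrtr_sqr -(sqrtr_sqr t) -sqrtrM ?mulr_ge0 ?sqnorm_ge0//.
  rewrite ler_wsqrtr//; apply: le_trans (fL _ _) _.
  have -> : m + (t *: v + u) *m A - (m + u *m A) = t *: (v *m A).
    by rewrite mulmxDl -scalemxAl opprD addrACA subrr add0r addrK.
  by rewrite !sqnormE !dot_lin expr2; lra.
- congr Ez; apply/funext => u.
  by have [] := derivable_affine (df (m + u *m A) (v *m A)).
Qed.

(** Stein's identity for the constant 1; second moments come from coordinate functions in the same
    way. *)
Lemma Ez_coord i : Ez (fun u => u 0 i) = 0.
Proof.
have /= := @stein_affine (fun=> 1) 0 1%:M (evec R i) 0 (lexx _) (lbnd_cst _ _)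
  (fun _ _ => derivable_cst _ _ _).
under eq_fun do rewrite mul1r dot_evec.
move=> -> //; last by move=> x y; rewrite subrr expr0n mul0r.
under eq_fun do rewrite derive_cst.
exact: Ez_cst.
Qed.

Lemma derive_coord x v i : derivable (fun u : 'rV[R]_n => u 0 i) x v /\
  'D_v (fun u : 'rV[R]_n => u 0 i) x = v 0 i.
Proof.
split; first exact/diff_derivable/differentiable_coord.
apply: cvg_lim => //; apply: cvg_near_cst; near=> h.
have h0 : h != 0 by near: h; exact: nbhs_dnbhs_neq.
rewrite /= !mxE addrK [_ *: _]mulrA mulVf// mul1r//.
Unshelve. all: by end_near. Qed.

Lemma Ez_coordM i j : Ez (fun u => u 0 i * u 0 j) = (i == j)%:R.
Proof.
have : Ez (fun z => (0 + z *m 1%:M) 0 i * dot z (evec R j)) =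
   Ez (fun z => 'D_(evec R j *m 1%:M) (fun u : 'rV[R]_n => u 0 i) (0 + z *m 1%:M)).
  apply: (@stein_affine _ _ _ _ 1) => //.
  - exact: lbnd_affine.
  - by move=> x w; have [] := derive_coord x w i.
  - move=> x y; rewrite mul1r /sqnorm (bigD1 i)//= !mxE lerDl.
    by apply: sumr_ge0 => k _; exact: sqr_ge0.
under eq_fun do rewrite mulmx1 add0r dot_evec.
move=> ->; under eq_fun do rewrite (derive_coord _ _ _).2 mulmx1 evecE.
exact: Ez_cst.
Qed.

Lemma lbnd_row0 P i : lbnd (fun z => (z *m P) 0 i).
Proof. by have := lbnd_affine 0 P i; under eq_fun do rewrite add0r. Qed.

Lemma Ez_affine w P i : Ez (fun z => (w + z *m P) 0 i) = w 0 i.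
Proof.
under eq_fun do rewrite !mxE.
rewrite EzD; [|exact: integ_cst|].
  rewrite Ez_cst Ez_sum; first by rewrite big1 ?addr0// => k _;
    under eq_fun do rewrite mulrC; rewrite EzZ ?Ez_coord ?mulr0//;
        exact/qbnd_integ/lbnd_qbnd/lbnd_coord.
  by move=> k; under eq_fun do rewrite mulrC; apply/integZ/qbnd_integ/lbnd_qbnd/lbnd_coord.
by apply: integ_sum => k; under eq_fun do rewrite mulrC;
    apply/integZ/qbnd_integ/lbnd_qbnd/lbnd_coord.
Qed.

Lemma qbnd_dot (b c : 'rV[R]_n -> 'rV[R]_n) :
  (forall i, lbnd (fun z => b z 0 i)) -> (forall i, lbnd (fun z => c z 0 i)) ->
  qbnd (fun z => dot (b z) (c z)).
Proof.
move=> lb lc; under eq_fun do rewrite dotE.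
by apply: qbnd_sum => i; exact: lbndM.
Qed.

Lemma Ez_dotl (b : 'rV[R]_n -> 'rV[R]_n) w : (forall i, lbnd (fun z => b z 0 i)) ->
  Ez (fun z => dot (b z) w) = dot (\row_i Ez (fun z => b z 0 i)) w.
Proof.
move=> lb; under eq_fun do rewrite dotE.
rewrite Ez_sum; last by move=> i; apply/qbnd_integ/lbndM; [exact: lb|exact: lbnd_cst].
rewrite dotE; apply: eq_bigr => i _; rewrite mxE mulrC -EzZ; last exact/qbnd_integ/lbnd_qbnd.
by under eq_fun do rewrite mulrC.
Qed.

Lemma Ez_dot_mulmx (b : 'rV[R]_n -> 'rV[R]_n) P : (forall i, lbnd (fun z => b z 0 i)) ->
  Ez (fun z => dot (b z) (z *m P)) = \tr (P^T *m \matrix_(i, j) Ez (fun z => z 0 i * b z 0 j)).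
Proof.
move=> lb.
have q i j : integ (fun z => P i j * (z 0 i * b z 0 j)).
  by apply/integZ/qbnd_integ/lbndM => //; exact: lbnd_coord.
have -> : (fun z => dot (b z) (z *m P)) = fun z => \sum_j \sum_i P i j * (z 0 i * b z 0 j).
  apply/funext => z; rewrite dotE; apply: eq_bigr => j _; rewrite mxE mulr_sumr.
  by apply: eq_bigr => i _; ring.
rewrite Ez_sum => [|j]; last exact: integ_sum.
apply: eq_bigr => j _; rewrite Ez_sum// mxE; apply: eq_bigr => i _; rewrite !mxE.
by apply: EzZ; apply/qbnd_integ/lbndM => //; exact: lbnd_coord.
Qed.

Lemma Ez_dot_affine w1 w2 P Q :
  Ez (fun z => dot (w1 + z *m P) (w2 + z *m Q)) = dot w1 w2 + \tr (P^T *m Q).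
Proof.
have lP i := lbnd_affine w1 P i.
under eq_fun do rewrite dotDr.
rewrite EzD ?Ez_dotl//; first last.
- by apply/qbnd_integ/qbnd_dot => // i; exact: lbnd_row0.
- by apply/qbnd_integ/qbnd_dot => // i; exact: lbnd_cst.
congr (_ + _).
  by congr dot; apply/rowP => i; rewrite mxE Ez_affine.
rewrite Ez_dot_mulmx// -mxtrace_tr trmx_mul trmxK.
suff -> : \matrix_(i, j) Ez (fun z : 'rV[R]_n => z 0 i * (w1 + z *m P) 0 j) = P.
  by [].
apply/matrixP => i j; rewrite mxE.
have -> : (fun z : 'rV[R]_n => z 0 i * (w1 + z *m P) 0 j) =
    (fun z => w1 0 j * z 0 i + \sum_k P k j * (z 0 k * z 0 i)).
  apply/funext => z; rewrite !mxE mulrDr mulrC; congr (_ + _); rewrite mulr_sumr.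
  by apply: eq_bigr => k _; ring.
have q k : integ (fun z : 'rV[R]_n => z 0 k * z 0 i) by apply/qbnd_integ/lbndM; exact: lbnd_coord.
rewrite EzD; [|exact/integZ/qbnd_integ/lbnd_qbnd/lbnd_coord|by apply: integ_sum => k; exact:
    integZ].
rewrite EzZ ?Ez_coord; last exact/qbnd_integ/lbnd_qbnd/lbnd_coord.
rewrite mulr0 add0r Ez_sum => [|k]; last exact: integZ.
rewrite (bigD1 i)//= big1 ?addr0 => [|k ki]; rewrite EzZ// Ez_coordM ?eqxx ?mulr1//.
by rewrite (negbTE ki) mulr0.
Qed.

Lemma Ez_dot_centered w P : Ez (fun z => dot w (0 + z *m P)) = 0.
Proof.
have := Ez_dot_affine w 0 0 P.
under eq_fun do rewrite mulmx0 addr0.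
by move=> ->; rewrite !trmx0 mul0mx mxtrace0 /dot trmx0 mulmx0 mxE addr0.
Qed.

End GaussianMoments.

(** * Gaussian integrals and couplings *)

Section GaussianIntegrals.
Variables (R : realType) (n : nat).
Implicit Types (f g : 'rV[R]_n -> R) (u v w z m : 'rV[R]_n) (A P Q : 'M[R]_n).

Lemma rowmf_affine_inv f m A : A \in unitmx -> rowmf (fun z => f (m + z *m A)) -> rowmf f.
Proof.
move=> uA mf; have := rowmf_affine (- m *m invmx A) (invmx A) mf.
suff -> : (fun u => f (m + (- m *m invmx A + u *m invmx A) *m A)) = f by [].
by apply/funext => u; rewrite mulmxDl !mulmxKV// addrA subrr add0r.
Qed.

Lemma gauss_density_dominated f m A : A \in unitmx -> qbnd (fun z => f (m + z *m A)) ->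
  gauss_dominated (fun u => gauss_density m (A^T *m A) u * f u).
Proof.
move=> uA [mf [C Cf]]; split.
  apply: rowmf_rmeas; apply: rowmfM; first exact: measurable_gauss_density.
  exact: rowmf_affine_inv mf.
have dA0 : 0 < `|\det A| by rewrite normr_gt0 -unitfE.
(* The quadratic growth of [f] uses up a factor exp (|z|^2 / 4) of the density, and |u|^2 <= 2 |m|^2
   + 2 k |z|^2 converts the remaining exp (- |z|^2 / 4) into decay in [u] at rate 1 / (8 k). The
   added 1 keeps [k] positive. *)
set k := frob A + 1; have k0 : 0 < k by rewrite ltr_wpDl// frob_ge0.
exists (`|\det A|^-1 * ((Num.sqrt (2 * pi))^-1 ^+ n * (`|C| * (4 * expR (sqnorm m / (4 *
    k)))))), (8 * k)^-1.
split=> [|u]; first by rewrite invr_gt0 mulr_gt0.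
set z := (u - m) *m invmx A.
have uz : u = m + z *m A by rewrite mulmxKV// subrKC.
have -> : gauss_density m (A^T *m A) u = `|\det A|^-1 * std_density z.
  by rewrite -(gauss_density_affine m z uA) -uz mulrA mulVf ?mul1r// gt_eqF.
have c0 : 0 <= (Num.sqrt (2 * pi))^-1 ^+ n :> R by rewrite exprn_ge0// invr_ge0 sqrtr_ge0.
rewrite !normrM normrV ?unitfE ?gt_eqF// normr_id (ger0_norm c0) (ger0_norm (expR_ge0 _)).
rewrite -!mulrA; apply: ler_wpM2l; first by rewrite invr_ge0 ltW.
apply: ler_wpM2l => //.
have fu : `|f u| <= `|C| * (4 * expR (4^-1 * sqnorm z)).
  rewrite uz; apply: le_trans (Cf z) _; apply: (@le_trans _ _ (`|C| * (1 + sqnorm z))).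
    by rewrite ler_wpM2r ?ler_norm// ltW// sqnorm1_gt0.
  apply: ler_wpM2l => //; apply: le_trans (expR_ge_affine (_ : 0 < 4^-1) (sqnorm_ge0 z) _) _ =>
      //; lra.
apply: le_trans (ler_wpM2l (expR_ge0 _) fu) _.
rewrite mulrCA; apply: ler_wpM2l => //.
rewrite mulrCA -!expRD; apply: ler_wpM2l => //; rewrite ler_expR.
have h1 : sqnorm u <= 2 * sqnorm m + 2 * (sqnorm z * k).
  rewrite {1}uz; apply: le_trans (sqnormD_le _ _) _; rewrite lerD2l ler_pM2l//.
  by apply: le_trans (sqnorm_mulmx _ _) _; rewrite ler_wpM2l ?sqnorm_ge0// lerDl.
have -> : sqnorm m / (4 * k) + - (8 * k)^-1 * sqnorm u = - ((8 * k)^-1 * (sqnorm u - 2 * sqnorm m)).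
  by field; rewrite gt_eqF.
have -> : - sqnorm z / 2 + 4^-1 * sqnorm z = - ((8 * k)^-1 * (2 * (sqnorm z * k))).
  by field; rewrite gt_eqF.
by rewrite lerN2 ler_pM2l ?invr_gt0 ?mulr_gt0// lerBlDl.
Qed.

(** Positive and negative parts are treated separately by [gauss_rint]. Through this identity the
    means of the potential, of the entropy and of the one-step majorants become standard
    expectations. *)
Lemma gauss_int_Ez f m A : A \in unitmx -> qbnd (fun z => f (m + z *m A)) ->
  gauss_int m (A^T *m A) (fun u => (f u)%:E) = (Ez (fun z => f (m + z *m A)))%:E.
Proof.
move=> uA qf; rewrite gauss_intE.
have dom := gauss_density_dominated uA qf.
under eq_fun do rewrite -EFinM.
rewrite (rint_dominated dom) Ez_fin; last exact: qbnd_integ.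
have mf : rowmf f := rowmf_affine_inv uA qf.1.
have key (g : 'rV[R]_n -> \bar R) : rmeas g -> (forall u, (0 <= g u)%E) ->
  (\int[prod_measure lebesgue_measure n]_t ((gauss_density m (A^T *m A) (row_of t))%:E * g
      (row_of t)) =
   \int[std_gauss R n]_t g (m + row_of t *m A)%R)%E.
  move=> mg g0; rewrite -(gauss_rint _ uA mg g0) (rint_prod _ _)//.
  - by apply: emeasurable_funM => //; apply/measurable_EFinP; exact: measurable_gauss_density.
  - by move=> u; rewrite mule_ge0// lee_fin gauss_density_ge0.
rewrite [LHS]integralE [RHS]integralE; congr (_ - _)%E.
- under [RHS]eq_integral do rewrite funeposE.
  rewrite -(key (fun u => maxe (f u)%:E 0)).
  + apply: eq_integral => t _; rewrite funeposE EFinM.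
    by rewrite maxeMr ?mule0// lee_fin gauss_density_ge0.
  + by apply: measurable_maxe; [exact: rowmf_rmeas|exact: measurable_cst].
  + by move=> u; rewrite le_max lexx orbT.
- under [RHS]eq_integral do rewrite funenegE.
  rewrite -(key (fun u => maxe (- (f u)%:E)%E 0)).
  + apply: eq_integral => t _; rewrite funenegE EFinM -muleN.
    by rewrite maxeMr ?mule0// lee_fin gauss_density_ge0.
  + apply: measurable_maxe; [|exact: measurable_cst].
    by apply: measurableT_comp => //; exact: rowmf_rmeas.
  + by move=> u; rewrite le_max lexx orbT.
Qed.

Lemma Ez_sqnorm : Ez (@sqnorm R n) = n%:R.
Proof.
have -> : @sqnorm R n = fun z => dot (0 + z *m 1%:M) (0 + z *m 1%:M).
  by apply/funext => z; rewrite sqnormE mulmx1 add0r.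
by rewrite Ez_dot_affine -sqnormE mulmx1 trmx1 mxtrace1 (eqP (_ : sqnorm 0 == 0)) ?add0r
    ?sqnorm_eq0.
Qed.

Lemma qbnd_sqnorm : qbnd (@sqnorm R n).
Proof.
have -> : @sqnorm R n = fun z => dot z z by apply/funext => z; exact: sqnormE.
by apply: qbnd_dot => i; exact: lbnd_coord.
Qed.

Lemma ln_det_gram A : A \in unitmx -> ln (\det (A^T *m A)) = 2 * ln `|\det A|.
Proof.
rewrite unitmxE unitfE => dA; rewrite det_mulmx det_tr -expr2 -real_normK ?num_real//.
by rewrite lnXn ?normr_gt0// mulr_natl.
Qed.

Lemma entropyE m A : A \in unitmx ->
  entropy m (A^T *m A) = (n%:R * ln (Num.sqrt (2 * pi))^-1 - n%:R / 2 - ln (\det (A^T *m A)) /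
      2)%:E.
Proof.
move=> uA.
have dA0 : 0 < `|\det A| by rewrite normr_gt0 -unitfE.
have lnE z : ln (gauss_density m (A^T *m A) (m + z *m A)) =
    (n%:R * ln (Num.sqrt (2 * pi))^-1 - ln `|\det A|) + - 2^-1 * sqnorm z.
  have p0 : 0 < (Num.sqrt (2 * pi))^-1 :> R by rewrite invr_gt0 sqrtr_gt0 mulr_gt0// pi_gt0.
  have -> : gauss_density m (A^T *m A) (m + z *m A) = `|\det A|^-1 * std_density z.
    by rewrite -(gauss_density_affine m z uA) mulrA mulVf ?mul1r// gt_eqF.
  have c0 : 0 < (Num.sqrt (2 * pi))^-1 ^+ n :> R by rewrite exprn_gt0.
  rewrite lnM ?posrE ?invr_gt0// ?mulr_gt0 ?expR_gt0// lnM ?posrE ?expR_gt0//.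
  by rewrite expRK lnV ?posrE// lnXn// mulr_natl; lra.
have q : qbnd (fun z => ln (gauss_density m (A^T *m A) (m + z *m A))).
  under eq_fun do rewrite lnE.
  by apply: qbndD; [exact: qbnd_cst|apply/qbndZ/qbnd_sqnorm].
rewrite /entropy (gauss_int_Ez uA q).
under eq_fun do rewrite lnE.
rewrite EzD ?Ez_cst ?EzZ ?Ez_sqnorm ?ln_det_gram//; last 3 first.
- exact/qbnd_integ/qbnd_sqnorm.
- exact: integ_cst.
- exact/integZ/qbnd_integ/qbnd_sqnorm.
by congr EFin; lra.
Qed.

End GaussianIntegrals.

(** * Upper and lower bounds for the Wasserstein distance *)

Section Coupling.
Variables (R : realType) (n : nat).
Implicit Types (f : 'rV[R]_n -> R) (u v w z m : 'rV[R]_n) (A P Q : 'M[R]_n).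

Lemma gaussE m A (E : set (n.-tuple R)) : A \in unitmx -> measurable E ->
  gauss m (A^T *m A) E = std_gauss R n ((fun t => tup (m + row_of t *m A)) @^-1` E).
Proof.
move=> uA mE.
have mI : rmeas (fun u : 'rV[R]_n => (\1_E (tup u))%:E).
  apply/measurable_EFinP.
  rewrite [X in measurable_fun _ X](_ : _ = \1_E)//.
  by apply/funext => t /=; rewrite row_ofK.
have I0 u : (0 <= (\1_E (tup u) : R)%:E)%E by rewrite lee_fin.
rewrite /gauss lebintE.
have := gauss_rint m uA mI I0.
rewrite integral_indic//; last first.
  by rewrite -[X in measurable X]setTI; exact: measurable_affine.
rewrite setIT => <-; congr (iterint _ _); apply/funext => t /=.
by rewrite row_ofK EFinM muleC.
Qed.

Lemma marginal_integral d (T : measurableType d) (g : probability T R) (pr : T -> n.-tuple R) m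
    A f :
  measurable_fun setT pr -> A \in unitmx ->
  (forall E, measurable E -> g (pr @^-1` E) = gauss m (A^T *m A) E) ->
  qbnd (fun z => f (m + z *m A)) ->
  g.-integrable setT (fun t => (f (row_of (pr t)))%:E) /\
  (\int[g]_t (f (row_of (pr t)))%:E = (Ez (fun z => f (m + z *m A)))%:E)%E.
Proof.
move=> mpr uA gE qf.
have mf : rowmf f := rowmf_affine_inv uA qf.1.
have maf := measurable_affine m A.
pose phi := fun t : n.-tuple R => tup (m + row_of t *m A).
have key (h : n.-tuple R -> \bar R) : (\int[pushforward g pr]_y h y = \int[pushforward
    (std_gauss R n) phi]_y h y)%E.
  apply: eq_measure_integral => E mE _.
  by rewrite [LHS]gE// gaussE.
have Iq := qbnd_integ qf.
have mef : measurable_fun setT (fun t : n.-tuple R => (f (row_of t))%:E) by exact: rowmf_rmeas.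
have If : g.-integrable setT (fun t => (f (row_of (pr t)))%:E).
  apply/integrableP; split; first exact: (measurableT_comp mef mpr).
  have /integrableP[_] := Iq.
  have mabs : measurable_fun setT (fun t : n.-tuple R => `|(f (row_of t))%:E|%E) by exact:
      measurableT_comp.
  have := key (fun t => `|(f (row_of t))%:E|%E).
  rewrite !ge0_integral_pushforward// !preimage_setT => ->.
  by under eq_integral do rewrite /= tupK.
split=> //; rewrite Ez_fin//.
have := key (fun t => (f (row_of t))%:E).
rewrite !integral_pushforward// ?preimage_setT//.
  by move=> ->; apply: eq_integral => t _; rewrite /= tupK.
by move: Iq; rewrite /integ; congr (_.-integrable _ _); apply/funext => t; rewrite /= tupK.
Qed.

Definition std_law d (T : measurableType d) (phi : n.-tuple R -> T)
  (mphi : measurable_fun setT phi) : set T -> \bar R := image_measure (std_gauss R n) mphi.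

HB.instance Definition _ d (T : measurableType d) (phi : n.-tuple R -> T)
  (mphi : measurable_fun setT phi) := Measure.on (std_law mphi).

Lemma std_law_setT d (T : measurableType d) (phi : n.-tuple R -> T)
  (mphi : measurable_fun setT phi) : (std_law mphi setT = 1)%E.
Proof. exact: std_gauss_setT. Qed.

HB.instance Definition _ d (T : measurableType d) (phi : n.-tuple R -> T)
  (mphi : measurable_fun setT phi) := Measure_isProbability.Build _ _ _ (std_law mphi)
      (std_law_setT mphi).

Lemma measurable_transport_cost : measurable_fun setT
  (fun z : n.-tuple R * n.-tuple R => (sqnorm (row_of z.1 - row_of z.2))%:E).
Proof.
apply/measurable_EFinP; apply: measurable_sum => i; apply: measurable_funX.
under eq_fun do rewrite !mxE.
by apply: measurable_funB; apply: (measurableT_comp (measurable_tnth _)).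
Qed.

Lemma W2sq_le m mhat A B : A \in unitmx -> B \in unitmx ->
  (W2sq (gauss m (A^T *m A)) (gauss mhat (B^T *m B))
    <= (sqnorm (m - mhat) + \tr ((A - B)^T *m (A - B)))%:E)%E.
Proof.
move=> uA uB.
pose phi := fun t : n.-tuple R => (tup (m + row_of t *m A), tup (mhat + row_of t *m B)).
have mphi : measurable_fun setT phi.
  by apply/measurable_fun_pair; exact: measurable_affine.
have E z : sqnorm (m + z *m A - (mhat + z *m B)) = dot (m - mhat + z *m (A - B)) (m - mhat + z
    *m (A - B)).
  by rewrite -sqnormE mulmxBr opprD addrACA.
apply: ge_ereal_inf.
exists (\int[std_law mphi]_(z in [set: n.-tuple R * n.-tuple R])
                     (sqnorm (row_of z.1 - row_of z.2))%:E)%E.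
  exists (std_law mphi : probability _ _) => //.
  split=> F mF; rewrite gaussE// /std_law /image_measure /= /pushforward; congr (std_gauss _ _ _).
    by apply/funext => t; rewrite /phi/=/setX/= propeqE; tauto.
  by apply/funext => t; rewrite /phi/=/setX/= propeqE; tauto.
rewrite [leLHS](_ : _ = (Ez (fun z => dot (m - mhat + z *m (A - B)) (m - mhat + z *m (A - B))))%:E).
  by rewrite Ez_dot_affine sqnormE.
rewrite Ez_fin; last by apply/qbnd_integ/qbnd_dot => i; exact: lbnd_affine.
under [RHS]eq_integral do rewrite -E.
have := integral_image_measure (std_gauss R n) mphi measurable_transport_cost.
move=> ->; first by apply: eq_integral => t _; rewrite /= !tupK.
by move=> z; rewrite lee_fin sqnorm_ge0.
Qed.

(* [f1] and [f2] are the Kantorovich potentials of the map [T]. *)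
Lemma W2sq_ge m mhat A B T : A \in unitmx -> B \in unitmx -> spd T ->
  T *m (A^T *m A) *m T = B^T *m B ->
  ((gcost m mhat (A^T *m A) T)%:E
    <= W2sq (gauss m (A^T *m A)) (gauss mhat (B^T *m B)))%E.
Proof.
move=> uA uB sT TAT.
apply/ereal_infP => _ [g [gA gB] <-].
set delta := m - mhat; have uT := spd_unit sT.
pose f1 (x : 'rV[R]_n) := dot (x - m) (x - m) + - 1 * dot ((x - m) *m T) (x - m) + (2 * dot (x -
    m) delta + sqnorm delta).
pose f2 (y : 'rV[R]_n) := dot (y - mhat) (y - mhat) + - 1 * dot ((y - mhat) *m invmx T) (y -
    mhat) + -2 * dot (y - mhat) delta.
(* With a = x - m and b = y - mhat, the gap is exactly the quadratic form of [T] at a - b T^(-1). *)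
have dual x y : f1 x + f2 y <= sqnorm (x - y).
  have -> : x - y = (x - m) - (y - mhat) + delta by apply/rowP => i; rewrite !mxE; ring.
  rewrite /f1 /f2; move: (x - m) (y - mhat) (delta) => a b e.
  have := (spd_spsd sT).2 (a - b *m invmx T); rewrite qformE mulmxBl mulmxKV// !sqnormE !dot_lin.
  have -> : dot (a *m T) (b *m invmx T) = dot b a.
    by rewrite dot_mulmx sT.1 mulmxKV// dotC.
  rewrite (dotC b (b *m _)) (dotC b a) (dotC e a) (dotC e b); lra.
have f1E z : f1 (m + z *m A) = dot (0 + z *m A) (0 + z *m A) + - 1 * dot (0 + z *m (A *m T)) (0
    + z *m A) + (2 * dot (0 + z *m A) delta + sqnorm delta).
  by rewrite /f1 (addrC m) addrK !add0r mulmxA.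
have f2E z : f2 (mhat + z *m B) = dot (0 + z *m B) (0 + z *m B) + - 1 * dot (0 + z *m (B *m
    invmx T)) (0 + z *m B) + - 2 * dot (0 + z *m B) delta.
  by rewrite /f2 (addrC mhat) addrK !add0r mulmxA.
have qd P Q : qbnd (fun z : 'rV[R]_n => dot (0 + z *m P) (0 + z *m Q)).
  by apply: qbnd_dot => i; exact: lbnd_affine.
have ql P : qbnd (fun z : 'rV[R]_n => dot (0 + z *m P) delta).
  by apply: qbnd_dot => i; [exact: lbnd_affine|exact: lbnd_cst].
have q1 : qbnd (fun z => f1 (m + z *m A)).
  under eq_fun do rewrite f1E.
  apply: qbndD; first by apply: qbndD => //; exact: qbndZ.
  by apply: qbndD; [exact: qbndZ|exact: qbnd_cst].
have q2 : qbnd (fun z => f2 (mhat + z *m B)).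
  under eq_fun do rewrite f2E.
  by apply: qbndD; [apply: qbndD => //|]; exact: qbndZ.
have el P : Ez (fun z : 'rV[R]_n => dot (0 + z *m P) delta) = 0.
  by under eq_fun do rewrite dotC; exact: Ez_dot_centered.
have dot00 : dot (0 : 'rV[R]_n) 0 = 0 by rewrite /dot mul0mx mxE.
have E1 : Ez (fun z => f1 (m + z *m A)) = \tr (A^T *m A) - \tr (A^T *m A *m T) + sqnorm delta.
  under eq_fun do rewrite f1E.
  rewrite 3?EzD ?EzZ ?Ez_cst ?el ?Ez_dot_affine ?dot00; do ?[by apply/qbnd_integ; do ?[apply:
      qbndD|apply: qbndZ|exact: qbnd_cst]].
  by rewrite !add0r trmx_mul sT.1 -[T *m _ *m _]mulmxA (mxtrace_mulC T) mulN1r mulr0 add0r.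
have E2 : Ez (fun z => f2 (mhat + z *m B)) = \tr (B^T *m B) - \tr (A^T *m A *m T).
  under eq_fun do rewrite f2E.
  rewrite 2?EzD ?EzZ ?Ez_cst ?el ?Ez_dot_affine ?dot00; do ?[by apply/qbnd_integ; do ?[apply:
      qbndD|apply: qbndZ|exact: qbnd_cst]].
  rewrite mulr0 !add0r addr0 trmx_mul (spd_inv sT).1 -[_ *m _ *m B]mulmxA -TAT.
  by rewrite -(mulmxA T) mulKmx// mulN1r.
have [i1 e1] := marginal_integral measurable_fst uA
  (fun E (mE : measurable E) => etrans (congr1 g (esym (setXT _ E))) (gA E mE)) q1.
have [i2 e2] := marginal_integral measurable_snd uB
  (fun E (mE : measurable E) => etrans (congr1 g (esym (setTX _ E))) (gB E mE)) q2.
apply: (@le_trans _ _ (\int[g]_z ((f1 (row_of z.1))%:E + (f2 (row_of z.2))%:E))%E).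
  rewrite integralD// e1 e2 -EFinD lee_fin E1 E2 -TAT /gcost /ipS -/delta.
  have -> : (1%:M - T)^T = 1%:M - T by rewrite raddfB /= trmx1 sT.1.
  rewrite !(mulmxBl, mulmxBr) !(mul1mx, mulmx1) !raddfB /=.
  rewrite [\tr (T *m (A^T *m A))]mxtrace_mulC; lra.
(* Comparing integrals of signed functions uses integrability of the cost; a coupling of infinite
   cost satisfies the bound trivially. *)
have [->|] := eqVneq (\int[g]_z (sqnorm (row_of z.1 - row_of z.2))%:E)%E +oo%E; first exact: leey.
rewrite -ltey => foo; apply: le_integral => //.
- exact: integrableD.
- apply/integrableP; split; first exact: measurable_transport_cost.
  by under eq_integral do rewrite gee0_abs ?lee_fin ?sqnorm_ge0//.
- by move=> z _; rewrite -EFinD lee_fin.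
Qed.

End Coupling.

(** * Contraction *)

Section SmoothPotential.
Variables (R : realType) (n : nat) (V : 'rV[R]_n -> R) (alpha beta : R).
Hypotheses (C2V : C2 V) (alpha0 : 0 < alpha) (alphabeta : alpha <= beta).
Hypotheses (strongV : strongly_convex alpha V) (smoothV : smooth beta V).
Implicit Types (m w z : 'rV[R]_n) (A P L : 'M[R]_n).

Let beta0 : 0 < beta. Proof. exact: lt_le_trans alphabeta. Qed.

Lemma sqnorm_coord (u : 'rV[R]_n) i : u 0 i ^+ 2 <= sqnorm u.
Proof. by rewrite /sqnorm (bigD1 i)//= lerDl sumr_ge0// => k _; exact: sqr_ge0. Qed.

Lemma sqnorm_affine_le m A z :
  sqnorm (m + z *m A) <= (2 * sqnorm m + 2 * frob A) * (1 + sqnorm z).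
Proof.
apply: le_trans (sqnormD_le _ _) _.
have := sqnorm_mulmx z A; have := frob_ge0 A; have := sqnorm_ge0 m; have := sqnorm_ge0 z.
nra.
Qed.

Lemma lbnd_grad m A j : lbnd (fun z => grad V (m + z *m A) 0 j).
Proof.
split; first by apply: (@rowmf_affine _ _ (fun x => grad V x 0 j)); exact: (continuous_rowmf
    (@continuous_gradi _ _ _ C2V j)).
exists (2 * (beta ^+ 2 * (2 * sqnorm m + 2 * frob A)) + 2 * sqnorm (grad V 0)) => z.
apply: le_trans (sqnorm_coord _ j) _.
rewrite -{1}(subrK (grad V 0) (grad V (m + z *m A))).
apply: le_trans (sqnormD_le _ _) _.
have h := grad_lipschitz C2V alpha0 alphabeta strongV smoothV 0 (m + z *m A).
rewrite subr0 in h.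
have h2 : beta ^+ 2 * sqnorm (m + z *m A) <= beta ^+ 2 * ((2 * sqnorm m + 2 * frob A) * (1 +
    sqnorm z)).
  by rewrite ler_wpM2l ?sqr_ge0// sqnorm_affine_le.
have h3 := mulr_ge0 (sqnorm_ge0 (grad V 0)) (sqnorm_ge0 z).
rewrite mulrDl -!mulrA; lra.
Qed.

Lemma lbnd_hess m A i j : lbnd (fun z => hess V (m + z *m A) i j).
Proof.
split; first by apply: (@rowmf_affine _ _ (fun x => hess V x i j)); exact: (continuous_rowmf
    (@continuous_hessij _ _ _ C2V i j)).
exists (beta * (beta * sqnorm (evec R i))) => z; set x := m + z *m A.
have -> : hess V x i j = (evec R i *m hess V x) 0 j by rewrite /evec -rowE [RHS]mxE.
apply: le_trans (sqnorm_coord _ j) _.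
apply: le_trans (hess_sq_le C2V alpha0 alphabeta strongV smoothV _ _) _.
apply: (@le_trans _ _ (beta * (beta * sqnorm (evec R i)))).
  by rewrite ler_pM2l//; have /andP[] := smoothV x (evec R i).
by rewrite ler_peMr ?sqnorm1_ge1// !mulr_ge0 ?sqnorm_ge0// ltW.
Qed.

Lemma qbnd_potential m A : qbnd (fun z => V (m + z *m A)).
Proof.
split; first by apply: (@rowmf_affine _ _ V); exact: (continuous_rowmf (@continuous_V _ _ _ C2V)).
exists (`|V 0| + sqnorm (grad V 0) + (1 + beta) * (2 * sqnorm m + 2 * frob A)) => z.
have := taylor_upper C2V strongV smoothV 0 (m + z *m A).
have := taylor_lower C2V strongV smoothV 0 (m + z *m A).
rewrite subr0; have := sqnorm_affine_le m A z.
move: (m + z *m A) (grad V 0) => x g xz l u.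
have gx1 : 0 <= sqnorm g + 2 * dot g x + sqnorm x.
  by have := sqnorm_ge0 (g + x); rewrite !sqnormE !dot_lin (dotC x g); lra.
have gx2 : 0 <= sqnorm g - 2 * dot g x + sqnorm x.
  by have := sqnorm_ge0 (g - x); rewrite !sqnormE !dot_lin (dotC x g); lra.
have := sqnorm_ge0 z; have := sqnorm_ge0 x; have := sqnorm_ge0 g.
have := mulr_ge0 (ltW alpha0) (sqnorm_ge0 x); have := mulr_ge0 (ltW beta0) (sqnorm_ge0 x).
have := ler_norm (V 0); have := lerNnormlW (lexx `|V 0|).
move=> v1 v2 bx ax g0 x0 z0.
have xz2 : (1 + beta) * sqnorm x <= (1 + beta) * ((2 * sqnorm m + 2 * frob A) * (1 + sqnorm z)).
  by rewrite ler_wpM2l// addr_ge0// ltW.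
have v3 := mulr_ge0 (normr_ge0 (V 0)) z0.
have g3 := mulr_ge0 g0 z0.
rewrite ler_norml; apply/andP; split.
  rewrite mulrDl -mulrA; lra.
rewrite mulrDl -mulrA; lra.
Qed.

Definition mean_grad m A : 'rV[R]_n := \row_i Ez (fun z => grad V (m + z *m A) 0 i).
Definition mean_hess m A : 'M[R]_n := \matrix_(i, j) Ez (fun z => hess V (m + z *m A) i j).

Lemma mean_hess_sym m A : (mean_hess m A)^T = mean_hess m A.
Proof.
apply/matrixP => i j; rewrite !mxE; congr Ez; apply/funext => z.
by rewrite -[in LHS](hess_sym C2V) mxE.
Qed.

Lemma stein_grad m A i j :
  Ez (fun z => z 0 i * grad V (m + z *m A) 0 j) = (A *m mean_hess m A) i j.
Proof.
have -> : (fun z => z 0 i * grad V (m + z *m A) 0 j) =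
    (fun z => grad V (m + z *m A) 0 j * dot z (evec R i)).
  by apply/funext => z; rewrite dot_evec mulrC.
rewrite (@stein_affine _ _ (fun x => grad V x 0 j) m A (evec R i) (beta ^+ 2)
  (sqr_ge0 _) (lbnd_grad m A j)).
- under eq_fun do rewrite (hessE C2V).
  rewrite Ez_sum; last first.
    by move=> k; apply/integZ/qbnd_integ/lbnd_qbnd/lbnd_hess.
  rewrite mxE; apply: eq_bigr => k _; rewrite -rowE mxE EzZ; last
      exact/qbnd_integ/lbnd_qbnd/lbnd_hess.
  by rewrite -[in RHS]mean_hess_sym !mxE.
- by move=> x w; exact: derivable_gradi.
- move=> x y; apply: le_trans (grad_lipschitz C2V alpha0 alphabeta strongV smoothV x y).
  by apply: le_trans (sqnorm_coord _ j); rewrite !mxE.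
Qed.

(** The directional derivative of [mean_potential] at (m, A) along (w, P): Stein's identity converts
    the part linear in z into a trace against the mean Hessian. *)
Lemma Ez_dot_grad m A w P :
  Ez (fun z => dot (grad V (m + z *m A)) (w + z *m P)) =
  dot (mean_grad m A) w + \tr (P^T *m A *m mean_hess m A).
Proof.
under eq_fun do rewrite dotDr.
have lg := lbnd_grad m A.
rewrite EzD; first last.
- by apply/qbnd_integ/qbnd_dot => // i; exact: lbnd_row0.
- by apply/qbnd_integ/qbnd_dot => // i; exact: lbnd_cst.
rewrite Ez_dotl// Ez_dot_mulmx//; congr (_ + \tr _); rewrite -mulmxA; congr (_ *m _).
by apply/matrixP => i j; rewrite mxE stein_grad.
Qed.

Lemma spd_gram A : A \in unitmx -> spd (A^T *m A).
Proof.
move=> uA; have := spd_conj (P := A^T) _ (spd1 R n).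
by rewrite unitmx_tr mulmx1 trmxK; apply.
Qed.

Definition mean_potential m A := Ez (fun z => V (m + z *m A)).

Lemma freeFE m A : A \in unitmx -> freeF V m (A^T *m A) =
  (mean_potential m A + (n%:R * ln (Num.sqrt (2 * pi))^-1 - n%:R / 2 - ln (\det (A^T *m A)) /
      2))%:E.
Proof. by move=> uA; rewrite /freeF /potential entropyE// gauss_int_Ez//; exact: qbnd_potential.
    Qed.

Section Minimizer.
Variables (mhat : 'rV[R]_n) (Shat : 'M[R]_n).
Hypothesis minF : forall m S, spd S -> (freeF V mhat Shat <= freeF V m S)%E.

Lemma minimizer_le B m A : B \in unitmx -> B^T *m B = Shat -> A \in unitmx ->
  mean_potential mhat B - ln (\det Shat) / 2 <= mean_potential m A - ln (\det (A^T *m A)) / 2.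
Proof.
move=> uB BB uA; have := minF m (spd_gram uA).
by rewrite -BB !freeFE// lee_fin; lra.
Qed.

(* Compare [(mhat, Shat)] with [(mhat, (1 - t)^2 Shat)] as [t] tends to 0. *)
Lemma minimizer_trace_le B : B \in unitmx -> B^T *m B = Shat ->
  \tr (B^T *m B *m mean_hess mhat B) <= n%:R.
Proof.
(* The constant [c] collects the second-order terms in [t]: beta / 2 \tr (B^T B) from smoothness,
   and 2 n from - ln (1 - t) <= t + 2 t^2 for t <= 1/2. *)
move=> uB BB; set Q := \tr _; set c := beta / 2 * \tr (B^T *m B) + 2 * n%:R.
have c0 : 0 <= c.
  have := mxtrace_conj_ge0 B (spd_spsd (spd1 R n)); rewrite mulmx1 => t0.
  by rewrite addr_ge0 ?mulr_ge0// ltW.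
suff key (t : R) : 0 < t -> t <= 2^-1 -> Q <= n%:R + t * c.
  apply/ler_addgt0Pr => e e0; have c1 : 0 < c + 1 by rewrite ltr_wpDl.
  have := key (Num.min 2^-1 (e / (c + 1))).
  rewrite lt_min divr_gt0// ge_min lexx andbT invr_gt0 ltr0n => /(_ isT isT) h.
  apply: (le_trans h); rewrite lerD2l.
  apply: (@le_trans _ _ (e / (c + 1) * c)); first by rewrite ler_wpM2r// ge_min lexx orbT.
  rewrite mulrAC ler_pdivrMr// ler_pM2l// lerDl//.
move=> t0 t2; have t1 : 0 < 1 - t by lra.
have uA : (1 - t) *: B \in unitmx by rewrite unitmxZ// unitfE gt_eqF.
have := minimizer_le mhat uB BB uA.
have dB : 0 < `|\det B| by rewrite normr_gt0 -unitfE -unitmxE.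
rewrite -BB !ln_det_gram// detZ normrM normrX (gtr0_norm t1) lnM ?posrE ?exprn_gt0//.
rewrite lnXn// -[_ *+ n]mulr_natl.
have : mean_potential mhat ((1 - t) *: B) <=
   mean_potential mhat B + (- t * Q + beta / 2 * t ^+ 2 * \tr (B^T *m B)).
  have E1 : Ez (fun z => dot (grad V (mhat + z *m B)) (0 + z *m (- t *: B))) = - t * Q.
    rewrite Ez_dot_grad /dot trmx0 mulmx0 mxE add0r linearZ /= -!scalemxAl linearZ//.
  have E2 : Ez (fun z => dot (0 + z *m B) (0 + z *m B)) = \tr (B^T *m B).
    by rewrite Ez_dot_affine /dot trmx0 mulmx0 mxE add0r.
  have q1 : qbnd (fun z => dot (grad V (mhat + z *m B)) (0 + z *m (- t *: B))).
    by apply: qbnd_dot => i; [exact: lbnd_grad|exact: lbnd_affine].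
  have q2 : qbnd (fun z : 'rV[R]_n => beta / 2 * t ^+ 2 * dot (0 + z *m B) (0 + z *m B)).
    by apply/qbndZ/qbnd_dot => i; exact: lbnd_affine.
  have qV := qbnd_potential mhat B.
  rewrite -E1 -E2 -EzZ; last by apply/qbnd_integ/qbnd_dot => i; exact: lbnd_affine.
  rewrite -!EzD; try exact/qbnd_integ; try exact/integD/qbnd_integ/q2/qbnd_integ.
  apply: Ez_le; [exact/qbnd_integ/qbnd_potential| |].
    by apply/qbnd_integ/qbndD => //; exact: qbndD.
  move=> z; have := taylor_upper C2V strongV smoothV (mhat + z *m B) (mhat + z *m ((1 - t) *: B)).
  have -> : mhat + z *m ((1 - t) *: B) - (mhat + z *m B) = - t *: (z *m B).
    by rewrite opprD addrACA subrr add0r -scalemxAr scalerBl scale1r addrAC subrr add0r scaleNr.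
  rewrite !add0r -[z *m (- t *: B)]scalemxAr !sqnormE !dot_lin; lra.
have lt : - ln (1 - t) <= t / (1 - t).
  rewrite -lnV ?posrE//; have e : (1 - t)^-1 = 1 + t / (1 - t) by field; exact: lt0r_neq0.
  rewrite [in leLHS]e.
  by apply: le_ln1Dx; rewrite (lt_trans (ltrN10 _))// divr_gt0.
have nlt : n%:R * - ln (1 - t) <= n%:R * (t / (1 - t)) by rewrite ler_wpM2l.
have n2 : n%:R * (t / (1 - t)) <= n%:R * (t * (1 + 2 * t)).
  rewrite ler_wpM2l// ler_pM2l// -[leLHS]mul1r ler_pdivrMr//; nra.
move=> h1 h2.
rewrite -(ler_pM2l t0) /c; nra.
Qed.

End Minimizer.

End SmoothPotential.

(** * Monotonicity of integrals without measurability *)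

Section MonotoneIntegral.
(** The integral of a nonnegative function is a supremum over the simple functions below it, and
    that family grows with the function. *)
Lemma ge0_le_integral_nonmeasurable d (T : measurableType d) (R : realType)
  (mu : {measure set T -> \bar R}) (f g : T -> \bar R) :
  (forall x, (0 <= f x)%E) -> (forall x, (f x <= g x)%E) ->
  (\int[mu]_x f x <= \int[mu]_x g x)%E.
Proof.
move=> f0 fg; have g0 x := le_trans (f0 x) (fg x).
rewrite !ge0_integralTE//; apply: ereal_sup_le => _ [h hf <-].
by exists h => // x; exact: le_trans (hf x) (fg x).
Qed.

Lemma ge0_le_gauss_int (R : realType) n (m : 'rV[R]_n) S (f g : 'rV[R]_n -> \bar R) :
  (forall u, (0 <= f u)%E) -> (forall u, (f u <= g u)%E) ->
  (gauss_int m S f <= gauss_int m S g)%E.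
Proof.
move=> f0 fg; rewrite /gauss_int.
have lebint_ge0 k (F : k.-tuple R -> \bar R) : (forall t, (0 <= F t)%E) -> (0 <= lebint F)%E.
  by move=> F0; rewrite lebintE; exact: iterint_ge0.
have lebint_le k (F G : k.-tuple R -> \bar R) : (forall t, (0 <= F t)%E) ->
    (forall t, (F t <= G t)%E) -> (lebint F <= lebint G)%E.
  elim: k F G => [|k IH] F G F0 FG //=.
  apply: ge0_le_integral_nonmeasurable => x; first exact: lebint_ge0.
  exact: IH.
apply: lebint_le => t; first by rewrite mule_ge0 ?lee_fin ?gauss_density_ge0.
by rewrite lee_wpmul2l ?lee_fin ?gauss_density_ge0.
Qed.

Lemma expected_W2sq_ge0 (R : realType) n (V : 'rV[R]_n -> R) eta target k p :
  (0 <= expected_W2sq V eta target k p)%E.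
Proof.
elim: k p => [|k IH] p /=.
  by apply/ereal_infP => _ [g _ <-]; apply: integral_ge0 => z _; rewrite lee_fin sqnorm_ge0.
rewrite gauss_intE; apply: iterint_ge0 => t.
by rewrite mule_ge0 ?lee_fin ?gauss_density_ge0.
Qed.

End MonotoneIntegral.

Lemma step_size_le (R : realFieldType) (alpha beta eta : R) : 0 < alpha -> alpha <= beta ->
  eta <= alpha ^+ 2 / (48 * beta ^+ 3) -> eta * beta <= 48^-1.
Proof.
move=> alpha0 alphabeta eta_le; have beta0 : 0 < beta := lt_le_trans alpha0 alphabeta.
have h : eta * (48 * beta ^+ 3) <= alpha ^+ 2.
  by rewrite -ler_pdivlMr ?mulr_gt0 ?exprn_gt0.
have h2 : alpha ^+ 2 <= beta ^+ 2 by rewrite ler_pXn2r// nnegrE ltW.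
rewrite -(@ler_pM2r _ (beta ^+ 2 * 48)) ?mulr_gt0 ?exprn_gt0//.
have -> : eta * beta * (beta ^+ 2 * 48) = eta * (48 * beta ^+ 3) by ring.
have -> : 48^-1 * (beta ^+ 2 * 48) = beta ^+ 2 by field.
exact: le_trans h2.
Qed.

(** * Noise estimate, averaged step and induction on the number of steps *)

Section Contraction.
Variables (R : realType) (n : nat) (V : 'rV[R]_n -> R) (alpha beta : R).
Hypotheses (C2V : C2 V) (alpha0 : 0 < alpha) (alphabeta : alpha <= beta).
Hypotheses (strongV : strongly_convex alpha V) (smoothV : smooth beta V).
Implicit Types (m w z : 'rV[R]_n) (A P L : 'M[R]_n).

Let beta0 : 0 < beta. Proof. exact: lt_le_trans alphabeta. Qed.

(** Telescopes grad V x through grad V y and grad V mh. The factor 5/2 is 1 + 1/2 + 1: the pairing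
    of grad V y - grad V mh with b itself, Young's inequality with co-coercivity for its pairing
    with a - b, and strong monotonicity to absorb the alpha |b|^2 left by the pairing of grad V x -
    grad V y with a. *)
Lemma cross_term_le (x y mh a b : 'rV[R]_n) : y = mh + b ->
  dot (grad V x) a <= dot (grad V mh) a
   + 5 / 2 * (dot (grad V y) b - dot (grad V mh) b)
   + beta ^+ 2 / (2 * alpha) * sqnorm (x - y) + (alpha + beta / 2) * sqnorm (a - b).
Proof.
move=> ->; have eb : mh + b - mh = b by rewrite addrAC subrr add0r.
have := grad_lipschitz C2V alpha0 alphabeta strongV smoothV (mh + b) x.
have := grad_cocoercive C2V alpha0 alphabeta strongV smoothV mh (mh + b).
have := grad_strongly_monotone C2V strongV smoothV mh (mh + b).
rewrite eb; move: (grad V x) (grad V (mh + b)) (grad V mh) (sqnorm (x - _)) => G1 G2 G3 e h3 h2 h1.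
have y1 : dot (G1 - G2) a <= (2 * alpha)^-1 * sqnorm (G1 - G2) + alpha / 2 * sqnorm a.
  have := sqnorm_ge0 ((G1 - G2) - alpha *: a); move: (G1 - G2) => D.
  rewrite -(@pmulr_rge0 _ ((2 * alpha)^-1)) ?invr_gt0 ?mulr_gt0//.
  have -> : (2 * alpha)^-1 * sqnorm (D - alpha *: a) =
     (2 * alpha)^-1 * sqnorm D - dot D a + alpha / 2 * sqnorm a.
    by rewrite !sqnormE !dot_lin (dotC a D); field; rewrite gt_eqF.
  lra.
have y2 : dot (G2 - G3) (a - b) <= (2 * beta)^-1 * sqnorm (G2 - G3) + beta / 2 * sqnorm (a - b).
  have := sqnorm_ge0 ((G2 - G3) - beta *: (a - b)); move: (G2 - G3) (a - b) => D c.
  rewrite -(@pmulr_rge0 _ ((2 * beta)^-1)) ?invr_gt0 ?mulr_gt0//.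
  have -> : (2 * beta)^-1 * sqnorm (D - beta *: c) =
     (2 * beta)^-1 * sqnorm D - dot D c + beta / 2 * sqnorm c.
    by rewrite !sqnormE !dot_lin (dotC c D); field; rewrite gt_eqF.
  lra.
have y3 : sqnorm a <= 2 * sqnorm b + 2 * sqnorm (a - b).
  by rewrite -{1}(subrKC b a); exact: sqnormD_le.
have h1' : (2 * alpha)^-1 * sqnorm (G1 - G2) <= (2 * alpha)^-1 * (beta ^+ 2 * e).
  by rewrite ler_pM2l ?invr_gt0 ?mulr_gt0.
have h2' : (2 * beta)^-1 * sqnorm (G2 - G3) <= 2^-1 * dot (G2 - G3) b.
  rewrite ler_pdivrMl ?mulr_gt0//.
  suff -> : 2 * beta * (2^-1 * dot (G2 - G3) b) = beta * dot (G2 - G3) b by [].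
  by field.
have y3' : alpha / 2 * sqnorm a <= alpha * sqnorm b + alpha * sqnorm (a - b).
  have := ler_wpM2l (ltW alpha0) y3; lra.
have -> : beta ^+ 2 / (2 * alpha) * e = (2 * alpha)^-1 * (beta ^+ 2 * e) by ring.
move: y1 y2 h3 h1' h2' y3'; rewrite dotDl dotNl (dotDr (G2 - G3)) dotNr.
move: (sqnorm a) (sqnorm b) (sqnorm (a - b)) (sqnorm (G1 - G2)) (sqnorm (G2 - G3)) => sa sb sab
    s12 s23.
rewrite !dotDl !dotNl; lra.
Qed.

(** Strong convexity and smoothness of the mean potential along couplings driven by a common z: the
    pointwise Taylor bounds for the displacement w + z P are integrated. *)
Lemma mean_taylor m A w P :
  let L := mean_potential V m A + (dot (mean_grad V m A) w + \tr (P^T *m A *m mean_hess V m A)) in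
  let q := sqnorm w + \tr (P^T *m P) in
  L + alpha / 2 * q <= mean_potential V (m + w) (A + P) <= L + beta / 2 * q.
Proof.
have ge := Ez_dot_grad C2V alpha0 alphabeta strongV smoothV m A w P.
have qV m' A' := qbnd_potential C2V alpha0 alphabeta strongV smoothV m' A'.
have qg : qbnd (fun z => dot (grad V (m + z *m A)) (w + z *m P)).
  by apply: qbnd_dot => i; [exact: (lbnd_grad C2V alpha0 alphabeta strongV smoothV)|exact:
      lbnd_affine].
have qa : qbnd (fun z : 'rV[R]_n => dot (w + z *m P) (w + z *m P)).
  by apply: qbnd_dot => i; exact: lbnd_affine.
have E c : mean_potential V m A + (dot (mean_grad V m A) w + \tr (P^T *m A *m mean_hess V m A))
    + c * (sqnorm w + \tr (P^T *m P)) =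
    Ez (fun z => V (m + z *m A) + (dot (grad V (m + z *m A)) (w + z *m P)
       + c * dot (w + z *m P) (w + z *m P))).
  rewrite !EzD ?EzZ ?ge ?Ez_dot_affine -?sqnormE ?addrA//; do ?[exact/qbnd_integ].
    exact/qbnd_integ/qbndZ.
  by apply/integD; [exact/qbnd_integ|exact/qbnd_integ/qbndZ].
have q c : integ (fun z => V (m + z *m A) + (dot (grad V (m + z *m A)) (w + z *m P)
       + c * dot (w + z *m P) (w + z *m P))).
  by apply/qbnd_integ/qbndD => //; apply/qbndD => //; exact: qbndZ.
have dE z : m + w + z *m (A + P) - (m + z *m A) = w + z *m P.
  by rewrite mulmxDr; move: (z *m A) (z *m P) => a p; rewrite addrACA [X in X - _]addrC addrK.
rewrite /= !E; apply/andP; split; apply: Ez_le => //; try exact/qbnd_integ.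
  move=> z; have := taylor_lower C2V strongV smoothV (m + z *m A) (m + w + z *m (A + P)).
  by rewrite dE sqnormE addrA.
move=> z; have := taylor_upper C2V strongV smoothV (m + z *m A) (m + w + z *m (A + P)).
by rewrite dE sqnormE addrA.
Qed.

Variables (mhat : 'rV[R]_n) (Shat : 'M[R]_n).
Hypothesis (spdShat : spd Shat).
Hypothesis minF : forall m S, spd S -> (freeF V mhat Shat <= freeF V m S)%E.

Lemma gram_unit A : A^T *m A = Shat -> A \in unitmx.
Proof.
by move=> AA; have := spd_unit spdShat; rewrite -AA unitmx_mul => /andP[].
Qed.

(** By Stein's identity the trace is the mean of <grad V (m + z A), z A>, compared through
    [cross_term_le] with its analogue at the minimizer, which is at most n. The terms in grad V mhat
    are centered and vanish; alpha and beta are both at most beta^2 / alpha, which merges the error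
    terms. *)
Lemma mean_hess_trace_le m A B : B^T *m B = Shat ->
  \tr (A^T *m A *m mean_hess V m A) <= 5 / 2 * n%:R +
   2 * beta ^+ 2 / alpha * (sqnorm (m - mhat) + \tr ((A - B)^T *m (A - B))).
Proof.
move=> BB; pose D := \tr ((A - B)^T *m (A - B)).
have ge m' B' w P := Ez_dot_grad C2V alpha0 alphabeta strongV smoothV m' B' w P.
have dw0 w : dot w 0 = 0 :> R by rewrite /dot trmx0 mulmx0 mxE.
have Q0 m' B' : \tr (B'^T *m B' *m mean_hess V m' B') =
    Ez (fun z => dot (grad V (m' + z *m B')) (0 + z *m B')).
  by rewrite ge dw0 add0r.
pose Qh := Ez (fun z => dot (grad V (mhat + z *m B)) (0 + z *m B)).
have Qn : Qh <= n%:R.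
  rewrite /Qh -Q0.
  exact: (minimizer_trace_le C2V alpha0 alphabeta strongV smoothV minF (gram_unit BB) BB).
rewrite Q0.
have D0 : 0 <= D.
  by have := mxtrace_conj_ge0 (A - B) (spd_spsd (spd1 R n)); rewrite mulmx1.
pose gm := grad V mhat.
pose r z := dot gm (0 + z *m A) + (5 / 2 * dot (grad V (mhat + z *m B)) (0 + z *m B)
  + (- (5 / 2) * dot gm (0 + z *m B)
  + (beta ^+ 2 / (2 * alpha) * dot (m - mhat + z *m (A - B)) (m - mhat + z *m (A - B))
  + (alpha + beta / 2) * dot (0 + z *m (A - B)) (0 + z *m (A - B))))).
have lg m' B' i := lbnd_grad C2V alpha0 alphabeta strongV smoothV m' B' i.
have q0 P : qbnd (fun z => dot gm (0 + z *m P)).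
  by apply: qbnd_dot => i; [exact: lbnd_cst|exact: lbnd_affine].
have q1 w P : qbnd (fun z => dot (w + z *m P) (w + z *m P)).
  by apply: qbnd_dot => i; exact: lbnd_affine.
have q2 m' B' : qbnd (fun z => dot (grad V (m' + z *m B')) (0 + z *m B')).
  by apply: qbnd_dot => i //; exact: lbnd_affine.
have i0 P := qbnd_integ (q0 P); have i1 w P := qbnd_integ (q1 w P).
have i2 m' B' := qbnd_integ (q2 m' B').
have Er : Ez r = 5 / 2 * Qh + beta ^+ 2 / (2 * alpha) * (sqnorm (m - mhat) + D) + (alpha + beta
    / 2) * D.
  rewrite /r 4?EzD ?EzZ //; do ?[by do ?[apply: integD|apply: integZ|by []]].
  rewrite !Ez_dot_centered !Ez_dot_affine !dw0 -sqnormE /Qh; move: (Ez _) => q; rewrite /D;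
      move: (\tr _) => D'; ring.
have ir : integ r by rewrite /r; do ?[apply: integD|apply: integZ|by []].
apply: (@le_trans _ _ (Ez r)).
  apply: Ez_le => // z; rewrite /r.
  have := @cross_term_le (m + z *m A) (mhat + z *m B) mhat (z *m A) (z *m B) erefl.
  have -> : m + z *m A - (mhat + z *m B) = m - mhat + z *m (A - B).
    by rewrite mulmxBr opprD addrACA.
  by rewrite !add0r -mulmxBr !sqnormE -/gm; lra.
rewrite Er.
have ab2 : alpha <= beta ^+ 2 / alpha by rewrite ler_pdivlMr// expr2 ler_pM// ltW.
have b2 : beta <= beta ^+ 2 / alpha by rewrite ler_pdivlMr// expr2 ler_wpM2l// ltW.
have -> : beta ^+ 2 / (2 * alpha) = 2^-1 * (beta ^+ 2 / alpha) by field; rewrite gt_eqF.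
rewrite -(mulrA 2).
move: (beta ^+ 2 / alpha) ab2 b2 => c ab2 b2.
have s0 := sqnorm_ge0 (m - mhat).
have c0 : 0 <= c by apply: le_trans b2; exact: ltW.
have := mulr_ge0 c0 s0; have := mulr_ge0 c0 D0.
have := ler_wpM2r D0 ab2; have := ler_wpM2r D0 b2; lra.
Qed.

Lemma qbnd_ipS_hess m A S P : qbnd (fun z => ipS S (hess V (m + z *m A)) P).
Proof.
rewrite /ipS /mxtrace.
apply: qbnd_sum => i; apply: lbnd_qbnd.
under eq_fun do rewrite -mulmxA mxE.
apply: lbnd_sum => k; under eq_fun do rewrite mxE mulrC.
exact/lbndZ/(lbnd_hess C2V alpha0 alphabeta strongV smoothV).
Qed.

Lemma Ez_ipS_hess m A S P :
  Ez (fun z => ipS S (hess V (m + z *m A)) P) = ipS S (mean_hess V m A) P.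
Proof.
have h i k : integ (fun z => hess V (m + z *m A) i k).
  exact/qbnd_integ/lbnd_qbnd/(lbnd_hess C2V alpha0 alphabeta strongV smoothV).
have E z : ipS S (hess V (m + z *m A)) P =
    \sum_i \sum_k (S *m P) k i * hess V (m + z *m A) k i.
  rewrite /ipS -mulmxA; apply: eq_bigr => i _; rewrite mxE.
  by apply: eq_bigr => k _; rewrite mxE mulrC.
under eq_fun do rewrite E.
rewrite Ez_sum => [|i]; last by apply: integ_sum => k; exact: integZ.
rewrite /ipS -mulmxA; apply: eq_bigr => i _; rewrite mxE Ez_sum => [|k]; last exact: integZ.
by apply: eq_bigr => k _; rewrite EzZ// mulrC !mxE.
Qed.

Lemma ipS_hess_sq_le A x : ipS (A^T *m A) (hess V x) (hess V x) <= beta * ipS (A^T *m A) (hess V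
    x) 1%:M.
Proof.
set h := hess V x; have hT : h^T = h := hess_sym C2V x.
have -> : ipS (A^T *m A) h h = \tr (A^T^T *m (h *m h) *m A^T).
  by rewrite /ipS hT trmxK mxtrace_mulC !mulmxA [LHS]mxtrace_mulC !mulmxA.
have -> : ipS (A^T *m A) h 1%:M = \tr (A^T^T *m h *m A^T).
  by rewrite /ipS hT trmxK mulmx1 mulmxA [LHS]mxtrace_mulC mulmxA.
rewrite !mxtrace_qform mulr_sumr; apply: ler_sum => i _.
rewrite qformE mulmxA dot_mulmx hT -sqnormE.
exact: (hess_sq_le C2V alpha0 alphabeta strongV smoothV).
Qed.

Variable eta : R.
Hypotheses (eta0 : 0 < eta) (eta_le : eta <= alpha ^+ 2 / (48 * beta ^+ 3)).

Lemma step_unit x : 1%:M - eta *: hess V x \in unitmx.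
Proof.
apply: spd_unit; split; first by rewrite raddfB /= trmx1 linearZ /= (hess_sym C2V).
move=> u u0; rewrite -scaleNr qformD qformZ qform1.
have /andP[_ h] := smoothV x u.
have s0 : 0 < sqnorm u by rewrite sqnorm_gt0.
have h2 : eta * qform (hess V x) u <= 48^-1 * sqnorm u.
  apply: (@le_trans _ _ (eta * (beta * sqnorm u))); first by rewrite ler_pM2l.
  by rewrite mulrA ler_pM2r//; exact: (step_size_le alpha0 alphabeta eta_le).
rewrite mulNr; lra.
Qed.

Lemma ipS_gram A P Q : ipS (A^T *m A) P Q = \tr ((A *m P)^T *m (A *m Q)).
Proof. by rewrite /ipS trmx_mul !mulmxA. Qed.

Lemma gcost_gram m A K :
  gcost m mhat (A^T *m A) K = sqnorm (m - mhat) + \tr ((A - A *m K)^T *m (A - A *m K)).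
Proof. by rewrite /gcost ipS_gram mulmxBr mulmx1. Qed.

(** Discharges the three inequalities assumed in [one_step]: smoothness of the mean potential along
    the displacement of the step, its strong convexity towards the minimizer, and minimality tested
    at the next iterate, whose covariance has the factor A (1 + L). *)
Lemma one_step_sample m A K x : A \in unitmx -> K^T *m (A^T *m A) *m K = Shat ->
  let g := mean_grad V m A in let H := mean_hess V m A in
  let S := A^T *m A in let b := grad V x in let h := hess V x in
  let Sp := prox_cov eta ((1%:M - eta *: h) *m S *m (1%:M - eta *: h)) in
  exists Kp, [/\ spd Sp, Kp^T *m Sp *m Kp = Shat &
    gcost (m - eta *: b) mhat Sp Kp <= (1 - alpha * eta) * gcost m mhat S K
    + 2 * eta * (dot (g - b) (m - mhat) + ipS S (H - h) (1%:M - K))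
    + 2 * eta ^+ 2 * (sqnorm (b - g) + ipS S (h - H) (h - H))].
Proof.
move=> uA KAK g H S b h Sp.
have BB : (A *m K)^T *m (A *m K) = Shat by rewrite trmx_mul -KAK !mulmxA.
have uB := gram_unit BB.
have eb2 : eta * beta <= 2^-1 by apply: (le_trans (step_size_le alpha0 alphabeta eta_le)); lra.
have [L [Kp [sSp KSp LSp step]]] := one_step alpha
  (mean_potential V m A) (mean_potential V mhat (A *m K)) H m mhat b g eta0 eb2 (spd_gram uA)
      spdShat (hess_sym C2V x) (step_unit x) KAK.
exists Kp; split; [exact: sSp|exact: KSp|].
pose A' := A *m (1%:M + L).
have A'E : A'^T *m A' = Sp by rewrite -[RHS]LSp /A' trmx_mul !mulmxA.
have uA' : A' \in unitmx by have := spd_unit sSp; rewrite -/Sp -A'E unitmx_mul => /andP[].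
have {}step := step (mean_potential V (m - eta *: b) A').
apply: step.
- have /andP[_] := mean_taylor m A (- (eta *: b)) (A *m L).
  have -> : A + A *m L = A' by rewrite /A' mulmxDr mulmx1.
  rewrite dotNr dotZr !ipS_gram -[_ *m A *m _]mulmxA !sqnormE dotNr dotNl opprK dotZl dotZr -/g -/H.
  move/le_trans; apply.
  move: (\tr _) (\tr _) (mean_potential V m A) (dot g b) (dot b b) => t1 t2 t3 t4 t5; lra.
- have /andP[+ _] := mean_taylor m A (- (m - mhat)) (- (A *m (1%:M - K))).
  have -> : A - A *m (1%:M - K) = A *m K by rewrite mulmxBr mulmx1 opprB addrC subrK.
  rewrite opprB subrKC; apply: le_trans.
  have NT : (- (A *m (1%:M - K)))^T = - (A *m (1%:M - K))^T by rewrite linearN.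
  rewrite /gcost !ipS_gram mulmxA NT !mulNmx mulmxN opprK -(opprB m mhat).
  rewrite dotNr !sqnormE dotNl dotNr opprK [X in _ <= _ + (_ + X) + _]raddfN /= -/g -/H.
  by rewrite !addrA.
- have := minimizer_le C2V alpha0 alphabeta strongV smoothV minF (m - eta *: b) uB BB uA'.
  by rewrite A'E.
Qed.

(* By co-coercivity the quadratic noise is dominated by terms linear in [grad V x]
   and [hess V x], so that first moments suffice. *)
Lemma one_step_mean m A K : A \in unitmx -> K^T *m (A^T *m A) *m K = Shat ->
  exists r : 'rV[R]_n -> R, [/\ qbnd (fun z => r (m + z *m A)),
    Ez (fun z => r (m + z *m A)) <= (1 - alpha * eta / 2) * gcost m mhat (A^T *m A) K
      + 10 * eta ^+ 2 * beta * n%:R &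
    forall x, let Sp := prox_cov eta ((1%:M - eta *: hess V x) *m (A^T *m A) *m (1%:M - eta *:
        hess V x)) in
      exists Kp, [/\ spd Sp, Kp^T *m Sp *m Kp = Shat &
        gcost (m - eta *: grad V x) mhat Sp Kp <= r x]].
Proof.
move=> uA KAK; set S := A^T *m A; have sS : spd S := spd_gram uA.
pose g := mean_grad V m A; pose H := mean_hess V m A; pose c := grad V m.
pose J := gcost m mhat S K; pose k := 2 * eta ^+ 2.
have k0 : 0 <= k by rewrite mulr_ge0 ?sqr_ge0.
(* [r] is the bound of [one_step_sample] with its squares expanded, |grad V x - c|^2 being replaced
   by its co-coercive bound and |hess V x|^2 by beta <hess V x, 1>. The pivot c = grad V m is there
   because co-coercivity compares gradients at two points, whereas [g] is only a mean. *)
pose C0 := (1 - alpha * eta) * J + 2 * eta * (dot g (m - mhat) + ipS S H (1%:M - K))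
  + k * (2 * dot c (g - c) + sqnorm (g - c) + ipS S H H).
pose w := - (2 * eta) *: (m - mhat) - (2 * k) *: (g - c).
pose X := - (2 * eta) *: (1%:M - K) + (k * beta) *: 1%:M - (2 * k) *: H.
pose r x := C0 + (dot (grad V x) (w + (k * beta) *: (x - m))
  + (ipS S (hess V x) X + dot (- (k * beta) *: c) (x - m))).
exists r.
have rE z : r (m + z *m A) = C0 + (dot (grad V (m + z *m A)) (w + z *m ((k * beta) *: A))
  + (ipS S (hess V (m + z *m A)) X + dot (- (k * beta) *: c) (0 + z *m A))).
  by rewrite /r (addrC m (z *m A)) addrK -scalemxAr add0r.
have qg P : qbnd (fun z => dot (grad V (m + z *m A)) (w + z *m P)).
  by apply: qbnd_dot => i; [exact: (lbnd_grad C2V alpha0 alphabeta strongV smoothV)|exact: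
      lbnd_affine].
have qh := qbnd_ipS_hess m A S X.
have qc u : qbnd (fun z : 'rV[R]_n => dot u (0 + z *m A)).
  by apply: qbnd_dot => i; [exact: lbnd_cst|exact: lbnd_affine].
split.
- under eq_fun do rewrite rE.
  by do ?[apply: qbndD => //]; exact: qbnd_cst.
- under eq_fun do rewrite rE.
  rewrite !EzD ?Ez_cst ?Ez_dot_centered ?Ez_ipS_hess ?(Ez_dot_grad C2V alpha0 alphabeta strongV
      smoothV);
    do ?[exact: integ_cst | exact/qbnd_integ | by do ?[apply: integD]; exact/qbnd_integ].
  have Q := @mean_hess_trace_le m A (A *m K).
  rewrite -gcost_gram -/S -/J -/H in Q.
  have {}Q : \tr (S *m H) <= 5 / 2 * n%:R + 2 * beta ^+ 2 / alpha * J.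
    by apply: Q; rewrite trmx_mul -KAK !mulmxA.
  have J0 : 0 <= J by rewrite addr_ge0 ?sqnorm_ge0 ?ipS_ge0//; exact: spd_spsd.
  have HH0 : 0 <= k * ipS S H H by rewrite mulr_ge0 ?ipS_ge0//; exact: spd_spsd.
  have gc0 : 0 <= k * sqnorm (g - c) by rewrite mulr_ge0 ?sqnorm_ge0.
  (* The gradient and Hessian noises each contribute k beta \tr (S H); after averaging, |g - c|^2
     and |H|^2 carry the coefficient - k and are dropped. *)
  have kb0 : 0 <= 2 * (k * beta) by rewrite !mulr_ge0// ltW.
  have Q' := ler_wpM2l kb0 Q.
  have small : 8 * eta ^+ 2 * beta ^+ 3 / alpha * J <= alpha * eta / 2 * J.
    rewrite ler_wpM2r// ler_pdivrMr//.
    have h : eta * (48 * beta ^+ 3) <= alpha ^+ 2.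
      by rewrite -ler_pdivlMr ?mulr_gt0 ?exprn_gt0.
    have := ler_wpM2l (ltW eta0) h; have : 0 <= eta * alpha ^+ 2 by rewrite mulr_ge0 ?sqr_ge0 ?ltW.
    lra.
  have -> : \tr (((k * beta) *: A)^T *m A *m mean_hess V m A) = k * beta * \tr (S *m H).
    by rewrite linearZ /= -!scalemxAl mxtraceZ.
  have H1 : ipS S H 1%:M = \tr (S *m H).
    by rewrite /ipS (mean_hess_sym C2V) mulmx1 mxtrace_mulC.
  have -> : ipS S (mean_hess V m A) X = - (2 * eta) * ipS S H (1%:M - K) + k * beta * \tr (S *m
      H) - 2 * k * ipS S H H.
    by rewrite -H1 /X -/H; move: (1%:M - K) => D; rewrite !ipSDr ipSNr !ipSZr.
  have -> : dot (mean_grad V m A) w = - (2 * eta) * dot g (m - mhat) - 2 * k * dot g (g - c).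
    by rewrite /w -/g; move: (m - mhat) (g - c) => d e; rewrite dotDr dotNr !dotZr.
  have gcE : 2 * dot c (g - c) - 2 * dot g (g - c) = - (2 * sqnorm (g - c)).
    by rewrite sqnormE (dotDl g) dotNl; lra.
  have gcE' : k * (2 * dot c (g - c)) - k * (2 * dot g (g - c)) = - (2 * (k * sqnorm (g - c))).
    by rewrite -mulrBr gcE; ring.
  move: Q' HH0 gc0 gcE' small; rewrite -/J /k.
  move: (\tr _) (ipS S H (1%:M - K)) (ipS S H H) (dot g (m - mhat)) (dot c _) (dot g (g - c))
      (sqnorm _) (J) => t1 t2 t3 t4 t5 t6 t7 J' *.
  lra.
- move=> x /=; have [Kp [h1 h2 h3]] := @one_step_sample m A K x uA KAK.
  exists Kp; split; [exact: h1|exact: h2|apply: (le_trans h3)].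
  have coc := ler_wpM2l k0 (grad_cocoercive C2V alpha0 alphabeta strongV smoothV m x).
  have hh := ler_wpM2l k0 (ipS_hess_sq_le A x).
  rewrite -/S -/c in coc hh; rewrite -/S -/g -/H -/J -/k /r /C0 /w /X.
  move: coc hh; move: (grad V x) (hess V x) (x - m) (m - mhat) (1%:M - K) => b h y d D.
  have SS : S^T = S := sS.1.
  rewrite !sqnormE !ipS_lin !dot_lin (ipSC H h SS) (dotC g b) (dotC c b) (dotC c g).
  move: (k) (J) => k' J'.
  lra.
Qed.

(** The bound is a convex combination of the current cost and the stationary level, a form preserved
    by the recursion cost' <= rho cost + (1 - rho) B. Quantifying over [K] lets the induction
    hypothesis be applied separately at each sample. *)
Lemma expected_W2sq_le k m S K : spd S -> K^T *m S *m K = Shat ->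
  (expected_W2sq V eta (gauss mhat Shat) k (m, S) <=
   ((1 - alpha * eta / 2) ^+ k * gcost m mhat S K
    + (1 - (1 - alpha * eta / 2) ^+ k) * (24 * beta * eta * n%:R / alpha))%:E)%E.
Proof.
have rho0 : 0 <= 1 - alpha * eta / 2.
  have h1 : alpha * eta <= eta * beta by rewrite mulrC ler_pM2l.
  have := (step_size_le alpha0 alphabeta eta_le); lra.
elim: k m S K => [|k IH] m S K sS.
  have [A sA AA] := spd_sqrt sS; rewrite -AA -[X in X *m A](sA.1) => KAK.
  have BB : (A *m K)^T *m (A *m K) = Shat by rewrite trmx_mul -KAK !mulmxA.
  rewrite /= expr0 subrr mul0r mul1r addr0 -BB gcost_gram.
  by apply: W2sq_le; [exact: spd_unit|exact: gram_unit BB].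
have [A sA AA] := spd_sqrt sS; rewrite -AA -[X in X *m A](sA.1) => KAK.
have uA := spd_unit sA.
have [r [qr Er rP]] := one_step_mean m uA KAK.
set rho := 1 - alpha * eta / 2 in rho0 IH Er *; set B := _ / alpha in IH *.
have q : qbnd (fun z => rho ^+ k * r (m + z *m A) + (1 - rho ^+ k) * B).
  by apply: qbndD; [exact: qbndZ|exact: qbnd_cst].
rewrite /=; apply: (@le_trans _ _ (gauss_int m (A^T *m A) (fun x => (rho ^+ k * r x + (1 - rho
    ^+ k) * B)%:E))).
  apply: ge0_le_gauss_int => x; first exact: expected_W2sq_ge0.
  have [Kp [sSp KSp le_r]] := rP x.
  apply: le_trans (IH _ _ _ sSp KSp) _.
  by rewrite lee_fin lerD2r ler_wpM2l// exprn_ge0.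
rewrite (gauss_int_Ez uA (f := fun x => rho ^+ k * r x + (1 - rho ^+ k) * B) q) lee_fin.
rewrite EzD ?Ez_cst ?EzZ; [|exact: qbnd_integ|exact/qbnd_integ/qbndZ|exact: integ_cst].
(* With [B] = 24 beta eta n / alpha, (1 - rho) B equals 12 eta^2 beta n, above the noise of one
   step. *)
have noise : 10 * eta ^+ 2 * beta * n%:R <= (1 - rho) * B.
  have -> : (1 - rho) * B = 12 * eta ^+ 2 * beta * n%:R.
    by rewrite /rho /B; field; rewrite gt_eqF.
  have : 0 <= eta ^+ 2 * beta * n%:R by rewrite !mulr_ge0 ?sqr_ge0// ltW.
  lra.
have alg (p s c e b J : R) : p * s <= p * (c * J + e) -> p * e <= p * ((1 - c) * b) ->
    p * s + (1 - p) * b <= c * p * J + (1 - c * p) * b by lra.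
rewrite (exprS rho k).
exact: (alg _ _ _ _ _ _ (ler_wpM2l (exprn_ge0 k rho0) Er) (ler_wpM2l (exprn_ge0 k rho0) noise)).
Qed.

End Contraction.

Theorem mainTheorem6 (R : realType) (d : nat) (V : 'rV[R]_d -> R)
  (alpha beta eta : R) (mhat : 'rV[R]_d) (Shat : 'M[R]_d)
  (m0 : 'rV[R]_d) (S0 : 'M[R]_d) (N : nat) :
  C2 V ->
  0 < alpha -> alpha <= beta ->
  strongly_convex alpha V -> smooth beta V ->
  spd Shat ->
  (forall (m : 'rV[R]_d) (S : 'M[R]_d), spd S ->
     (freeF V mhat Shat <= freeF V m S)%E) ->
  0 < eta -> eta <= alpha ^+ 2 / (48 * beta ^+ 3) ->
  spd S0 ->
  (expected_W2sq V eta (gauss mhat Shat) N (m0, S0)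
   <= (expR (- (alpha * N%:R * eta) / 2))%:E
        * W2sq (gauss m0 S0) (gauss mhat Shat)
      + (24 * beta * eta * d%:R / alpha)%:E)%E.
Proof.
move=> C2V alpha0 alphabeta strongV smoothV spdShat minF eta0 eta_le sS.
have [T sT TST] := brenier_map_exists sS spdShat.
have TT : T^T *m S0 *m T = Shat by rewrite sT.1.
have := expected_W2sq_le C2V alpha0 alphabeta strongV smoothV spdShat minF eta0 eta_le N m0 sS TT.
have [A sA AA] := spd_sqrt sS; have [B sB BB] := spd_sqrt spdShat.
have low := @W2sq_ge R d m0 mhat A B T (spd_unit sA) (spd_unit sB) sT.
rewrite sA.1 sB.1 AA BB in low; have {}low := low TST.
move=> /le_trans; apply.
have rho0 : 0 <= 1 - alpha * eta / 2.
  have h1 : alpha * eta <= eta * beta by rewrite mulrC ler_pM2l.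
  have := (step_size_le alpha0 alphabeta eta_le); lra.
have beta0 : 0 < beta := lt_le_trans alpha0 alphabeta.
have rhoN : (1 - alpha * eta / 2) ^+ N <= expR (- (alpha * N%:R * eta) / 2).
  have -> : - (alpha * N%:R * eta) / 2 = N%:R * (- (alpha * eta / 2)) by lra.
  rewrite expRM_natl lerXn2r ?nnegrE ?expR_ge0//.
  by rewrite -[leLHS]/(1 + _) expR_ge1Dx.
have J0 : 0 <= gcost m0 mhat S0 T by rewrite addr_ge0 ?sqnorm_ge0 ?ipS_ge0//; exact: spd_spsd.
rewrite EFinD leeD//.
  apply: (@le_trans _ _ ((expR (- (alpha * N%:R * eta) / 2))%:E * (gcost m0 mhat S0 T)%:E)%E).
    by rewrite -EFinM lee_fin ler_wpM2r.
  by rewrite lee_wpmul2l// lee_fin expR_ge0.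
rewrite lee_fin ler_piMl//.
  by rewrite !mulr_ge0 ?invr_ge0// ltW.
by rewrite lerBlDr lerDl exprn_ge0.
Qed.
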